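(* Two quantum Hadamard graphs, arising from quantum Hadamard matrices over finite quantum spaces $X$ and $X'$, are quantum isomorphic if and only if $X$ and $X'$ are quantum isomorphic (i.e. if and only if $\delta=\delta'$).
   Context: A finite quantum space $X$ is a special Frobenius $*$-algebra $C(X)$: a finite-dimensional unital $*$-algebra over $\mathbb{C}$ with multiplication $m$, unit map $\eta\colon\mathbb{C}\to C(X)$, and a positive functional $\psi$ such that $(a,b)\mapsto\psi(ab)$ is non-degenerate and $mm^\dagger=\mathrm{id}$, where $\dagger$ is the adjoint with respect to $\langle a,b\rangle=\psi(a^*b)$. Then $\psi=\eta^\dagger$. The resulting Hilbert space is $l^2(X)$; put $\delta:=\sqrt{\eta^\dagger\eta}>0$ and $R:=m^\dagger\eta$, so $R^\dagger=\eta^\dagger m$. Primed symbols refer to $X'$. For $A,B\colon l^2(X)\to l^2(X)$ put $A^*:=(\mathrm{id}\otimes R^\dagger)(\mathrm{id}\otimes A^\dagger\otimes\mathrm{id})(R\otimes\mathrm{id})$ and $A\bullet B:=m(A\otimes B)m^\dagger$. A quantum Hadamard matrix over $X$ is a linear map $H\colon l^2(X)\to l^2(X)$ with $H=H^*$, $H\bullet H=\eta\eta^\dagger$ and $HH^\dagger=\delta^2\,\mathrm{id}=H^\dagger H$. Quantum Hadamard graph of $H$: put $J=\eta\eta^\dagger$, $H^\pm=\frac12(J\pm H)$, and let $Y=X\sqcup X\sqcup X\sqcup X$, i.e. $C(Y)=C(X)^{\oplus4}$ with functional the sum of the four copies of $\psi$. The quantum Hadamard graph is the pair $(Y,A)$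 with adjacency matrix $A\colon l^2(Y)\to l^2(Y)$, $$A=\begin{pmatrix}0&0&H^+&H^-\\0&0&H^-&H^+\\H^{+\dagger}&H^{-\dagger}&0&0\\H^{-\dagger}&H^{+\dagger}&0&0\end{pmatrix}.$$ For linear maps $T_i$ between tensor powers of a Hilbert space, $\langle T_1,\dots,T_n\rangle$ denotes the smallest set of linear maps between tensor powers containing the $T_i$ and the identities and closed under composition, tensor product, linear combinations and adjoints. Finite quantum spaces $X,X'$ are quantum isomorphic if $m\mapsto m'$, $\eta^\dagger\mapsto\eta'^\dagger$ extends to a monoidal $\dagger$-isomorphism $\langle m,\eta^\dagger\rangle\to\langle m',\eta'^\dagger\rangle$. Quantum graphs $(Y,A)$, $(Y',A')$ are quantum isomorphic if $m_Y\mapsto m_{Y'}$, $\eta_Y^\dagger\mapsto\eta_{Y'}^\dagger$, $A\mapsto A'$ extends to a monoidal $\dagger$-isomorphism $\langle m_Y,\eta_Y^\dagger,A\rangle\to\langle m_{Y'},\eta_{Y'}^\dagger,A'\rangle$; equivalently, there is a unitary $u\in\mathscr{L}(l^2(Y),l^2(Y'))\otimes\mathscr{A}$ for some nonzero $*$-algebra $\mathscr{A}$ with $um_Y=m_{Y'}(u\otimes u)$, $\eta_{Y'}^\dagger u=\eta_Y^\dagger$ and $uA=A'u$. *)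

(* Defs.v *)
From HB Require Import structures.
From mathcomp Require Import all_boot all_order all_algebra all_field.
From mathcomp Require Import boolp classical_sets functions reals.
From mathcomp Require Import complex.

Set Implicit Arguments.
Unset Strict Implicit.
Unset Printing Implicit Defensive.

Import Order.TTheory GRing.Theory Num.Theory.
Local Open Scope ring_scope.

Set Warnings "-redundant-canonical-projection".
HB.instance Definition _ (K : fieldType) (A B : falgType K) :=
  GRing.UnitAlgebra.on (A * B)%type.
Set Warnings "redundant-canonical-projection".

(* The k-th tensor power of V is modelled as the space of coordinate families  *)
(* over multi-indices i : 'I_k -> 'I_(dim V), with respect to vbasis {:V};     *)
(* tpure v is v_0 (x) ... (x) v_(k-1), and tlift F is the linear map sending   *)
(* tpure v to F v for F multilinear (it is defined by its values on the basis, *)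
(* so it is linear whatever F is).                                             *)
Section TensorPowers.
Variables (K : fieldType) (V : vectType K).
Implicit Types k l : nat.

Definition tidx k : finType := {ffun 'I_k -> 'I_(\dim {:V})}.
Definition tpow k : vectType K := {ffun tidx k -> K^o}.

Definition tpure k (v : {ffun 'I_k -> V}) : tpow k :=
  [ffun i : tidx k => \prod_(s < k) coord (vbasis {:V}) (i s) (v s)].

Definition tbasis k (i : tidx k) : {ffun 'I_k -> V} :=
  [ffun s => (vbasis {:V})`_(i s)].

Definition tlift k (W : vectType K) (F : {ffun 'I_k -> V} -> W) :
    'Hom(tpow k, W) :=
  linfun (fun x : tpow k => \sum_(i : tidx k) x i *: F (tbasis i)).

Definition tleft (T : Type) k l (v : {ffun 'I_(k + l) -> T}) :
  {ffun 'I_k -> T} := [ffun s => v (lshift l s)].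
Definition tright (T : Type) k l (v : {ffun 'I_(k + l) -> T}) :
  {ffun 'I_l -> T} := [ffun s => v (rshift k s)].

Definition tcat k l (x : tpow k) (y : tpow l) : tpow (k + l) :=
  [ffun i : tidx (k + l) => x (tleft i) * y (tright i)].

Definition tmap k k' l l' (f : 'Hom(tpow k, tpow k'))
    (g : 'Hom(tpow l, tpow l')) : 'Hom(tpow (k + l), tpow (k' + l')) :=
  tlift (fun v : {ffun 'I_(k + l) -> V} =>
    tcat (f (tpure (tleft v))) (g (tpure (tright v)))).

Definition tendo (f : 'End(V)) : 'End(tpow 1) :=
  tlift (fun v : {ffun 'I_1 -> V} => tpure [ffun => f (v ord0)]).

End TensorPowers.

Section Adjoint.
Variables (K : fieldType) (U W : vectType K).
Variables (bU : U -> U -> K) (bW : W -> W -> K).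

Definition is_adjoint (f : 'Hom(U, W)) (g : 'Hom(W, U)) : Prop :=
  forall w u, bU (g w) u = bW w (f u).

Definition adjoint (f : 'Hom(U, W)) : 'Hom(W, U) :=
  xget 0 [set g | is_adjoint f g].

End Adjoint.

Section FrobeniusStructure.
Variable R : realType.
Local Notation C := R[i].

Record frob_data := FrobData {
  falg :> falgType C;
  fstar : falg -> falg;
  fpsi : {scalar falg}
}.

Variable X : frob_data.

Definition finner (a b : X) : C := fpsi X (fstar a * b).

(* The sesquilinear extension of                                           *)
(* <a_1 (x) ... (x) a_k, b_1 (x) ... (x) b_k> = \prod_s <a_s, b_s>.        *)
Definition tinner k (x y : tpow X k) : C :=
  \sum_(i : tidx X k) \sum_(j : tidx X k)
    (x i)^* * y j * \prod_(s < k) finner (tbasis i s) (tbasis j s).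

Definition dagger k l (f : 'Hom(tpow X k, tpow X l)) :
    'Hom(tpow X l, tpow X k) :=
  adjoint (@tinner k) (@tinner l) f.

Definition fmul : 'Hom(tpow X 2, tpow X 1) :=
  tlift (fun v : {ffun 'I_2 -> X} => tpure [ffun => v ord0 * v ord_max]).

Definition funit : 'Hom(tpow X 0, tpow X 1) :=
  tlift (fun _ : {ffun 'I_0 -> X} => tpure [ffun => 1]).

(* The same unit map C -> C(X) and adjoints of endomorphisms, on C(X) itself *)
(* instead of its first tensor power.                                        *)
Definition unit_map : 'Hom(C^o, X) := linfun (fun c : C^o => c *: (1 : X)).
Definition unit_dag : 'Hom(X, C^o) :=
  adjoint (fun c d : C^o => c^* * d) finner unit_map.
Definition edagger (f : 'End(X)) : 'End(X) := adjoint finner finner f.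

Definition delta : C := sqrtC (unit_dag (unit_map 1)).

Definition star_algebra_axiom : Prop :=
  [/\ involutive (@fstar X),
      forall (c : C) (a b : X), fstar (c *: a + b) = c^* *: fstar a + fstar b
    & forall a b : X, fstar (a * b) = fstar b * fstar a].

Definition finite_quantum_space_axiom : Prop :=
  [/\ star_algebra_axiom,
      forall a : X, 0 <= fpsi X (fstar a * a),
      (forall a : X, (forall b, fpsi X (a * b) = 0) -> a = 0) /\
      (forall b : X, (forall a, fpsi X (a * b) = 0) -> b = 0)
    & (fmul \o dagger fmul)%VF = \1%VF].

End FrobeniusStructure.

Section TensorTheory.
Variables (K : fieldType) (V : vectType K).

Lemma coord_vbasisf (v : V) :
  v = \sum_(i < \dim {:V}) coord (vbasis {:V}) i v *: (vbasis {:V})`_i.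
Proof. exact: coord_vbasis (memvf v). Qed.

Lemma coord_vbasis_nth (i j : 'I_(\dim {:V})) :
  coord (vbasis {:V}) i (vbasis {:V})`_j = (i == j)%:R.
Proof. by rewrite coord_free ?(basis_free (vbasisP _)) // eq_sym. Qed.

Lemma tpure_tbasis k (i j : tidx V k) : tpure (tbasis i) j = (i == j)%:R.
Proof.
rewrite ffunE; have [->|/eqP neq] := eqVneq i j.
  by rewrite big1 // => s _; rewrite ffunE coord_vbasis_nth eqxx.
have [s ns] : exists s, i s != j s.
  by apply/existsP; apply: contra_notT neq => /existsPn H; apply/ffunP => s;
     apply/eqP; move: (H s); rewrite negbK.
by rewrite (bigD1 s) //= ffunE coord_vbasis_nth eq_sym (negPf ns) mul0r.
Qed.

Lemma tpow_basis k (x : tpow V k) : x = \sum_i x i *: tpure (tbasis i).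
Proof.
apply/ffunP => j; rewrite sum_ffunE (bigD1 j) //= big1 ?addr0 => [|i ne].
  by rewrite ffunE tpure_tbasis eqxx /GRing.scale /= mulr1.
by rewrite ffunE tpure_tbasis (negPf ne) scaler0.
Qed.

Lemma tliftE k (W : vectType K) (F : {ffun 'I_k -> V} -> W) x :
  tlift F x = \sum_i x i *: F (tbasis i).
Proof.
pose G := fun x : tpow V k => \sum_i x i *: F (tbasis i).
have G_lin : linear G.
  move=> a u v; rewrite /G scaler_sumr -big_split; apply: eq_bigr => i _.
  by rewrite !ffunE scalerDl scalerA.
pose GL : {linear tpow V k -> W} := HB.pack G
  (GRing.isLinear.Build _ _ _ _ G G_lin).
exact: (lfunE GL).
Qed.

Lemma tlift_basis k (W : vectType K) (F : {ffun 'I_k -> V} -> W) i :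
  tlift F (tpure (tbasis i)) = F (tbasis i).
Proof.
rewrite tliftE (bigD1 i) //= big1 ?addr0 => [|j ne].
  by rewrite tpure_tbasis eqxx scale1r.
by rewrite tpure_tbasis eq_sym (negPf ne) scale0r.
Qed.

Lemma eq_tpow k (W : vectType K) (f g : 'Hom(tpow V k, W)) :
  (forall v, f (tpure v) = g (tpure v)) -> f = g.
Proof.
move=> fg; apply/lfunP => x; rewrite (tpow_basis x) !linear_sum.
by apply: eq_bigr => i _; rewrite !linearZ /= fg.
Qed.

Lemma tmulE (W : vectType K) (x : {ffun 'I_2 -> V}) (F : V -> V -> W) :
    (forall a u u' v, F (a *: u + u') v = a *: F u v + F u' v) ->
    (forall a u v v', F u (a *: v + v') = a *: F u v + F u v') ->
  tlift (fun v : {ffun 'I_2 -> V} => F (v ord0) (v ord_max)) (tpure x)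
    = F (x ord0) (x ord_max).
Proof.
move=> F1 F2; rewrite tliftE.
have suml v (I : finType) (c : I -> K) (u : I -> V) :
    F (\sum_i c i *: u i) v = \sum_i c i *: F (u i) v.
  have F0 : F 0 v = 0.
    by have := F1 (-1) 0 0 v; rewrite scaler0 addr0 scaleN1r addNr.
  by apply: (big_rec2 (fun a b => F a v = b)) => // i a b _ <-; rewrite F1.
have sumr v (I : finType) (c : I -> K) (u : I -> V) :
    F v (\sum_i c i *: u i) = \sum_i c i *: F v (u i).
  have F0 : F v 0 = 0.
    by have := F2 (-1) v 0 0; rewrite scaler0 addr0 scaleN1r addNr.
  by apply: (big_rec2 (fun a b => F v a = b)) => // i a b _ <-; rewrite F2.
rewrite [in RHS](coord_vbasisf (x ord0)) [in RHS](coord_vbasisf (x ord_max)).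
rewrite suml (eq_bigr _ (fun i _ => congr1 _ (sumr _ _ _ _))).
under eq_bigr do rewrite scaler_sumr.
rewrite pair_big /=.
pose h (p : 'I_(\dim {:V}) * 'I_(\dim {:V})) : tidx V 2 :=
  [ffun s => if s == ord0 then p.1 else p.2].
rewrite (reindex h) /=.
  apply: eq_bigr => -[i j] _; rewrite !ffunE !big_ord_recl big_ord0 mulr1 scalerA.
  by rewrite !ffunE /= (_ : lift ord0 ord0 = ord_max) //; apply: val_inj.
exists (fun i => (i ord0, i ord_max)) => [[i j] _|i _] /=; first by rewrite !ffunE.
apply/ffunP => s; rewrite ffunE; case: eqP => [->//|ns].
by congr (i _); apply/val_inj; case: s ns => -[|[|s]] //= lt [];
   apply/val_inj.
Qed.

End TensorTheory.

Section Functor.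
Variables (K : fieldType) (V W : vectType K) (h : 'Hom(V, W)).

Definition tfun k : 'Hom(tpow V k, tpow W k) :=
  tlift (fun v : {ffun 'I_k -> V} => tpure [ffun s => h (v s)]).

Lemma tfunE k (v : {ffun 'I_k -> V}) :
  tfun k (tpure v) = tpure [ffun s => h (v s)].
Proof.
apply/ffunP => j; rewrite tliftE sum_ffunE ffunE.
under [RHS]eq_bigr => s _.
  rewrite ffunE {1}(coord_vbasisf (v s)) !linear_sum.
  under eq_bigr do rewrite !linearZ /=.
over.
rewrite bigA_distr_bigA /=; apply: eq_bigr => i _.
rewrite !ffunE /GRing.scale /= -big_split; apply: eq_bigr => s _.
by rewrite !ffunE.
Qed.

End Functor.

Section TensorMap.
Variables (K : fieldType) (V : vectType K).

Definition tjoin (T : Type) k l (p : {ffun 'I_k -> T} * {ffun 'I_l -> T}) :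
    {ffun 'I_(k + l) -> T} :=
  [ffun s : 'I_(k + l) => match fintype.split s with inl a => p.1 a | inr b => p.2 b end].

Lemma tjoinK (T : Type) k l :
  cancel (@tjoin T k l) (fun v => (tleft v, tright v)).
Proof.
by move=> [v w]; congr (_, _); apply/ffunP => s; rewrite !ffunE;
   [rewrite -[lshift l s]/(unsplit (inl s)) | rewrite -[rshift k s]/(unsplit (inr s))];
   rewrite unsplitK.
Qed.

Lemma tsplitK (T : Type) k l :
  cancel (fun v => (tleft v, tright v)) (@tjoin T k l).
Proof.
by move=> v; apply/ffunP => s; rewrite -(fintype.splitK s) ffunE unsplitK;
   case: (fintype.split s) => t; rewrite ffunE.
Qed.

Lemma tpure_tcat k l (v : {ffun 'I_(k + l) -> V}) :
  tpure v = tcat (tpure (tleft v)) (tpure (tright v)).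
Proof.
apply/ffunP => i; rewrite !ffunE big_split_ord.
by congr (_ * _); apply: eq_bigr => s _; rewrite !ffunE.
Qed.

Lemma tmapE k k' l l' (f : 'Hom(tpow V k, tpow V k'))
    (g : 'Hom(tpow V l, tpow V l')) x y :
  tmap f g (tcat x y) = tcat (f x) (g y).
Proof.
rewrite /tmap tliftE (reindex (@tjoin _ k l)) /=; last first.
  by apply: onW_bij; exists (fun v => (tleft v, tright v));
     [exact: tjoinK | exact: tsplitK].
rewrite [in RHS](tpow_basis x) [in RHS](tpow_basis y) !linear_sum.
apply/ffunP => j; rewrite sum_ffunE !ffunE !sum_ffunE mulr_suml.
under [in RHS]eq_bigr do rewrite mulr_sumr.
rewrite pair_big; apply: eq_bigr => p _ /=.
have [pl pr] : tleft (tjoin p) = p.1 /\ tright (tjoin p) = p.2.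
  by have := tjoinK p; case: p => a b /= [-> ->].
have [tl tr] : tleft (tbasis (tjoin p)) = tbasis p.1 :> {ffun 'I_k -> V} /\
               tright (tbasis (tjoin p)) = tbasis p.2 :> {ffun 'I_l -> V}.
  split; apply/ffunP => s; rewrite [LHS]ffunE [LHS]ffunE [RHS]ffunE.
    by rewrite -[in RHS]pl [in RHS]ffunE.
  by rewrite -[in RHS]pr [in RHS]ffunE.
rewrite !linearZ /= !ffunE pl pr tl tr /GRing.scale /=.
by rewrite mulrACA.
Qed.

Lemma tendoE (f : 'End(V)) v : tendo f (tpure v) = tpure [ffun=> f (v ord0)].
Proof.
have -> : tendo f = tfun f 1.
  apply/lfunP => x; rewrite !tliftE; apply: eq_bigr => i _.
  by congr (_ *: tpure _); apply/ffunP => s; rewrite [LHS]ffunE [RHS]ffunE (ord1 s).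
by rewrite tfunE; congr tpure; apply/ffunP => s; rewrite !ffunE ord1.
Qed.

End TensorMap.

Section Representation.
Variables (K : numClosedFieldType) (V : vectType K) (b : V -> V -> K).
Hypothesis b_conj : forall a u u' v, b (a *: u + u') v = a^* * b u v + b u' v.
Hypothesis b_lin : forall a u v v', b u (a *: v + v') = a * b u v + b u v'.
Hypothesis b_nl : forall u, (forall v, b u v = 0) -> u = 0.
Hypothesis b_nr : forall v, (forall u, b u v = 0) -> v = 0.
Local Notation e := (vbasis {:V}).

Lemma form_sumr u (I : finType) (c : I -> K) (v : I -> V) :
  b u (\sum_i c i *: v i) = \sum_i c i * b u (v i).
Proof.
have b0 : b u 0 = 0.
  by have := b_lin (-1) u 0 0; rewrite scaler0 addr0 mulN1r addNr.
by apply: (big_rec2 (fun a c => b u a = c)) => // i x y _ <-; rewrite b_lin.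
Qed.

Lemma form_suml u (I : finType) (c : I -> K) (v : I -> V) :
  b (\sum_i c i *: v i) u = \sum_i (c i)^* * b (v i) u.
Proof.
have b0 : b 0 u = 0.
  by have := b_conj (-1) 0 0 u; rewrite scaler0 addr0 rmorphN1 mulN1r addNr.
by apply: (big_rec2 (fun a c => b a u = c)) => // i x y _ <-; rewrite b_conj.
Qed.

Lemma basis_coef0 (c : 'I_(\dim {:V}) -> K) :
  \sum_i c i *: e`_i = 0 -> forall i, c i = 0.
Proof.
move=> /(congr1 (fun v => coord e ^~ v)) E i; have := congr1 (@^~ i) E.
rewrite /= linear0 linear_sum (bigD1 i) //= big1 ?addr0 => [|j ne].
  by rewrite linearZ /= coord_vbasis_nth eqxx mulr1.
by rewrite linearZ /= coord_vbasis_nth eq_sym (negPf ne) mulr0.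
Qed.

Lemma form_repr (phi : 'Hom(V, K^o)) : exists w, forall u, b w u = phi u.
Proof.
pose T := fun w => \sum_(i < \dim {:V}) (b w e`_i)^* *: e`_i.
have T_lin : linear T.
  move=> a u v; rewrite /T scaler_sumr -big_split; apply: eq_bigr => i _.
  by rewrite b_conj rmorphD rmorphM /= conjCK scalerDl scalerA.
pose TL : {linear V -> V} := HB.pack T (GRing.isLinear.Build _ _ _ _ T T_lin).
have Tinj : lker (linfun TL) == 0%VS.
  apply/lker0P => u v; rewrite !lfunE /= => Tuv; apply/eqP; rewrite -subr_eq0.
  apply/eqP; apply: b_nl => z; rewrite (coord_vbasisf z) form_sumr big1 // => i _.
  suff -> : b (u - v) e`_i = 0 by rewrite mulr0.
  have: T (u - v) = 0 by rewrite -[T _]/(TL _) linearB /= Tuv subrr.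
  by move=> /basis_coef0/(_ i)/eqP; rewrite conjC_eq0 => /eqP.
have := lker0_lfunVK Tinj (\sum_(i < \dim {:V}) (phi e`_i)^* *: e`_i).
set w := ((_^-1)%VF _); rewrite lfunE /= => Tw; exists w => u.
rewrite (coord_vbasisf u) form_sumr linear_sum; apply: eq_bigr => i _.
rewrite linearZ /=; congr (_ * _).
have: \sum_(i < \dim {:V}) ((b w e`_i)^* - (phi e`_i)^*) *: e`_i = 0.
  by under eq_bigr do rewrite scalerBl; rewrite sumrB -Tw subrr.
by move=> /basis_coef0/(_ i)/eqP; rewrite subr_eq0 => /eqP/(can_inj conjCK).
Qed.

Lemma form_dual : exists d : 'I_(\dim {:V}) -> V,
  forall i j : 'I_(\dim {:V}), b e`_i (d j) = (i == j)%:R.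
Proof.
pose T := fun w => \sum_(i < \dim {:V}) b e`_i w *: e`_i.
have T_lin : linear T.
  move=> a u v; rewrite /T scaler_sumr -big_split; apply: eq_bigr => i _.
  by rewrite b_lin scalerDl scalerA.
pose TL : {linear V -> V} := HB.pack T (GRing.isLinear.Build _ _ _ _ T T_lin).
have Tinj : lker (linfun TL) == 0%VS.
  apply/lker0P => u v; rewrite !lfunE /= => Tuv; apply/eqP; rewrite -subr_eq0.
  apply/eqP; apply: b_nr => z; rewrite (coord_vbasisf z) form_suml big1 // => i _.
  suff -> : b e`_i (u - v) = 0 by rewrite mulr0.
  have: T (u - v) = 0 by rewrite -[T _]/(TL _) linearB /= Tuv subrr.
  by move=> /basis_coef0/(_ i).
exists (fun j => (linfun TL)^-1%VF e`_j) => i j.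
have := lker0_lfunVK Tinj e`_j; set w := ((_^-1)%VF _); rewrite lfunE /= => Tw.
have: \sum_(i < \dim {:V}) (b e`_i w - (i == j)%:R) *: e`_i = 0.
  under eq_bigr do rewrite scalerBl; rewrite sumrB [X in X - _]Tw.
  rewrite (bigD1 j) //= eqxx scale1r big1 ?addr0 ?subrr // => k /negPf ->.
  by rewrite scale0r.
by move=> /basis_coef0/(_ i)/eqP; rewrite subr_eq0 => /eqP.
Qed.

End Representation.

Section AdjointTheory.
Variables (K : numClosedFieldType) (U W : vectType K).
Variables (bU : U -> U -> K) (bW : W -> W -> K).
Hypothesis bU_conj : forall a u u' v, bU (a *: u + u') v = a^* * bU u v + bU u' v.
Hypothesis bU_lin : forall a u v v', bU u (a *: v + v') = a * bU u v + bU u v'.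
Hypothesis bU_nl : forall u, (forall v, bU u v = 0) -> u = 0.
Hypothesis bW_conj : forall a u u' v, bW (a *: u + u') v = a^* * bW u v + bW u' v.
Hypothesis bW_lin : forall a u v v', bW u (a *: v + v') = a * bW u v + bW u v'.

Lemma is_adjoint_uniq f g g' :
  is_adjoint bU bW f g -> is_adjoint bU bW f g' -> g = g'.
Proof.
move=> Hg Hg'; apply/lfunP => w; apply/eqP; rewrite -subr_eq0; apply/eqP.
apply: bU_nl => u; rewrite (_ : g w - g' w = -1 *: g' w + g w).
  by rewrite bU_conj Hg Hg' rmorphN1 mulN1r addNr.
by rewrite scaleN1r addrC.
Qed.

Lemma adjointP f : is_adjoint bU bW f (adjoint bU bW f).
Proof.
suff [g Hg] : exists g, is_adjoint bU bW f g by exact: (xgetI 0 Hg).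
have repr w : exists z, forall u, bU z u = bW w (f u).
  pose p : U -> K^o := fun u => bW w (f u).
  have p_lin : linear p by move=> a u v; rewrite /p linearP bW_lin.
  pose pL : {linear U -> K^o} :=
    HB.pack p (GRing.isLinear.Build _ _ _ _ p p_lin).
  have [z Hz] := form_repr bU_conj bU_lin bU_nl (linfun pL).
  by exists z => u; rewrite Hz lfunE.
have [g Hg] := choice repr.
have g_lin : linear g.
  move=> a w w'; apply/eqP; rewrite -subr_eq0; apply/eqP; apply: bU_nl => u.
  rewrite (_ : _ - _ = -1 *: (a *: g w + g w') + g (a *: w + w')).
    by rewrite !bU_conj !Hg bW_conj rmorphN1 mulN1r addNr.
  by rewrite scaleN1r [RHS]addrC.
pose gL : {linear W -> U} := HB.pack g (GRing.isLinear.Build _ _ _ _ g g_lin).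
by exists (linfun gL) => w u; rewrite lfunE /= Hg.
Qed.

Lemma adjointE f g : is_adjoint bU bW f g -> adjoint bU bW f = g.
Proof. exact: is_adjoint_uniq (adjointP f). Qed.

End AdjointTheory.

Lemma tpure1_linear (K : fieldType) (V : vectType K) (a : K) (u v : V) :
  tpure [ffun=> a *: u + v] =
  a *: tpure [ffun=> u] + tpure [ffun=> v] :> tpow V 1.
Proof.
by apply/ffunP => i; rewrite !ffunE !big_ord1 !ffunE linearP.
Qed.

Lemma ffun1E (T : Type) (v : {ffun 'I_1 -> T}) : v = [ffun=> v ord0].
Proof. by apply/ffunP => s; rewrite ffunE; congr (v _); case: s => -[|//] ?; apply/val_inj. Qed.

Section FrobeniusTheory.
Variables (R : realType) (X : frob_data R).
Local Notation C := R[i].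

Lemma fmulE (v : {ffun 'I_2 -> X}) :
  fmul X (tpure v) = tpure [ffun=> v ord0 * v ord_max].
Proof.
rewrite /fmul (tmulE v (F := fun a b : X => tpure [ffun=> a * b])) //.
  by move=> a u u' w; rewrite mulrDl -scalerAl tpure1_linear.
by move=> a u w w'; rewrite mulrDr -scalerAr tpure1_linear.
Qed.

Lemma finner_lin a (u v v' : X) :
  finner u (a *: v + v') = a * finner u v + finner u v'.
Proof. by rewrite /finner mulrDr -scalerAr linearP. Qed.

Hypothesis starX : star_algebra_axiom X.

Lemma fstar0 : fstar (0 : X) = 0.
Proof.
have [_ lin _] := starX.
by have := lin (-1) 0 0; rewrite scaler0 addr0 rmorphN1 scaleN1r addNr.
Qed.

Lemma finner_conj a (u u' v : X) :
  finner (a *: u + u') v = a^* * finner u v + finner u' v.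
Proof.
by have [_ lin _] := starX; rewrite /finner lin mulrDl -scalerAl linearP.
Qed.

Lemma tinner_conj k a (u u' v : tpow X k) :
  tinner (a *: u + u') v = a^* * tinner u v + tinner u' v.
Proof.
rewrite /tinner mulr_sumr -big_split; apply: eq_bigr => i _ /=.
rewrite mulr_sumr -big_split; apply: eq_bigr => j _ /=.
by rewrite !ffunE rmorphD rmorphM /= !mulrDl !mulrA.
Qed.

Lemma tinner_lin k a (u v v' : tpow X k) :
  tinner u (a *: v + v') = a * tinner u v + tinner u v'.
Proof.
rewrite /tinner mulr_sumr -big_split; apply: eq_bigr => i _ /=.
rewrite mulr_sumr -big_split; apply: eq_bigr => j _ /=.
by rewrite !ffunE mulrDr mulrDl !mulrA [_ * a]mulrC -!mulrA.
Qed.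

Lemma tinner_purer k (x : tpow X k) (w : {ffun 'I_k -> X}) :
  tinner x (tpure w) = \sum_i (x i)^* * \prod_(s < k) finner (tbasis i s) (w s).
Proof.
rewrite /tinner; apply: eq_bigr => i _.
under [in RHS]eq_bigr => s _ do rewrite [w s]coord_vbasisf (form_sumr finner_lin).
rewrite bigA_distr_bigA /= mulr_sumr; apply: eq_bigr => j _.
rewrite ffunE -mulrA -big_split /=; congr (_ * _).
by apply: eq_bigr => s _; rewrite [tbasis j s]ffunE.
Qed.

Lemma tinner_pure k (v w : {ffun 'I_k -> X}) :
  tinner (tpure v) (tpure w) = \prod_(s < k) finner (v s) (w s).
Proof.
rewrite tinner_purer.
under [in RHS]eq_bigr => s _ do rewrite [v s]coord_vbasisf (form_suml finner_conj).
rewrite bigA_distr_bigA /=; apply: eq_bigr => i _.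
rewrite ffunE rmorph_prod -big_split /=; apply: eq_bigr => s _.
by rewrite ffunE.
Qed.

Hypothesis ndl : forall a : X, (forall b, fpsi X (a * b) = 0) -> a = 0.
Hypothesis ndr : forall b : X, (forall a, fpsi X (a * b) = 0) -> b = 0.

Lemma finner_nl (u : X) : (forall v, finner u v = 0) -> u = 0.
Proof.
have [inv _ _] := starX.
by move=> /ndl su; rewrite -(inv u) su fstar0.
Qed.

Lemma finner_nr (v : X) : (forall u, finner u v = 0) -> v = 0.
Proof.
have [inv _ _] := starX.
by move=> Hv; apply: ndr => a; have := Hv (fstar a); rewrite /finner inv.
Qed.

Lemma tinner_nl k (x : tpow X k) : (forall y, tinner x y = 0) -> x = 0.
Proof.
have [d Hd] := form_dual finner_conj finner_lin finner_nr.
move=> x0; apply/ffunP => j; rewrite ffunE.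
have := x0 (tpure [ffun s => d (j s)]); rewrite tinner_purer (bigD1 j) //=.
rewrite [X in _ + X]big1 => [|i ne].
  rewrite big1 => [|s _]; last by rewrite !ffunE Hd eqxx.
  by rewrite mulr1 addr0 => /eqP; rewrite conjC_eq0 => /eqP.
have [s ns] : exists s, i s != j s.
  by apply/existsP; apply: contraNT ne => /existsPn H; apply/eqP/ffunP => s;
     apply/eqP; move: (H s); rewrite negbK.
by rewrite (bigD1 s) //= !ffunE Hd (negPf ns) mul0r mulr0.
Qed.

End FrobeniusTheory.

Section DaggerTheory.
Variables (R : realType) (X : frob_data R).
Hypothesis Xfqs : finite_quantum_space_axiom X.

Lemma daggerP k l (f : 'Hom(tpow X k, tpow X l)) x y :
  tinner (dagger f y) x = tinner y (f x).
Proof.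
have [sX _ [ndl ndr] _] := Xfqs; apply: adjointP; first exact: tinner_conj.
- exact: tinner_lin.
- exact: tinner_nl.
- exact: tinner_conj.
exact: tinner_lin.
Qed.

Lemma edaggerP (f : 'End(X)) x y : finner (edagger f y) x = finner y (f x).
Proof.
have [sX _ [ndl ndr] _] := Xfqs; apply: adjointP; first exact: finner_conj.
- exact: finner_lin.
- exact: finner_nl.
- exact: finner_conj.
exact: finner_lin.
Qed.

End DaggerTheory.

Section DirectSum.
Variables (R : realType) (X Y : frob_data R).
Local Notation C := R[i].

Definition sum_psi (p : X * Y) : C := fpsi X p.1 + fpsi Y p.2.
Lemma sum_psi_linear : linear_for *%R sum_psi.
Proof. by move=> a u v; rewrite /sum_psi /= !linearP /= mulrDr addrACA. Qed.
HB.instance Definition _ :=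
  GRing.isLinear.Build C (X * Y)%type C *%R sum_psi sum_psi_linear.

Definition frob_sum : frob_data R :=
  @FrobData R (X * Y)%type (fun p => (fstar p.1, fstar p.2)) sum_psi.

End DirectSum.

Lemma tinner_adj (R : realType) (X Y : frob_data R) k
    (f : 'Hom(tpow X k, tpow Y k)) (g : 'Hom(tpow Y k, tpow X k)) :
    star_algebra_axiom X -> star_algebra_axiom Y ->
    (forall v w, tinner (f (tpure v)) (tpure w) = tinner (tpure v) (g (tpure w))) ->
  forall x y, tinner (f x) y = tinner x (g y).
Proof.
move=> sX sY fg x y; rewrite [x]tpow_basis [y]tpow_basis !linear_sum.
under eq_bigr do rewrite linearZ /=.
rewrite (form_suml (tinner_conj (k := k))).
rewrite (form_suml (tinner_conj (k := k))).
apply: eq_bigr => i _; congr (_ * _).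
under [in RHS]eq_bigr do rewrite linearZ /=.
rewrite !(form_sumr (@tinner_lin _ _ k)).
by apply: eq_bigr => j _; rewrite fg.
Qed.

Section DirectSumTheory.
Variables (R : realType) (X Y : frob_data R).
Local Notation C := R[i].
Local Notation Z := (frob_sum X Y).
Hypothesis Xfqs : finite_quantum_space_axiom X.
Hypothesis Yfqs : finite_quantum_space_axiom Y.

Lemma frob_sum_star : star_algebra_axiom Z.
Proof.
have [[iX lX mX] _ _ _] := Xfqs; have [[iY lY mY] _ _ _] := Yfqs.
split=> [[a b]|c [a b] [a' b']|[a b] [a' b']] /=; first by rewrite iX iY.
  by congr (_, _); rewrite ?lX ?lY.
by congr (_, _); rewrite ?mX ?mY.
Qed.

Let inl_fun (x : X) : Z := (x, 0).
Let inr_fun (y : Y) : Z := (0, y).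
Let inl_lin : linear inl_fun.
Proof. by move=> a u v; congr (_, _); rewrite /= scaler0 addr0. Qed.
Let inr_lin : linear inr_fun.
Proof. by move=> a u v; congr (_, _); rewrite /= scaler0 addr0. Qed.
Let injl : 'Hom(X, Z) :=
  linfun (HB.pack inl_fun (GRing.isLinear.Build _ _ _ _ inl_fun inl_lin)
    : {linear X -> Z}).
Let injr : 'Hom(Y, Z) :=
  linfun (HB.pack inr_fun (GRing.isLinear.Build _ _ _ _ inr_fun inr_lin)
    : {linear Y -> Z}).
Let prl : 'Hom(Z, X) := linfun (fst : X * Y -> X).
Let prr : 'Hom(Z, Y) := linfun (snd : X * Y -> Y).
Let injlE x : injl x = (x, 0). Proof. by rewrite lfunE. Qed.
Let injrE x : injr x = (0, x). Proof. by rewrite lfunE. Qed.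
Let prlE x : prl x = x.1. Proof. by rewrite lfunE. Qed.
Let prrE x : prr x = x.2. Proof. by rewrite lfunE. Qed.

Let sX : star_algebra_axiom X. Proof. by case: Xfqs. Qed.
Let sY : star_algebra_axiom Y. Proof. by case: Yfqs. Qed.

Let finnerE (p q : Z) : finner p q = finner p.1 q.1 + finner p.2 q.2.
Proof. by []. Qed.

Let finner0l (T : frob_data R) (sT : star_algebra_axiom T) (v : T) : finner 0 v = 0.
Proof. by rewrite /finner fstar0 // mul0r linear0. Qed.
Let finner0r (T : frob_data R) (v : T) : finner v 0 = 0.
Proof. by rewrite /finner mulr0 linear0. Qed.

Let injl_adj k x y : tinner (tfun injl k x) y = tinner x (tfun prl k y).
Proof.
apply: tinner_adj x y => //; first exact: frob_sum_star.
move=> v w; rewrite !tfunE !tinner_pure //; last exact: frob_sum_star.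
by apply: eq_bigr => s _; rewrite !ffunE injlE prlE finnerE /= finner0l // addr0.
Qed.
Let injr_adj k x y : tinner (tfun injr k x) y = tinner x (tfun prr k y).
Proof.
apply: tinner_adj x y => //; first exact: frob_sum_star.
move=> v w; rewrite !tfunE !tinner_pure //; last exact: frob_sum_star.
by apply: eq_bigr => s _; rewrite !ffunE injrE prrE finnerE /= finner0l // add0r.
Qed.
Let prl_adj k x y : tinner (tfun prl k x) y = tinner x (tfun injl k y).
Proof.
apply: tinner_adj x y => //; first exact: frob_sum_star.
move=> v w; rewrite !tfunE !tinner_pure //; last exact: frob_sum_star.
by apply: eq_bigr => s _; rewrite !ffunE injlE prlE finnerE /= finner0r addr0.
Qed.
Let prr_adj k x y : tinner (tfun prr k x) y = tinner x (tfun injr k y).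
Proof.
apply: tinner_adj x y => //; first exact: frob_sum_star.
move=> v w; rewrite !tfunE !tinner_pure //; last exact: frob_sum_star.
by apply: eq_bigr => s _; rewrite !ffunE injrE prrE finnerE /= finner0r add0r.
Qed.

Let fmul_prl x : fmul X (tfun prl 2 x) = tfun prl 1 (fmul Z x).
Proof.
rewrite -!comp_lfunE; congr (fun_of_lfun _ x); apply: eq_tpow => v.
by rewrite !comp_lfunE tfunE !fmulE tfunE; congr tpure; apply/ffunP => s; rewrite !ffunE !prlE.
Qed.
Let fmul_prr x : fmul Y (tfun prr 2 x) = tfun prr 1 (fmul Z x).
Proof.
rewrite -!comp_lfunE; congr (fun_of_lfun _ x); apply: eq_tpow => v.
by rewrite !comp_lfunE tfunE !fmulE tfunE; congr tpure; apply/ffunP => s; rewrite !ffunE !prrE.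
Qed.
Let fmul_injl x : fmul Z (tfun injl 2 x) = tfun injl 1 (fmul X x).
Proof.
rewrite -!comp_lfunE; congr (fun_of_lfun _ x); apply: eq_tpow => v.
rewrite !comp_lfunE tfunE !fmulE tfunE; congr tpure; apply/ffunP => s.
by rewrite !ffunE !injlE; congr (_, _); rewrite /= mulr0.
Qed.
Let fmul_injr x : fmul Z (tfun injr 2 x) = tfun injr 1 (fmul Y x).
Proof.
rewrite -!comp_lfunE; congr (fun_of_lfun _ x); apply: eq_tpow => v.
rewrite !comp_lfunE tfunE !fmulE tfunE; congr tpure; apply/ffunP => s.
by rewrite !ffunE !injrE; congr (_, _); rewrite /= mulr0.
Qed.

Let inj_pr x : tfun injl 1 (tfun prl 1 x) + tfun injr 1 (tfun prr 1 x) = x.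
Proof.
rewrite -!comp_lfunE -add_lfunE -[RHS]id_lfunE; congr (fun_of_lfun _ x).
apply: eq_tpow => v; rewrite add_lfunE id_lfunE !comp_lfunE !tfunE.
rewrite -[X in X + _]scale1r; set a := [ffun s => injl _]; set b := [ffun s => injr _].
rewrite [a]ffun1E [b]ffun1E -tpure1_linear scale1r.
rewrite [in RHS](ffun1E v); congr tpure; apply/ffunP => s; rewrite !ffunE.
rewrite injlE injrE prlE prrE; case: (v ord0) => p q.
by congr (_, _); rewrite /= ?addr0 ?add0r.
Qed.

Let g : 'Hom(tpow Z 1, tpow Z 2) :=
  (tfun injl 2 \o (dagger (fmul X) \o tfun prl 1))%VF +
  (tfun injr 2 \o (dagger (fmul Y) \o tfun prr 1))%VF.

Let g_adj x y : tinner (g y) x = tinner y (fmul Z x).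
Proof.
have addl (u u' v : tpow Z 2) : tinner (u + u') v = tinner u v + tinner u' v.
  by have := tinner_conj 1 u u' v; rewrite scale1r rmorph1 mul1r.
have addr (u v v' : tpow Z 1) : tinner u (v + v') = tinner u v + tinner u v'.
  by have := tinner_lin 1 u v v'; rewrite scale1r mul1r.
rewrite add_lfunE !comp_lfunE addl injl_adj injr_adj !daggerP //.
by rewrite fmul_prl fmul_prr prl_adj prr_adj -addr inj_pr.
Qed.

Lemma frob_sum_axiom : finite_quantum_space_axiom Z.
Proof.
have [_ pX [ndlX ndrX] mmX] := Xfqs; have [_ pY [ndlY ndrY] mmY] := Yfqs.
have ndl : forall a : Z, (forall b, fpsi Z (a * b) = 0) -> a = 0.
  move=> [a b] ab0; congr (_, _).
    by apply: ndlX => c; have := ab0 (c, 0); rewrite /= /sum_psi /= mulr0 linear0 addr0.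
  by apply: ndlY => c; have := ab0 (0, c); rewrite /= /sum_psi /= mulr0 linear0 add0r.
have ndr : forall b : Z, (forall a, fpsi Z (a * b) = 0) -> b = 0.
  move=> [a b] ab0; congr (_, _).
    by apply: ndrX => c; have := ab0 (c, 0); rewrite /= /sum_psi /= mul0r linear0 addr0.
  by apply: ndrY => c; have := ab0 (0, c); rewrite /= /sum_psi /= mul0r linear0 add0r.
split; [exact: frob_sum_star | by move=> a; exact: addr_ge0 (pX a.1) (pY a.2) | by [] | ].
have -> : dagger (fmul Z) = g.
  apply: adjointE; last by move=> y x; exact: g_adj.
  - exact: tinner_conj.
  - exact: tinner_lin.
  - exact: tinner_nl frob_sum_star ndr _.
  - exact: tinner_conj.
  - exact: tinner_lin.
apply/lfunP => y; rewrite comp_lfunE add_lfunE !comp_lfunE id_lfunE linearD /=.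
rewrite fmul_injl fmul_injr -!(comp_lfunE (fmul _)) mmX mmY !id_lfunE.
exact: inj_pr.
Qed.

End DirectSumTheory.

Section FiniteQuantumSpaces.
Variable R : realType.
Local Notation C := R[i].

(* C(X) <> 0 is part of falgType (1 != 0). *)
Record fqspace := FQSpace {
  fq_data :> frob_data R;
  fq_axiom : finite_quantum_space_axiom fq_data
}.

Definition fq_sum (X Y : fqspace) : fqspace :=
  FQSpace (frob_sum_axiom (fq_axiom X) (fq_axiom Y)).

Definition fq_sum4 (X : fqspace) : fqspace :=
  fq_sum (fq_sum (fq_sum X X) X) X.

Record qgraph := QGraph {
  qg_space :> fqspace;
  qg_adj : 'End(qg_space)
}.

End FiniteQuantumSpaces.

Section UnitTheory.
Variables (R : realType) (X : fqspace R).

Lemma unit_mapE c : unit_map X c = c *: 1.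
Proof.
pose u := fun c : R[i]^o => c *: (1 : X).
have lin : linear u by move=> a b d; rewrite /u scalerDl scalerA.
pose L : {linear R[i]^o -> X} := HB.pack u (GRing.isLinear.Build _ _ _ _ u lin).
exact: (lfunE L).
Qed.

Lemma finner_herm (a b : X) : (finner a b)^* = finner b a.
Proof.
have [sX pos _ _] := fq_axiom X.
have posr (u : X) : (finner u u)^* = finner u u by apply: geC0_conj; exact: pos.
have expand c : finner (c *: b + a) (c *: b + a) =
    c^* * c * finner b b + c^* * finner b a + c * finner a b + finner a a.
  by rewrite finner_conj // !finner_lin mulrDr mulrA !addrA.
have := posr (1 *: b + a); rewrite expand !rmorphD !rmorphM /= !posr !rmorph1.
rewrite !mul1r => /addIr; rewrite -!addrA => /addrI E1.
have := posr ('i *: b + a); rewrite expand !rmorphD !rmorphM /= !posr !conjCK.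
rewrite conjCi ['i * - 'i]mulrC => /addIr; rewrite -!addrA => /addrI.
rewrite !mulNr -!mulrN -!mulrDr => /(mulfI (neq0Ci _)) E2.
apply: (@mulfI _ 2%:R); rewrite ?pnatr_eq0 // !mulr_natl !mulr2n.
have -> : (finner a b)^* + (finner a b)^* =
   ((finner b a)^* + (finner a b)^*) - ((finner b a)^* - (finner a b)^*).
  by rewrite [X in X - _]addrC addrKA opprK.
by rewrite E1 E2 opprD opprK addrACA subrr addr0.
Qed.

(* psi = eta^dagger *)
Lemma unit_dagE x : unit_dag X x = fpsi X x.
Proof.
have [sX pos [ndl ndr] _] := fq_axiom X; have [inv _ mulS] := sX.
have star1 : fstar 1 = 1 :> X by rewrite -[LHS]mulr1 -{2}(inv 1) -mulS mulr1 inv.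
pose L : 'Hom(X, R[i]^o) := linfun (fpsi X : {linear X -> R[i]^o}).
suff -> : unit_dag X = L by rewrite lfunE.
apply: adjointE => //=; first by move=> a u u' v; rewrite rmorphD rmorphM /= mulrDl mulrA.
- by move=> a u v v'; rewrite mulrDr mulrCA.
- by move=> u /(_ 1)/eqP; rewrite mulr1 conjC_eq0 => /eqP.
- exact: finner_conj.
- exact: finner_lin.
move=> w c; rewrite lfunE /= unit_mapE.
have -> : fpsi X w = finner 1 w by rewrite /finner star1 mul1r.
rewrite finner_herm -[c *: 1]addr0 finner_lin.
by rewrite /finner mulr0 linear0 addr0 mulrC.
Qed.

Lemma deltaE : delta X = sqrtC (fpsi X 1).
Proof. by rewrite /delta unit_dagE unit_mapE scale1r. Qed.

End UnitTheory.

Section QuantumHadamard.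
Variables (R : realType) (X : fqspace R).
Local Notation C := R[i].

(* R = m^dagger eta and R^dagger *)
Definition fcup : 'Hom(tpow X 0, tpow X 2) := (dagger (fmul X) \o funit X)%VF.
Definition fcap : 'Hom(tpow X 2, tpow X 0) := dagger fcup.

Definition real_conj (A : 'End(tpow X 1)) : 'End(tpow X 1) :=
  let id1 : 'End(tpow X 1) := \1%VF in
  (tmap id1 fcap \o (tmap id1 (tmap (dagger A) id1) \o tmap fcup id1))%VF.

Definition schur_prod (A B : 'End(tpow X 1)) : 'End(tpow X 1) :=
  (fmul X \o (tmap A B \o dagger (fmul X)))%VF.

Definition quantum_hadamard (H : 'End(X)) : Prop :=
  [/\ tendo H = real_conj (tendo H),
      schur_prod (tendo H) (tendo H) = (funit X \o dagger (funit X))%VF,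
      (H \o edagger H)%VF = delta X ^+ 2 *: \1%VF
    & (edagger H \o H)%VF = delta X ^+ 2 *: \1%VF].

Definition all_one : 'End(X) := (unit_map X \o unit_dag X)%VF.
Definition had_plus (H : 'End(X)) : 'End(X) := 2%:R^-1 *: (all_one + H).
Definition had_minus (H : 'End(X)) : 'End(X) := 2%:R^-1 *: (all_one - H).

Definition had_adj_fun (H : 'End(X)) (v : fq_sum4 X) : fq_sum4 X :=
  let: (a, b, c, d) := v in
  (had_plus H c + had_minus H d,
   had_minus H c + had_plus H d,
   edagger (had_plus H) a + edagger (had_minus H) b,
   edagger (had_minus H) a + edagger (had_plus H) b).

Definition hadamard_adj (H : 'End(X)) : 'End(fq_sum4 X) :=
  linfun (had_adj_fun H).

Lemma hadamard_adjE (H : 'End(X)) v : hadamard_adj H v = had_adj_fun H v.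
Proof.
have lin : linear (had_adj_fun H).
  move=> z [[[a b] c] d] [[[a' b'] c'] d'] /=.
  by congr (_, _, _, _); rewrite !linearP [in RHS]/= scalerDr addrACA.
pose L : {linear fq_sum4 X -> fq_sum4 X} :=
  HB.pack (had_adj_fun H) (GRing.isLinear.Build _ _ _ _ (had_adj_fun H) lin).
exact: (lfunE L).
Qed.

Definition hadamard_graph (H : 'End(X)) : qgraph R := QGraph (hadamard_adj H).

End QuantumHadamard.

Section QuantumIsomorphism.
Variable R : realType.
Local Notation C := R[i].
Implicit Types X : fqspace R.

Definition hom_family X := forall k l : nat, set 'Hom(tpow X k, tpow X l).

Inductive generated X (G : hom_family X) : hom_family X :=
| gen_base k l f of G k l f : generated G f
| gen_id k : generated G (\1%VF : 'End(tpow X k))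
| gen_comp k l n (f : 'Hom(tpow X k, tpow X l)) (g : 'Hom(tpow X l, tpow X n))
    of generated G f & generated G g : generated G (g \o f)%VF
| gen_tmap k k' l l' (f : 'Hom(tpow X k, tpow X k'))
    (g : 'Hom(tpow X l, tpow X l')) of generated G f & generated G g :
    generated G (tmap f g)
| gen_lin k l (a b : C) (f g : 'Hom(tpow X k, tpow X l))
    of generated G f & generated G g : generated G (a *: f + b *: g)
| gen_dagger k l (f : 'Hom(tpow X k, tpow X l)) of generated G f :
    generated G (dagger f).

Definition hom_map X X' :=
  forall k l : nat, 'Hom(tpow X k, tpow X l) -> 'Hom(tpow X' k, tpow X' l).

Record monoidal_dagger_iso X X' (D : hom_family X) (D' : hom_family X')
    (F : hom_map X X') : Prop := MonoidalDaggerIso {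
  mdi_bij : forall k l, set_bij (D k l) (D' k l) (F k l);
  mdi_id : forall k, F k k \1%VF = \1%VF;
  mdi_comp : forall k l n f g, D k l f -> D l n g ->
    F k n (g \o f)%VF = (F l n g \o F k l f)%VF;
  mdi_tmap : forall k k' l l' f g, D k k' f -> D l l' g ->
    F (k + l)%N (k' + l')%N (tmap f g) = tmap (F k k' f) (F l l' g);
  mdi_lin : forall k l (a b : C) f g, D k l f -> D k l g ->
    F k l (a *: f + b *: g) = a *: F k l f + b *: F k l g;
  mdi_dagger : forall k l f, D k l f -> F l k (dagger f) = dagger (F k l f)
}.

Inductive space_gens X : hom_family X :=
| space_gen_mul : space_gens (fmul X)
| space_gen_counit : space_gens (dagger (funit X)).

Definition quantum_isomorphic (X X' : fqspace R) : Prop :=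
  exists F : hom_map X X',
    [/\ monoidal_dagger_iso (generated (@space_gens X))
          (generated (@space_gens X')) F,
        F 2 1 (fmul X) = fmul X'
      & F 1 0 (dagger (funit X)) = dagger (funit X')].

Inductive graph_gens (Y : qgraph R) : hom_family Y :=
| graph_gen_space k l (f : 'Hom(tpow Y k, tpow Y l)) of space_gens f : graph_gens f
| graph_gen_adj : graph_gens (tendo (qg_adj Y)).

Definition quantum_graph_isomorphic (Y Y' : qgraph R) : Prop :=
  exists F : hom_map Y Y',
    [/\ monoidal_dagger_iso (generated (@graph_gens Y))
          (generated (@graph_gens Y')) F,
        F 2 1 (fmul Y) = fmul Y',
        F 1 0 (dagger (funit Y)) = dagger (funit Y')
      & F 1 1 (tendo (qg_adj Y)) = tendo (qg_adj Y')].

End QuantumIsomorphism.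

(* Main.v *)
Require Import Defs.
From HB Require Import structures.
From mathcomp Require Import all_boot all_order all_algebra all_field.
From mathcomp Require Import boolp classical_sets functions reals.
From mathcomp Require Import complex.
From mathcomp Require Import zify ring.

Set Implicit Arguments.
Unset Strict Implicit.
Unset Printing Implicit Defensive.

Import Order.TTheory GRing.Theory Num.Theory.
Local Open Scope ring_scope.

(** A monoidal dagger-category generated by some morphisms is determined by
    the values of its closed diagrams. Indeed, by Frobenius reciprocity every
    morphism can be bent into one without inputs, and such an [f] vanishes iff
    the closed diagram [f^dagger f] does, because the inner product of tensor
    powers is positive definite ([tinner_definite], [twin_eq0]). So if paired
    generators always give closed diagrams of equal value, they extend to a
    monoidal dagger-isomorphism ([twin_iso]). In the other direction,
    [eta^dagger eta = psi 1 = delta ^+ 2] is a closed diagram ([iso_psi1]), so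
    quantum isomorphic spaces or graphs have the same [delta]. What has to be
    shown is that closed diagrams in [m], [eta] and [A] depend on [delta] only.

    Every tensor factor [C(X)] is thickened to a shaded region between two
    strands. Then [eta^dagger] and [m] are caps, [eta] and [m^dagger] are cups,
    according to whether they take place in an unshaded or in a shaded region;
    with the right powers of a fourth root [r] of [psi 1], all closed loops
    have the value [r ^+ 2].

    Next, [C(Y)] is the tensor product of [C(X)], of an index for the first or
    the last two copies, and of an index for the sum or the difference of these
    two copies. On sums, [A] is [eta eta^dagger]; on differences it is [H] or
    its adjoint, and it always exchanges the first two copies with the last two.
    All this is recorded by a bit on every region: on a shaded region it is the
    first index, and a leg carries the sum if the unshaded regions on both of
    its sides have the same bit, the difference if not. A strand gets a letter,
    which tells whether the bits on its sides agree. A leg of sums is bounded by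
    two strands of the same letter, a leg of differences by two strands with
    different letters, and [H] crosses these. So strands with the same letter
    never cross.

    For strands with different letters, [H H^dagger = delta^2] undoes a double
    crossing around a shaded region, the Schur relation [H * H = eta eta^dagger]
    undoes one around an unshaded region ([act_crossK]), and [H = H^*] lets a
    strand slide across a cap or a cup ([act_slide_cap], [act_slide_cup]). With
    these moves the strands of one letter are pulled off those of the other, so
    every closed diagram is a multiple of the empty one by a power of [r ^+ 2].
    In the proof this is an induction: the functionals that are built by caps
    and crossings alone are closed under cups ([planar_cup]), and without legs
    they are constants that do not depend on the space ([planar_scalar]). *)

(** * Multilinear functionals on lists *)

Section Multilinear.
Variables (K : fieldType) (V : lmodType K).
Implicit Types (f : seq V -> K) (l : seq V).

Definition multilinear f := forall l1 l2 a u v,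
  f (l1 ++ (a *: u + v) :: l2) = a * f (l1 ++ u :: l2) + f (l1 ++ v :: l2).

Definition sized m f := forall l, size l != m -> f l = 0.

Definition nil_form : seq V -> K := fun l => (nilp l)%:R.

Lemma multilinear0 f l1 l2 : multilinear f -> f (l1 ++ 0 :: l2) = 0.
Proof.
by move=> /(_ l1 l2 (-1) 0 0); rewrite scaler0 addr0 mulN1r addNr.
Qed.

Lemma multilinearZ f l1 l2 a u : multilinear f -> f (l1 ++ (a *: u) :: l2) = a * f (l1 ++ u :: l2).
Proof. by move=> mf; rewrite -[a *: u]addr0 mf multilinear0 // addr0. Qed.

Lemma multilinearD f l1 l2 u v :
  multilinear f -> f (l1 ++ (u + v) :: l2) = f (l1 ++ u :: l2) + f (l1 ++ v :: l2).
Proof. by move=> mf; rewrite -[u]scale1r mf scale1r mul1r. Qed.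

Lemma multilinear_sum f l1 l2 (I : Type) (s : seq I) (u : I -> V) :
  multilinear f -> f (l1 ++ (\sum_(i <- s) u i) :: l2) = \sum_(i <- s) f (l1 ++ u i :: l2).
Proof.
move=> mf; elim: s => [|i s IH]; first by rewrite !big_nil multilinear0.
by rewrite !big_cons multilinearD // IH.
Qed.

Lemma multilinear_cons f x : multilinear f -> multilinear (fun l => f (x :: l)).
Proof. by move=> mf l1 l2 a u v; apply: (mf (x :: l1)). Qed.

Lemma multilinear_nilf : multilinear nil_form.
Proof. by case=> [|x l1] l2 a u v; rewrite /nil_form /= ?mulr0 ?addr0. Qed.

Fixpoint pop k (T : (seq V -> K) -> seq V -> K) f l : K :=
  if k is k'.+1 then
    if l is x :: l' then pop k' T (fun l'' => f (x :: l'')) l' else 0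
  else T f l.

End Multilinear.

(** * Strand operations and their relations *)

(** What the evaluation of closed diagrams needs to know of a quantum Hadamard
    matrix. The map [bu_map o] goes from legs of the other colour to legs of
    colour [o]; for the two colours it is the matrix and its adjoint.
    [bu_mapK] and [bu_schur] undo a double crossing around a shaded and around
    an unshaded region, [bu_mapT] turns a crossing. The involution does not
    appear, since diagrams are evaluated by bilinear means; [r] is a fourth root
    of [psi 1], so that a loop can be worth [r ^+ 2]. *)
Record biunitary (K : fieldType) (r : K) := Biunitary {
  bu_alg :> algType K;
  bu_psi : {scalar bu_alg};
  bu_cop : seq (bu_alg * bu_alg);
  bu_map : bool -> {linear bu_alg -> bu_alg};
  bu_copl : forall z, \sum_(e <- bu_cop) bu_psi (z * e.1) *: e.2 = z;
  bu_copr : forall z, \sum_(e <- bu_cop) bu_psi (e.2 * z) *: e.1 = z;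
  bu_special : \sum_(e <- bu_cop) e.1 * e.2 = 1;
  bu_one : bu_psi 1 = r ^+ 4;
  bu_mapK : forall o x, bu_map o (bu_map (~~ o) x) = r ^+ 4 *: x;
  bu_mapT : forall o x y, bu_psi (y * bu_map o x) = bu_psi (bu_map (~~ o) y * x);
  bu_schur : forall o x,
    \sum_(e <- bu_cop) bu_map o (x * e.1) * bu_map o e.2 = bu_psi x *: 1
}.

(** The legs of a functional are the entries of its argument: leg [j] is the
    shaded region between the strands [2 j] and [2 j + 1]. Operations transform
    functionals: a cap adds a pair of strands, a cup joins two neighbouring
    strands, and a crossing exchanges them. *)
Inductive op := Cap | Cup | Cross of bool.

(** An operation replaces [op_src] strands of the old functional by [op_tgt]
    strands of the new one, which shifts all strands to the right. *)
Definition op_src p := if p is Cap then 0%N else 2.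
Definition op_tgt p := if p is Cup then 0%N else 2.

Section Calculus.
Variables (K : fieldType) (r : K) (S : biunitary r).
Local Notation psi := (bu_psi S).
Local Notation E := (bu_cop S).
Local Notation H := (bu_map S).
Implicit Types (f g : seq S -> K) (l : seq S) (o : bool) (p q : op).

(** The region to the left of the first strand is unshaded in [act_plain] and
    shaded in [act_shaded]. The powers of [r] make all relations exact, apart
    from the value [r ^+ 2] of a loop. *)
Definition act_plain p f l : K := match p, l with
  | Cap, x :: l' => r^-1 * (psi x * f l')
  | Cup, _ => r^-1 * f (1 :: l)
  | Cross o, x :: l' => r ^- 2 * f (H o x :: l')
  | _, _ => 0
  end.

Definition act_shaded p f l : K := match p, l with
  | Cap, x :: y :: l' => r * f (x * y :: l')
  | Cup, x :: l' => r * \sum_(e <- E) f (x * e.1 :: e.2 :: l')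
  | Cross o, x :: y :: l' => \sum_(e <- E) f (x * e.1 :: H (~~ o) e.2 * y :: l')
  | _, _ => 0
  end.

Definition act p i f := pop i./2 (if odd i then act_shaded p else act_plain p) f.

Lemma psi_nd (a b : S) : (forall z, psi (z * a) = psi (z * b)) -> a = b.
Proof.
move=> ab; rewrite -[a]bu_copr -[b]bu_copr.
by apply: eq_bigr => e _; rewrite ab.
Qed.

(** A sum of elementary tensors is determined by its contractions with [psi] in
    the first factor, as the copairing rebuilds that factor from them. *)
Lemma tensor_ext (g : S -> S -> K) (I J : Type) (s : seq I) (t : seq J)
    (A B : I -> S) (A' B' : J -> S) :
  (forall a u u' v, g (a *: u + u') v = a * g u v + g u' v) ->
  (forall a u v v', g u (a *: v + v') = a * g u v + g u v') ->
  (forall z, \sum_(i <- s) psi (z * A i) *: B i = \sum_(j <- t) psi (z * A' j) *: B' j) ->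
  \sum_(i <- s) g (A i) (B i) = \sum_(j <- t) g (A' j) (B' j).
Proof.
move=> gl gr.
have g0l v : g 0 v = 0.
  by have := gl (-1) 0 0 v; rewrite scaler0 addr0 mulN1r addNr.
have g0r v : g v 0 = 0.
  by have := gr (-1) v 0 0; rewrite scaler0 addr0 mulN1r addNr.
have suml v (L : Type) (w : seq L) c (u : L -> S) :
    g (\sum_(i <- w) c i *: u i) v = \sum_(i <- w) c i * g (u i) v.
  by apply: (big_rec2 (fun a b => g a v = b)) => // i a b _ <-; rewrite gl.
have sumr v (L : Type) (w : seq L) c (u : L -> S) :
    g v (\sum_(i <- w) c i *: u i) = \sum_(i <- w) c i * g v (u i).
  by apply: (big_rec2 (fun a b => g v a = b)) => // i a b _ <-; rewrite gr.
have ex (L : Type) (w : seq L) (C D : L -> S) : \sum_(i <- w) g (C i) (D i) =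
    \sum_(e <- E) g e.1 (\sum_(i <- w) psi (e.2 * C i) *: D i).
  under [RHS]eq_bigr do rewrite sumr.
  rewrite exchange_big; apply: eq_bigr => i _ /=.
  by rewrite -{1}[C i]bu_copr suml.
by move=> st; rewrite (ex _ s) (ex _ t); apply: eq_bigr => e _; rewrite st.
Qed.

(** The copairing is central: a factor passes through an unshaded region that
    opens inside a shaded one. *)
Lemma cop_mul (g : S -> S -> K) a :
  (forall a u u' v, g (a *: u + u') v = a * g u v + g u' v) ->
  (forall a u v v', g u (a *: v + v') = a * g u v + g u v') ->
  \sum_(e <- E) g (a * e.1) e.2 = \sum_(e <- E) g e.1 (e.2 * a).
Proof.
move=> gl gr; apply: tensor_ext => // z.
under eq_bigr do rewrite mulrA.
rewrite bu_copl -[in LHS](bu_copl z) mulr_suml.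
by apply: eq_bigr => e _; rewrite scalerAl.
Qed.

Lemma sum_psi_mul (I : Type) (s : seq I) z (u : I -> S) :
  psi (z * \sum_(i <- s) u i) = \sum_(i <- s) psi (z * u i).
Proof. by rewrite mulr_sumr linear_sum. Qed.

Lemma map_negK o x : H (~~ o) (H o x) = r ^+ 4 *: x.
Proof. by rewrite -[RHS](bu_mapK (~~ o)) negbK. Qed.

(** The Schur relation turned by a quarter. *)
Lemma map_cup o y : \sum_(e <- E) e.1 * H o (H (~~ o) e.2 * y) = psi y *: 1.
Proof.
apply: psi_nd => z; rewrite sum_psi_mul.
under eq_bigr do rewrite mulrA bu_mapT mulrA.
rewrite -linear_sum -mulr_suml bu_schur -scalerAl mul1r -scalerAr mulr1.
by rewrite !linearZ /= mulrC.
Qed.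

Lemma act_cons p i f x l : act p i.+2 f (x :: l) = act p i (fun l' => f (x :: l')) l.
Proof. by rewrite /act /= negbK. Qed.

Lemma act_nil p i f : act p i.+2 f [::] = 0.
Proof. by []. Qed.

Lemma act_lin p i a f g :
  act p i (fun l => a * f l + g l) = fun l => a * act p i f l + act p i g l.
Proof.
apply/funext => l; elim/ltn_ind: i f g l => -[|[|i]] IH f g l.
- clear IH; case: p => [||o]; case: l => [|x l] //=; rewrite ?mulr0 ?addr0 // /act /=; ring.
- clear IH; rewrite /act; case: p => [||o]; case: l => [|x [|y l]] //=; rewrite ?mulr0 ?addr0 //.
  + ring.
  + by rewrite big_split -mulr_sumr /=; ring.
  + by rewrite big_split -mulr_sumr /=; ring.
  + by rewrite big_split -mulr_sumr /=; ring.
- by case: l => [|x l]; rewrite ?act_nil ?mulr0 ?addr0 // !act_cons IH.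
Qed.

Lemma multilinear_act p i f : multilinear f -> multilinear (act p i f).
Proof.
elim/ltn_ind: i f => -[|[|i]] IH f mf l1 l2 a u v.
- clear IH; case: p => [||o]; case: l1 => [|x l1] /=; rewrite /act /=.
  + by rewrite linearP /=; ring.
  + by rewrite mf; ring.
  + by rewrite (mf [:: 1]) /=; ring.
  + by rewrite (mf [:: 1, x & l1]) /=; ring.
  + by rewrite linearP /= (mf [::]) /=; ring.
  + by rewrite (mf (H o x :: l1)) /=; ring.
- clear IH; case: p => [||o]; case: l1 => [|x [|y l1]] /=; rewrite /act /=.
  + case: l2 => [|y l2]; first by ring.
    by rewrite mulrDl -scalerAl (mf [::]) /=; ring.
  + by rewrite mulrDr -scalerAr (mf [::]) /=; ring.
  + by rewrite (mf (x * y :: l1)) /=; ring.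
  + under eq_bigr do rewrite mulrDl -scalerAl (mf [::]) /=.
    by rewrite big_split -mulr_sumr /=; ring.
  + under eq_bigr do rewrite (mf [:: _; _]) /=.
    by rewrite big_split -mulr_sumr /=; ring.
  + under eq_bigr do rewrite (mf [:: _, _, _ & _]) /=.
    by rewrite big_split -mulr_sumr /=; ring.
  + case: l2 => [|y l2]; first by ring.
    under eq_bigr do rewrite mulrDl -scalerAl (mf [::]) /=.
    by rewrite big_split -mulr_sumr /=; ring.
  + under eq_bigr do rewrite mulrDr -scalerAr (mf [:: _]) /=.
    by rewrite big_split -mulr_sumr /=; ring.
  + under eq_bigr do rewrite (mf [:: _, _ & _]) /=.
    by rewrite big_split -mulr_sumr /=; ring.
- case: l1 => [|x l1]; rewrite /= !act_cons.
  + have -> : (fun l => f ((a *: u + v) :: l)) =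
              (fun l => a * f (u :: l) + f (v :: l)).
      by apply/funext => l; rewrite (mf [::]).
    by rewrite act_lin.
  + by apply: IH => //; apply: multilinear_cons.
Qed.

Lemma act0 p i : act p i (fun _ => 0 : K) = fun _ : seq S => 0.
Proof.
rewrite -[LHS](_ : act p i (fun l => -1 * 0 + 0) = _); last first.
  by congr (act p i); apply/funext => _; rewrite mulr0 addr0.
by rewrite act_lin; apply/funext => l; rewrite mulN1r addNr.
Qed.

Lemma act_supp p i f l :
  (forall l', (size l' + (op_tgt p)./2 = size l + (op_src p)./2)%N -> f l' = 0) ->
  act p i f l = 0.
Proof.
elim/ltn_ind: i f l => -[|[|i]] IH f l f0.
- clear IH; case: p f0 => [||o]; case: l => [|x l] //= f0; rewrite /act /= f0 ?mulr0 //=; lia.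
- clear IH; rewrite /act; case: p f0 => [||o]; case: l => [|x [|y l]] //= f0;
    rewrite ?f0 ?mulr0 ?big1 ?mulr0 //= ?addn1 ?addn0 // => e _; rewrite f0 //=; lia.
- case: l f0 => [|x l] f0; rewrite ?act_nil // act_cons.
  by apply: IH => // l' sl'; apply: f0 => /=; lia.
Qed.

Lemma sized_act p i m m' f : (m + (op_tgt p)./2 = m' + (op_src p)./2)%N ->
  sized m f -> sized m' (act p i f).
Proof.
move=> mm' sf l ln; apply: act_supp => l' ll'; apply: sf.
by apply: contra ln => /eqP sl'; apply/eqP/(@addIn (op_src p)./2); rewrite -ll' sl'.
Qed.

Lemma act_out p i m f : sized m f -> (m.*2 < i + op_src p)%N -> act p i f = fun _ => 0.
Proof.
move=> sf mi; apply/funext => l; elim/ltn_ind: i m f l sf mi => -[|[|i]] IH m f l sf mi.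
- clear IH; case: p mi => [||o] //=; rewrite add0n => mi; have m0 : m = 0%N by lia.
  + by rewrite /act /= sf ?mulr0 // m0.
  + by case: l => [|x l] //; rewrite /act /= sf ?mulr0 // m0.
- clear IH; have fz l' : (m < size l')%N -> f l' = 0.
    by move=> ml; apply: sf; rewrite gtn_eqF.
  case: p mi => [||o] /= mi; case: l => [|x [|y l]] //; rewrite /act /=.
  + by rewrite fz ?mulr0 //=; lia.
  + by rewrite big1 ?mulr0 // => e _; rewrite fz //=; lia.
  + by rewrite big1 ?mulr0 // => e _; rewrite fz //=; lia.
  by rewrite big1 ?mulr0 // => e _; rewrite fz //=; lia.
case: l => [|x l]; first by rewrite act_nil.
rewrite act_cons; case: m => [|m] in sf mi *.
  by rewrite (_ : (fun l' => f (x :: l')) = fun _ => 0) ?act0 //; apply/funext => l'; rewrite sf.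
apply: (IH _ _ m) => //.
by move=> l' ln; apply: sf.
Qed.

Lemma act_sum p i (J : Type) (s : seq J) (f : J -> seq S -> K) :
  act p i (fun l => \sum_(j <- s) f j l) = fun l => \sum_(j <- s) act p i (f j) l.
Proof.
elim: s => [|j s IH].
  transitivity (act p i (fun _ => 0)); first by congr (act p i _); apply/funext=> l; rewrite big_nil.
  by rewrite act0; apply/funext => l; rewrite big_nil.
transitivity (act p i (fun l => 1 * f j l + \sum_(j <- s) f j l)).
  by congr (act p i _); apply/funext=> l; rewrite big_cons mul1r.
by rewrite act_lin IH; apply/funext=> l; rewrite big_cons mul1r.
Qed.

Lemma actZ p i a f : act p i (fun l => a * f l) = fun l => a * act p i f l.
Proof.
have := act_lin p i a f (fun _ => 0); rewrite act0 => E.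
apply/funext => l; transitivity (act p i (fun l => a * f l + 0) l).
  by congr (act _ _ _ l); apply/funext => ?; rewrite addr0.
by rewrite E addr0.
Qed.

Hypothesis r0 : r != 0.

Lemma act0E p f l : act p 0 f l = act_plain p f l.
Proof. by []. Qed.

Lemma act1E p f l : act p 1 f l = act_shaded p f l.
Proof. by []. Qed.

Lemma eq_act p i f g l : f =1 g -> act p i f l = act p i g l.
Proof. by move=> /funext ->. Qed.

Lemma actZl p i a f l : act p i (fun l => a * f l) l = a * act p i f l.
Proof. by rewrite actZ. Qed.

Lemma act_suml p i (J : Type) (s : seq J) (f : J -> seq S -> K) l :
  act p i (fun l => \sum_(j <- s) f j l) l = \sum_(j <- s) act p i (f j) l.
Proof. by rewrite act_sum. Qed.

Lemma act_far_plain p q j f l :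
  act p 0 (act q (j + op_src p) f) l = act q (j + op_tgt p) (act p 0 f) l.
Proof.
case: p => [||o]; rewrite ?addn0 ?addn2.
- case: l => [|x l]; first by rewrite act_nil.
  rewrite act_cons act0E /= [RHS](@eq_act q j _ (fun l' => r^-1 * (psi x * f l'))) //.
  by rewrite !actZl.
- rewrite act0E /= act_cons [RHS](@eq_act q j _ (fun l' => r^-1 * f (1 :: l'))) //.
  by rewrite actZl.
- case: l => [|x l]; first by rewrite act_nil.
  rewrite act0E /= !act_cons [RHS](@eq_act q j _ (fun l' => r ^- 2 * f (H o x :: l'))) //.
  by rewrite actZl.
Qed.

(** The only case with mathematical content is that of two operations around
    the same shaded region: one multiplies the leg between them on its left, the
    other one on its right, so that associativity or [cop_mul] is needed. *)
Lemma act_far_shaded p q j f l : multilinear f -> (0 < j)%N ->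
  act p 1 (act q (j + op_src p) f) l = act q (j + op_tgt p) (act p 1 f) l.
Proof.
move=> mf; have mf1 w : multilinear (fun l' => f (w :: l')) by apply: multilinear_cons.
case: j => [//|[|j]] _.
  case: p => [||o]; rewrite ?addn0 ?addn2.
  - case: l => [|x [|y l]]; try by case: q.
  rewrite act_cons !act1E.
    case: q => [||o'] /=.
    + by case: l => [|z l]; rewrite ?mulr0 // !act1E /= [x * (y * z)]mulrA.
    + rewrite act1E; under [in RHS]eq_bigr do rewrite act1E /= [x * (y * _)]mulrA.
      by rewrite -mulr_sumr.
    + case: l => [|z l]; rewrite act1E ?mulr0 //.
      under [in RHS]eq_bigr do rewrite act1E /= [x * (y * _)]mulrA.
      by rewrite -mulr_sumr.
  - case: l => [|x l]; first by case: q.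
    have swp w v l' : \sum_(e <- E) f (w * v * e.1 :: e.2 :: l') =
                    \sum_(e <- E) f (w * e.1 :: e.2 * v :: l').
      under eq_bigr do rewrite -mulrA.
      rewrite (cop_mul (g := fun a b => f (w * a :: b :: l'))) //.
        by move=> a u u' b; rewrite mulrDr -scalerAr (mf [::]).
      by move=> a u b b'; rewrite (mf [:: _]).
    rewrite !act1E /=; under eq_bigr do rewrite act_cons act1E.
    case: q => [||o'] /=.
    + case: l => [|z l] /=; first by rewrite big1 ?mulr0.
      by rewrite act1E /= swp -mulr_sumr.
    + under [in RHS]eq_bigr do rewrite act1E /= swp.
      by rewrite -!mulr_sumr exchange_big.
    + case: l => [|z l] /=; first by rewrite big1 ?mulr0.
      under [in RHS]eq_bigr do rewrite act1E /= swp.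
      by rewrite -mulr_sumr exchange_big.
  - case: l => [|x [|y l]]; try by case: q.
  rewrite act_cons !act1E /=.
    under eq_bigr do rewrite act_cons act1E.
    case: q => [||o'] /=.
    + case: l => [|z l] /=; first by rewrite big1.
      by rewrite act1E /= mulr_sumr; under eq_bigr do rewrite -mulrA.
    + under [in RHS]eq_bigr do (rewrite act1E /=; under eq_bigr do rewrite mulrA).
      by rewrite -mulr_sumr exchange_big.
    + case: l => [|z l] /=; first by rewrite big1.
      under [in RHS]eq_bigr do (rewrite act1E /=; under eq_bigr do rewrite mulrA).
      by rewrite exchange_big.
case: p => [||o]; rewrite ?addn0 ?addn2.
- case: l => [|x [|y l]]; try by case: q.
  rewrite !act_cons act1E /= act_cons.
  by rewrite [RHS](@eq_act q j _ (fun l' => r * f (x * y :: l'))) // actZl.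
- case: l => [|x l] //; rewrite !act_cons act1E /=.
  under eq_bigr do rewrite !act_cons.
  rewrite [RHS](@eq_act q j _ (fun l' => r * \sum_(e <- E) f (x * e.1 :: e.2 :: l'))) //.
  by rewrite actZl act_suml.
- case: l => [|x [|y l]]; try by case: q.
  rewrite !act_cons act1E /=.
  under eq_bigr do rewrite !act_cons.
  rewrite [RHS](@eq_act q j _ (fun l' => \sum_(e <- E) f (x * e.1 :: H (~~ o) e.2 * y :: l'))) //.
  by rewrite act_suml.
Qed.

(** Operations on disjoint pairs of strands commute; [p] changes the number of
    the strands to its right. *)
Lemma act_far p q i j f : multilinear f -> (i <= j)%N ->
  act p i (act q (j + op_src p) f) = act q (j + op_tgt p) (act p i f).
Proof.
move=> mf ij; apply/funext => l.
elim/ltn_ind: i j f l mf ij => -[|[|i]] IH [|[|j]] f l mf ij //; try exact: act_far_plain.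
- exact: act_far_shaded.
- exact: act_far_shaded.
case: l => [|x l] //; rewrite !addSn !act_cons.
transitivity (act p i (act q (j + op_src p) (fun l' => f (x :: l'))) l).
  by apply: eq_act => l'; rewrite act_cons.
rewrite IH //; last exact: multilinear_cons.
by apply: eq_act => l'; rewrite act_cons.
Qed.

Lemma sizedP m f g : sized m f -> sized m g ->
  (forall l, size l = m -> f l = g l) -> f = g.
Proof.
move=> sf sg fg; apply/funext => l.
by have [/fg//|nl] := eqVneq (size l) m; rewrite sf ?sg.
Qed.

(** A word of operations, the last one first, at positions relative to [i]. *)
Definition acts (w : seq (op * nat)) i f := foldr (fun pa g => act pa.1 (pa.2 + i) g) f w.

Lemma acts_cons w i f x l : acts w i.+2 f (x :: l) = acts w i (fun l' => f (x :: l')) l.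
Proof.
elim: w f l x => [//|[p a] w IH] f l x; rewrite /acts /= -/(acts w _ _) !addnS act_cons.
by apply: eq_act => l'; apply: IH.
Qed.

(** A local relation holds everywhere if it holds at the first unshaded and at
    the first shaded position; its words may depend on the shading. The bound
    [b] says how many strands it involves, since an operation gives 0 when it is
    applied to missing strands. *)
Lemma acts_lift (w w' : bool -> seq (op * nat)) c b :
  (forall f l, multilinear f -> (b <= (size l).*2)%N ->
    acts (w false) 0 f l = c * acts (w' false) 0 f l) ->
  (forall f l, multilinear f -> (b < (size l).*2)%N ->
    acts (w true) 1 f l = c * acts (w' true) 1 f l) ->
  forall i f l, multilinear f -> (b + i <= (size l).*2)%N ->
    acts (w (odd i)) i f l = c * acts (w' (odd i)) i f l.
Proof.
move=> H0 H1; elim/ltn_ind => -[|[|i]] IH f l mf; rewrite ?addn0 ?addn1; try exact: H0; try exact: H1.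
case: l => [|x l]; rewrite ?addnS /= ?double0 ?doubleS ?ltnS // => sl.
rewrite !acts_cons !negbK; apply: IH => //; exact: multilinear_cons.
Qed.

(** In an unshaded region the loop is worth [psi 1] up to powers of [r], in a
    shaded one it is [m m^dagger = 1]. *)
Lemma act_loop i f l : multilinear f -> (i <= (size l).*2)%N ->
  act Cup i (act Cap i f) l = r ^+ 2 * f l.
Proof.
move: i f l; refine (@acts_lift (fun _ => [:: (Cup, 0%N); (Cap, 0%N)]) (fun _ => [::]) (r ^+ 2) 0 _ _) => /= f l mf.
  by rewrite act0E /= act0E /= bu_one => _; field.
case: l => [//|x l] _; rewrite act1E /= mulr_sumr.
under eq_bigr do rewrite act1E /= -mulrA.
rewrite -mulr_sumr -!mulr_sumr -(multilinear_sum [::]) //= -mulr_sumr bu_special mulr1; ring.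
Qed.

(** Around a shaded region this is [H H^dagger = delta^2], around an unshaded
    one the Schur relation. The orientation of the second crossing is the one
    that the first crossing imposes: it flips the bit of the region between the
    strands, which is the shaded one only for even [i]. *)
Lemma act_crossK i o f l : multilinear f -> (i.+2 <= (size l).*2)%N ->
  act (Cross (if odd i then o else ~~ o)) i (act (Cross o) i f) l = f l.
Proof.
rewrite -[RHS]mul1r; move: i f l; refine (@acts_lift
  (fun b => [:: (Cross (if b then o else ~~ o), 0%N); (Cross o, 0%N)]) (fun _ => [::]) 1 2 _ _) => /= f l mf.
  case: l => [//|x l] _; rewrite act0E /= act0E /= bu_mapK (multilinearZ [::]) //=.
  by field.
case: l => [//|x [|y l]] //= _; rewrite act1E mul1r /=.
under eq_bigr do rewrite act1E /=.
set o' := ~~ o; pose g (a b : S) := f (a :: b :: l).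
transitivity (\sum_(i <- [:: tt]) g x y); last by rewrite big_seq1.
transitivity (\sum_(p <- [seq (e, k) | e <- E, k <- E])
    g (x * p.1.1 * p.2.1) (H o' p.2.2 * (H o' p.1.2 * y))).
  by rewrite big_allpairs_dep.
apply: (tensor_ext (g := g)) => [a u u' v|a u v v'|z]; rewrite /g.
- by rewrite (mf [::]).
- by rewrite (mf [:: _]).
rewrite big_seq1 big_allpairs_dep /= -[RHS](_ : (psi (z * x) *: 1) * y = _); last first.
  by rewrite -scalerAl mul1r.
rewrite -(bu_schur o') mulr_suml; apply: eq_bigr => e _.
rewrite -[z * x * e.1]bu_copl linear_sum /= !mulr_suml; apply: eq_bigr => k _.
by rewrite linearZ /= -!scalerAl !mulrA.
Qed.

(** A bent strand can be straightened: by the copairing if the cup opens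
    inside a leg, and by the unit if not. *)
Lemma act_zigzag_r i f l : multilinear f -> (i.+1 <= (size l).*2)%N ->
  act Cup i.+1 (act Cap i f) l = f l.
Proof.
rewrite -[RHS]mul1r; move: i f l; refine (@acts_lift
  (fun _ => [:: (Cup, 1%N); (Cap, 0%N)]) (fun _ => [::]) 1 1 _ _) => /= f l mf.
  case: l => [//|x l] _; rewrite act1E mul1r /=.
  under eq_bigr do rewrite act0E /=.
  rewrite -mulr_sumr mulrA mulfV // mul1r.
  under eq_bigr do rewrite -(multilinearZ [::]) //.
  by rewrite -(multilinear_sum [::]) // bu_copl.
case: l => [//|x l] _; rewrite act_cons mul1r act0E /= act1E /= mulr1.
by field.
Qed.

Lemma act_zigzag_l i f l : multilinear f -> (i.+1 <= (size l).*2)%N ->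
  act Cup i (act Cap i.+1 f) l = f l.
Proof.
rewrite -[RHS]mul1r; move: i f l; refine (@acts_lift
  (fun _ => [:: (Cup, 0%N); (Cap, 1%N)]) (fun _ => [::]) 1 1 _ _) => /= f l mf.
  case: l => [//|x l] _; rewrite act0E mul1r /= act1E /= mul1r.
  by field.
case: l => [//|x l] _; rewrite mul1r act1E /=.
under eq_bigr do rewrite act_cons act0E /= -(multilinearZ [::]) //=.
rewrite -mulr_sumr mulrA mulfV // mul1r -(multilinear_sum [::]) //=; congr (f (_ :: _)).
rewrite -[RHS]mulr1 -[in RHS](bu_copr 1) mulr_sumr; apply: eq_bigr => e _.
by rewrite mulr1 scalerAr.
Qed.

(** A strand of the other letter slides across a cap. In an unshaded region
    this comes from [H H^dagger = delta^2], in a shaded one from the Schur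
    relation in the form [map_cup]. *)
Lemma act_slide_cap i o f l : multilinear f -> (i.+2 <= (size l).*2)%N ->
  act (Cross o) i (act (Cross o) i.+1 (act Cap i f)) l = act Cap i.+1 f l.
Proof.
rewrite -[RHS]mul1r; move: i f l; refine (@acts_lift
  (fun _ => [:: (Cross o, 0%N); (Cross o, 1%N); (Cap, 0%N)])
  (fun _ => [:: (Cap, 1%N)]) 1 2 _ _) => /= f l mf.
  case: l => [//|x [|y l]] _; rewrite mul1r act0E /= !act1E ?mulr0 //=.
  under eq_bigr do rewrite act0E /= -(multilinearZ [::]) //=.
  rewrite -mulr_sumr -(multilinear_sum [::]) //=.
  under eq_bigr do rewrite scalerAl -linearZ /=.
  rewrite -mulr_suml -linear_sum bu_copl map_negK -scalerAl (multilinearZ [::]) //=.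
  by field.
case: l => [//|x [|y l]] //= _; rewrite mul1r act1E /= act_cons act0E /=.
under eq_bigr do rewrite act_cons act0E /= act1E /=.
rewrite -!mulr_sumr -(multilinear_sum [::]) //=.
under eq_bigr do rewrite -mulrA.
rewrite -mulr_sumr map_cup -scalerAr mulr1 (multilinearZ [::]) //=.
by field.
Qed.

(** A strand of the other letter slides across a cup, as [H = H^*]. *)
Lemma act_slide_cup i o f l : multilinear f -> (i.+1 <= (size l).*2)%N ->
  act Cup i.+1 (act (Cross o) i f) l =
  act Cup i (act (Cross (if odd i then ~~ o else o)) i.+1 f) l.
Proof.
rewrite -[RHS]mul1r; move: i f l; refine (@acts_lift
  (fun _ => [:: (Cup, 1%N); (Cross o, 0%N)])
  (fun b => [:: (Cup, 0%N); (Cross (if b then ~~ o else o), 1%N)]) 1 1 _ _) => /= f l mf.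
  case: l => [//|x l] _; rewrite mul1r act1E act0E /= act1E /=.
  under eq_bigr do rewrite act0E /=.
  rewrite -mulr_sumr; under [in RHS]eq_bigr do rewrite mul1r.
  rewrite (tensor_ext (g := fun a b => f (a :: b :: l)) (t := E)
    (A' := fun e => e.1) (B' := fun e => H (~~ o) e.2 * x)).
  - by field.
  - by move=> a u u' v; rewrite (mf [::]).
  - by move=> a u v v'; rewrite (mf [:: _]).
  move=> z; under eq_bigr do rewrite bu_mapT mulrA.
  rewrite bu_copl; under [RHS]eq_bigr do rewrite scalerAl -linearZ.
  by rewrite -mulr_suml -linear_sum /= bu_copl.
case: l => [//|x l] _; rewrite mul1r act_cons act0E /= !act1E /=.
under [in RHS]eq_bigr do rewrite act_cons act0E /=.
under [in LHS]eq_bigr do rewrite mulr1.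
by rewrite -mulr_sumr; field.
Qed.

End Calculus.

(** * Bits of the regions in a row *)

(** Region [j] lies to the left of strand [j], so the shaded ones are those with
    odd [j]. [reg_ins], [reg_del] and [reg_flip] say what becomes of the bits
    under a cap, a cup and a crossing. *)
Definition reg_ins i q (t : nat -> bool) j :=
  if (j <= i)%N then t j else if j == i.+1 then q else t j.-2.
Definition reg_del i (t : nat -> bool) j := if (j <= i)%N then t j else t j.+2.
Definition reg_flip i (t : nat -> bool) j := t j (+) (j == i).
(** The letter of a strand tells whether the bits on its sides differ. A crossing
    of [i] and [i.+1] requires different letters, equivalently different bits on
    the regions [i] and [i.+2], and then flips the bit between them. *)
Definition letter (t : nat -> bool) j := t j (+) t j.+1.
(** The colour of the leg on which a crossing acts: the leg between the two
    strands, or, if the region between them is unshaded, the leg on the left. *)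
Definition orient (t : nat -> bool) i := if odd i then t i else t i.+1.

Ltac reg_case :=
  match goal with
  | |- context [(?a <= ?b)%N] => case: (leqP a b) => ?
  | |- context [@eq_op ?T ?a ?b] => unify (Equality.sort T) nat; case: (eqVneq a b) => ?
  end.
Ltac reg_tac :=
  rewrite /letter /reg_ins /reg_del /reg_flip /=; repeat (reg_case; rewrite /=);
  try (exfalso; lia); rewrite ?addbF ?addbT ?negbK; try (by []); subst;
  try (by []); try (congr (~~ _)); try (congr (_ _); lia); try (by []).

Section RegionMoves.
Implicit Types (t : nat -> bool).

Lemma flip_flip t i : reg_flip i (reg_flip i t) = t.
Proof. apply/funext => k; reg_tac. Qed.

Lemma flipC t i j : reg_flip i (reg_flip j t) = reg_flip j (reg_flip i t).
Proof. apply/funext => k; reg_tac. Qed.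

Lemma flip_ins_far t i j q : (i.+2 <= j)%N ->
  reg_flip i.+1 (reg_ins j q t) = reg_ins j q (reg_flip i.+1 t).
Proof. move=> ij; apply/funext => k; reg_tac. Qed.

Lemma flip_ins_far' t i j q : (i <= j)%N ->
  reg_flip j.+3 (reg_ins i q t) = reg_ins i q (reg_flip j.+1 t).
Proof. move=> ij; apply/funext => k; reg_tac. Qed.

Lemma del_flip_far t i j : (i <= j)%N ->
  reg_del i (reg_flip j.+3 t) = reg_flip j.+1 (reg_del i t).
Proof. move=> ij; apply/funext => k; reg_tac. Qed.

Lemma del_flip_far' t i j : (i <= j)%N ->
  reg_del j.+2 (reg_flip i.+1 t) = reg_flip i.+1 (reg_del j.+2 t).
Proof. move=> ij; apply/funext => k; reg_tac. Qed.

Lemma del_ins_far t i j q : (i <= j)%N -> t i = t i.+2 ->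
  reg_del i (reg_ins j.+2 q t) = reg_ins j q (reg_del i t).
Proof. move=> ij ti; apply/funext => k; reg_tac.
have -> : k.-2 = i by lia.
by rewrite ti; congr t; lia.
Qed.

Lemma del_ins_far' t i j q : (i <= j)%N ->
  reg_del j.+2 (reg_ins i q t) = reg_ins i q (reg_del j t).
Proof. move=> ij; apply/funext => k; reg_tac. Qed.

Lemma del_ins t i q : reg_del i (reg_ins i q t) = t.
Proof. apply/funext => k; reg_tac. Qed.

Lemma del_ins_l t i q : reg_del i (reg_ins i.+1 q t) = t.
Proof. apply/funext => k; reg_tac. Qed.

Lemma del_ins_r t i : reg_del i.+1 (reg_ins i (t i.+1) t) = t.
Proof. apply/funext => k; reg_tac. Qed.

Lemma slide_cap_reg t i :
  reg_flip i.+1 (reg_flip i.+2 (reg_ins i (~~ t i.+1) t)) = reg_ins i.+1 (~~ t i) t.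
Proof. apply/funext => k; reg_tac. Qed.

Lemma slide_cup_reg t i : t i.+3 = ~~ t i.+1 ->
  reg_del i.+1 (reg_flip i.+1 t) = reg_del i (reg_flip i.+2 t).
Proof. move=> ti; apply/funext => k; reg_tac. Qed.

End RegionMoves.

Lemma orient_flip_far t i j : (i.+2 <= j)%N ->
  (orient (reg_flip j.+1 t) i = orient t i) * (orient (reg_flip i.+1 t) j = orient t j).
Proof. by move=> ij; split; rewrite /orient; case: ifP => _; reg_tac. Qed.

Lemma orient_ins_lo t i j q : (i.+2 <= j)%N -> orient (reg_ins j q t) i = orient t i.
Proof. by move=> ij; rewrite /orient; case: ifP => _; reg_tac. Qed.

Lemma orient_ins_hi t i j q : (i <= j)%N -> orient (reg_ins i q t) j.+2 = orient t j.
Proof. by move=> ij; rewrite /orient /= negbK; case: ifP => _; reg_tac; congr t; lia. Qed.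

Lemma orient_del_lo t i j : (i.+2 <= j)%N -> orient (reg_del j t) i = orient t i.
Proof. by move=> ij; rewrite /orient; case: ifP => _; reg_tac. Qed.

Lemma orient_del_hi t i j : (i <= j)%N -> t i = t i.+2 ->
  orient (reg_del i t) j = orient t j.+2.
Proof.
move=> ij ti; rewrite /orient /= negbK; case: ifP => _; reg_tac.
by have -> : j = i by lia.
Qed.

(** * Diagrams with bits on their regions *)

Section States.
Variables (K : fieldType) (r : K).
Hypothesis r0 : r != 0.
Local Notation fam := (forall S : biunitary r, seq S -> K).

(** One diagram read in all biunitary systems at once: the family [fn] is what
    makes it possible to say that a value does not depend on the system. *)
Record state := State { legs : nat; reg : nat -> bool; fn : fam }.
Arguments fn : clear implicits.
Implicit Types u : state.

Definition good u := forall S, multilinear (fn u S) /\ sized (legs u) (fn u S).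

Definition cap i q u :=
  State (legs u).+1 (reg_ins i q (reg u)) (fun S => act Cap i (fn u S)).
Definition cup i u :=
  State (legs u).-1 (reg_del i (reg u)) (fun S => act Cup i (fn u S)).
Definition cross i u :=
  State (legs u) (reg_flip i.+1 (reg u))
    (fun S => act (Cross (orient (reg u) i)) i (fn u S)).

Lemma state_eq m m' t t' (f f' : fam) :
  m = m' -> t = t' -> (forall S, f S = f' S) -> State m t f = State m' t' f'.
Proof. by move=> -> -> ff'; congr State; apply: functional_extensionality_dep. Qed.

Lemma good_cap i q u : good u -> good (cap i q u).
Proof.
move=> gu S; have [/= mf sf] := gu S; split; first exact: multilinear_act.
by apply: sized_act sf => /=; rewrite addn1 addn0.
Qed.

Lemma good_cross i u : good u -> good (cross i u).
Proof.
move=> gu S; have [/= mf sf] := gu S; split; first exact: multilinear_act.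
exact: sized_act sf.
Qed.

Lemma good_cup i u : (0 < legs u)%N -> good u -> good (cup i u).
Proof.
move=> lu gu S; have [/= mf sf] := gu S; split; first exact: multilinear_act.
by apply: sized_act sf => /=; rewrite addn1 addn0 prednK.
Qed.

Lemma crossK i u : good u -> (i.+2 <= (legs u).*2)%N -> cross i (cross i u) = u.
Proof.
case: u => m t f gu im; apply: state_eq => //=; first exact: flip_flip.
move=> S; have [/= mf sf] := gu S; apply: (sizedP _ sf) => [|l sl].
  by have [] := good_cross i (good_cross i gu) S.
have <- := act_crossK r0 (i := i) (orient t i) mf (l := l); last by rewrite sl.
congr (act (Cross _) _ _ _); rewrite /orient; case: ifP => _.
  by rewrite /reg_flip ltn_eqF // addbF.
by rewrite /reg_flip eqxx addbT.
Qed.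

Lemma cross_cross i j u : good u -> (i.+2 <= j)%N ->
  cross i (cross j u) = cross j (cross i u).
Proof.
case: u => m t f gu ij; apply: state_eq => //=; first exact: flipC.
move=> S; have [/= mf sf] := gu S; rewrite (orient_flip_far t ij).1 (orient_flip_far t ij).2.
case: j ij => [|[|j]] // ij; have := @act_far _ _ S (Cross (orient t i)) (Cross (orient t j.+2)) i j _ mf.
by rewrite !addn2 => ->.
Qed.

Lemma cross_cap_lo i j q u : good u -> (i.+2 <= j)%N ->
  cross i (cap j q u) = cap j q (cross i u).
Proof.
case: u => m t f gu ij; apply: state_eq => //=; first exact: flip_ins_far.
move=> S; have [/= mf sf] := gu S; rewrite orient_ins_lo //.
case: j ij => [|[|j]] // ij; have := @act_far _ _ S (Cross (orient t i)) Cap i j _ mf.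
by rewrite !addn2 => ->.
Qed.

Lemma cross_cap_hi i j q u : good u -> (i <= j)%N ->
  cross j.+2 (cap i q u) = cap i q (cross j u).
Proof.
case: u => m t f gu ij; apply: state_eq => //=; first exact: flip_ins_far'.
move=> S; have [/= mf sf] := gu S; rewrite orient_ins_hi //.
have := @act_far _ _ S Cap (Cross (orient t j)) i j _ mf.
by rewrite addn2 addn0 => ->.
Qed.

Lemma cup_cross_hi i j u : good u -> (i <= j)%N -> reg u i = reg u i.+2 ->
  cup i (cross j.+2 u) = cross j (cup i u).
Proof.
case: u => m t f gu ij /= ti; apply: state_eq => //=; first exact: del_flip_far.
move=> S; have [/= mf sf] := gu S; rewrite orient_del_hi //.
have := @act_far _ _ S Cup (Cross (orient t j.+2)) i j _ mf.
by rewrite addn2 addn0 => ->.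
Qed.

Lemma cup_cross_lo i j u : good u -> (i <= j)%N ->
  cup j.+2 (cross i u) = cross i (cup j.+2 u).
Proof.
case: u => m t f gu ij; apply: state_eq => //=; first exact: del_flip_far'.
move=> S; have [/= mf sf] := gu S; rewrite orient_del_lo //.
have := @act_far _ _ S (Cross (orient t i)) Cup i j _ mf.
by rewrite addn2 => ->.
Qed.

Lemma cup_cap_hi i j q u : good u -> (0 < legs u)%N -> (i <= j)%N -> reg u i = reg u i.+2 ->
  cup i (cap j.+2 q u) = cap j q (cup i u).
Proof.
case: u => m t f gu /= m0 ij ti; apply: state_eq => /=.
- by rewrite prednK.
- exact: del_ins_far.
move=> S; have [/= mf sf] := gu S.
have := @act_far _ _ S Cup Cap i j _ mf.
by rewrite addn2 addn0 => ->.
Qed.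

Lemma cup_cap_lo i j q u : good u -> (0 < legs u)%N -> (i <= j)%N ->
  cup j.+2 (cap i q u) = cap i q (cup j u).
Proof.
case: u => m t f gu /= m0 ij; apply: state_eq => /=.
- by rewrite prednK.
- exact: del_ins_far'.
move=> S; have [/= mf sf] := gu S.
have := @act_far _ _ S Cap Cup i j _ mf.
by rewrite addn2 addn0 => ->.
Qed.

Lemma zigzag_r i u : good u -> (i < (legs u).*2)%N ->
  cup i.+1 (cap i (reg u i.+1) u) = u.
Proof.
case: u => m t f gu /= im; apply: state_eq => //=; first exact: del_ins_r.
move=> S; have [/= mf sf] := gu S; apply: (sizedP _ sf) => [|l sl].
  by have [] := good_cup i.+1 (u := cap i true (State m t f)) isT (good_cap i true gu) S.
by rewrite act_zigzag_r // sl.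
Qed.

Lemma zigzag_l i q u : good u -> (i < (legs u).*2)%N ->
  cup i (cap i.+1 q u) = u.
Proof.
case: u => m t f gu /= im; apply: state_eq => //=; first exact: del_ins_l.
move=> S; have [/= mf sf] := gu S; apply: (sizedP _ sf) => [|l sl].
  by have [] := good_cup i (u := cap i.+1 true (State m t f)) isT (good_cap i.+1 true gu) S.
by rewrite act_zigzag_l // sl.
Qed.

Lemma loop i q u : good u -> (i <= (legs u).*2)%N ->
  cup i (cap i q u) = State (legs u) (reg u) (fun S l => r ^+ 2 * fn u S l).
Proof.
case: u => m t f gu /= im; apply: state_eq => //=; first exact: del_ins.
move=> S; have [/= mf sf] := gu S; apply: (@sizedP _ _ _ m) => [|l ln|l sl].
- by have [] := good_cup i (u := cap i true (State m t f)) isT (good_cap i true gu) S.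
- by rewrite sf ?mulr0.
by rewrite act_loop // sl.
Qed.

(** The bit [q] of a new cap is forced by the letter of the strand that is to
    slide across it. *)
Lemma slide_cap i u : good u -> (i <= (legs u).*2)%N ->
  cross i (cross i.+1 (cap i (~~ reg u i.+1) u)) = cap i.+1 (~~ reg u i) u.
Proof.
case: u => m t f gu /= im; apply: state_eq => //=; first exact: slide_cap_reg.
move=> S; have [/= mf sf] := gu S.
have [_ s1] := good_cap i.+1 true gu S.
have [_ s2] := good_cross i (good_cross i.+1 (good_cap i (~~ t i.+1) gu)) S.
apply: sizedP s2 s1 _ => l sl /=.
rewrite /= in sl.
have -> : orient (reg_flip i.+2 (reg_ins i (~~ t i.+1) t)) i =
          orient (reg_ins i (~~ t i.+1) t) i.+1.
  by rewrite /orient /=; case: (odd i) => /=; reg_tac.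
by rewrite act_slide_cap // sl doubleS !ltnS.
Qed.

Lemma slide_cup i u : good u -> (i.+3 <= (legs u).*2)%N ->
  reg u i.+2 = ~~ reg u i -> reg u i.+3 = ~~ reg u i.+1 ->
  cup i.+1 (cross i u) = cup i (cross i.+1 u).
Proof.
case: u => m t f gu /= im t2 t3; apply: state_eq => //=; first exact: slide_cup_reg.
move=> S; have [/= mf sf] := gu S.
have m0 : (0 < m)%N by case: (m) im.
have [_ s1] := good_cup i.+1 (u := cross i (State m t f)) m0 (good_cross i gu) S.
have [_ s2] := good_cup i (u := cross i.+1 (State m t f)) m0 (good_cross i.+1 gu) S.
apply: sizedP s1 s2 _ => l sl /=; rewrite /= in sl.
rewrite act_slide_cup //; last first.
  by rewrite sl; move: im; case: (m) m0 => // m' _; rewrite doubleS !ltnS.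
by congr (act _ _ (act (Cross _) _ _) _); rewrite /orient /=; case: (odd i); rewrite ?t2.
Qed.

(** * Diagrams of caps and crossings *)

(** Spans of diagrams without cups; these are the normal forms of diagrams. *)
Inductive planar : state -> Prop :=
| planar0 m t : planar (State m t (fun S _ => 0))
| planar_lin a m t (f g : fam) : planar (State m t f) -> planar (State m t g) ->
    planar (State m t (fun S l => a * f S l + g S l))
| planar_nil : planar (State 0 (fun _ => false) (fun S => @nil_form K S))
| planar_cap i q u : (i <= (legs u).*2)%N -> planar u -> planar (cap i q u)
| planar_cross i u : (i.+2 <= (legs u).*2)%N -> reg u i != reg u i.+2 ->
    planar u -> planar (cross i u).

Lemma planar_good u : planar u -> good u.
Proof.
elim=> {u}.
- by move=> m t S; split=> // l1 l2 a u v; rewrite mulr0 addr0.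
- move=> a m t f g _ gf _ gg S; have [/= mf sf] := gf S; have [/= mg sg] := gg S.
  split=> [l1 l2 b u v|l ln] /=; last by rewrite sf // sg // mulr0 addr0.
  by rewrite mf mg; ring.
- by move=> S; split=> [|[|x l]] //; apply: multilinear_nilf.
- by move=> i q u _ _ gu; apply: good_cap.
by move=> i u _ _ _ gu; apply: good_cross.
Qed.

Lemma planarZ a m t f : planar (State m t f) -> planar (State m t (fun S l => a * f S l)).
Proof.
move=> pf; have -> : State m t (fun S l => a * f S l) =
    State m t (fun S l => a * f S l + (fun S' _ => 0 : K) S l).
  by apply: state_eq => // S; apply/funext => l; rewrite addr0.
by apply: planar_lin => //; apply: planar0.
Qed.

(** Strand [i] is pulled across the next [n] strands and joined to the one
    behind them, the strands in between having the other letter. Cups alone are not enough for the induction below: when a cup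
    is moved past a crossing, it becomes an arch around one more strand. *)
Fixpoint coarch n i u := if n is n'.+1 then coarch n' i.+1 (cross i u) else cup i u.

Definition coarchable n i u :=
  [/\ (i + n).+2 <= (legs u).*2, letter (reg u) (i + n).+1 = letter (reg u) i
    & forall k, i < k <= i + n -> letter (reg u) k = ~~ letter (reg u) i]%N.

Lemma letter_flip t i k : letter (reg_flip i.+1 t) k =
  letter t k (+) ((k == i) || (k == i.+1)).
Proof. reg_tac; by case: (t _); case: (t _). Qed.

Lemma letter_ins_lo t i q k : (k < i)%N -> letter (reg_ins i q t) k = letter t k.
Proof. move=> ki; reg_tac. Qed.
Lemma letter_ins_l t i q : letter (reg_ins i q t) i = t i (+) q.
Proof. reg_tac. Qed.
Lemma letter_ins_r t i q : letter (reg_ins i q t) i.+1 = t i (+) q.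
Proof. reg_tac. by rewrite addbC. Qed.
Lemma letter_ins_hi t i q k : (i <= k)%N -> letter (reg_ins i q t) k.+2 = letter t k.
Proof. move=> ki; reg_tac. Qed.

Lemma letter_cross t i : (t i != t i.+2) = (letter t i != letter t i.+1).
Proof. by rewrite /letter; case: (t i); case: (t i.+1); case: (t i.+2). Qed.

Lemma coarchable_step n i u : coarchable n.+1 i u -> coarchable n i.+1 (cross i u).
Proof.
case=> [im li lk]; split=> /=; first by move: im; rewrite addnS.
- rewrite !letter_flip addSnnS li eqxx orbT (lk i.+1); last by lia.
  have /negPf -> : (i + n.+1).+1 != i by lia.
  have /negPf -> : (i + n.+1).+1 != i.+1 by lia.
  by rewrite addbF addbT negbK.
move=> k ik; rewrite !letter_flip (lk k); last by lia.
rewrite (lk i.+1); last by lia.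
have /negPf -> : k != i by lia.
have /negPf -> : k != i.+1 by lia.
by rewrite eqxx orbT addbF addbT negbK.
Qed.

Lemma letter_cup n i u : coarchable n i u -> n = 0 -> reg u i = reg u i.+2.
Proof.
move=> [_ + _] n0; rewrite n0 addn0 /letter.
by case: (reg u i); case: (reg u i.+1); case: (reg u i.+2).
Qed.

Lemma coarch_reg_lo n i u j : (j <= i)%N -> reg (coarch n i u) j = reg u j.
Proof.
elim: n i u => [|n IH] i u ji /=; first by reg_tac.
by rewrite IH ?leqW //=; reg_tac.
Qed.

Lemma coarch_reg_hi n i u j : (i + n < j)%N -> reg (coarch n i u) j = reg u j.+2.
Proof.
elim: n i u => [|n IH] i u ji /=; first by reg_tac.
by rewrite IH //=; [reg_tac | lia].
Qed.

Lemma coarch_legs n i u : legs (coarch n i u) = (legs u).-1.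
Proof. by elim: n i u => [//|n IH] i u /=; rewrite IH. Qed.

Lemma coarch_cross_lo n i k u : good u -> (k.+2 <= i)%N ->
  coarch n i (cross k u) = cross k (coarch n i u).
Proof.
elim: n i u => [|n IH] i u gu ki /=.
  by case: i ki => [|[|i]] // ki; apply: cup_cross_lo.
rewrite -cross_cross // IH //; [exact: good_cross | by apply: leqW].
Qed.

Lemma coarch_cross_hi n i k u : good u -> coarchable n i u -> (i + n <= k)%N ->
  coarch n i (cross k.+2 u) = cross k (coarch n i u).
Proof.
elim: n i u => [|n IH] i u gu cu ik /=.
  by apply: cup_cross_hi => //; [lia | exact: letter_cup cu _].
rewrite cross_cross //; last by lia.
by rewrite IH //; [exact: good_cross | exact: coarchable_step | lia].
Qed.

Lemma coarch_cap_lo n i k q u : good u -> (0 < legs u)%N -> (k <= i)%N ->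
  coarch n i.+2 (cap k q u) = cap k q (coarch n i u).
Proof.
elim: n i u => [|n IH] i u gu lu ki /=; first exact: cup_cap_lo.
by rewrite cross_cap_hi // IH //; [exact: good_cross | exact: leqW].
Qed.

Lemma coarch_cap_hi n i k q u : good u -> coarchable n i u -> (i + n <= k)%N ->
  coarch n i (cap k.+2 q u) = cap k q (coarch n i u).
Proof.
elim: n i u => [|n IH] i u gu cu ik /=.
  apply: cup_cap_hi => //; [|lia|exact: letter_cup cu _].
  by case: cu => + _ _; case: (legs u).
rewrite cross_cap_lo //; last by lia.
by rewrite IH //; [exact: good_cross | exact: coarchable_step | lia].
Qed.

(** An arch can also be drawn by pulling its right end to the left, since a
    strand slides across a cup. *)
Lemma coarch_shrink_r n i u : good u -> coarchable n.+1 i u ->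
  coarch n.+1 i u = coarch n i (cross (i + n).+1 u).
Proof.
elim: n i u => [|n IH] i u gu cu.
  have [im li lk] := cu; have {}lk : letter (reg u) i.+1 = ~~ letter (reg u) i by apply: lk; lia.
  rewrite addn1 in im li.
  rewrite /= addn0 slide_cup //.
  - by move: li lk; rewrite /letter; case: (reg u i); case: (reg u i.+1);
      case: (reg u i.+2); case: (reg u i.+3).
  by move: li lk; rewrite /letter; case: (reg u i); case: (reg u i.+1);
      case: (reg u i.+2); case: (reg u i.+3).
rewrite -[LHS]/(coarch n.+1 i.+1 (cross i u)) IH; last 2 first.
- exact: good_cross.
- exact: coarchable_step.
by rewrite addSnnS -cross_cross //; lia.
Qed.

Lemma coarch_lin n i m t (f g : fam) a : exists m' t' (f' g' : fam),
  [/\ coarch n i (State m t f) = State m' t' f', coarch n i (State m t g) = State m' t' g'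
    & coarch n i (State m t (fun S l => a * f S l + g S l)) =
      State m' t' (fun S l => a * f' S l + g' S l)].
Proof.
elim: n i m t f g => [|n IH] i m t f g.
  exists m.-1, (reg_del i t), (fun S => act Cup i (f S)), (fun S => act Cup i (g S)).
  by split=> //; apply: state_eq => //= S; apply: act_lin.
rewrite /=; set o := Cross (orient t i).
have [m' [t' [f' [g' [ef eg efg]]]]] := IH i.+1 m (reg_flip i.+1 t)
   (fun S => act o i (f S)) (fun S => act o i (g S)).
exists m', t', f', g'; split=> //; rewrite -efg; congr (coarch n i.+1 _).
by apply: state_eq => //= S; apply: act_lin.
Qed.

Lemma planar_coarch0 n i m t : planar (coarch n i (State m t (fun S _ => 0))).
Proof.
elim: n i m t => [|n IH] i m t /=.
  rewrite (_ : cup _ _ = State m.-1 (reg_del i t) (fun S _ => 0)); first exact: planar0.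
  by apply: state_eq => //= S; apply: act0.
rewrite (_ : cross _ _ = State m (reg_flip i.+1 t) (fun S _ => 0)) //.
by apply: state_eq => //= S; apply: act0.
Qed.

Lemma coarch_reg_end n i u : coarchable n i u ->
  reg (coarch n i u) (i + n) = reg u (i + n).+2.
Proof.
elim: n i u => [|n IH] i u cu /=.
  by rewrite addn0 -(letter_cup cu) //; reg_tac.
rewrite addnS -addSn IH; last exact: coarchable_step.
have /negPf ne : (i.+1 + n).+2 != i.+1 by lia.
by rewrite /= /reg_flip ne addbF.
Qed.

Lemma coarchable_cross_lo n i k u : (k.+2 <= i)%N ->
  coarchable n i (cross k u) -> coarchable n i u.
Proof.
move=> ki [/= im li lk]; move: li lk.
have E j : (i <= j)%N -> letter (reg_flip k.+1 (reg u)) j = letter (reg u) j.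
  move=> ij; rewrite letter_flip.
  have /negPf -> : j != k by lia.
  have /negPf -> : j != k.+1 by lia.
  by rewrite addbF.
rewrite !E //; last by lia.
by move=> li lk; split=> // j ij; rewrite -E ?lk //; lia.
Qed.

(** The left end of the arch is the right foot of a cap. If the arch is a cup,
    it straightens the cap. If not, the next strand slides across the cap, which
    makes the arch shorter. *)
Lemma planar_coarch_cap_l n i q u : planar u -> (i <= (legs u).*2)%N ->
  coarchable n i.+1 (cap i q u) -> planar (coarch n i.+1 (cap i q u)).
Proof.
elim: n i q u => [|n IH] i q u pu iu cu; have gu := planar_good pu.
  have [/= im li _] := cu; rewrite addn0 letter_ins_hi // letter_ins_r in li.
  have <- : reg u i.+1 = q by move: li; rewrite /letter; case: (reg u i); case: (reg u _); case: (q).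
  by rewrite zigzag_r //; rewrite addn0 doubleS !ltnS in im.
have [/= im _ /(_ i.+2)] := cu; rewrite letter_ins_hi // letter_ins_r => li.
have {li} qE : q = ~~ reg u i.+1.
  have := li ltac:(lia); rewrite /letter.
  by case: (reg u i); case: (reg u _); case: (q).
have gc q' k := good_cap k q' gu.
have swap : cross i.+1 (cap i q u) = cross i (cap i.+1 (~~ reg u i) u).
  rewrite qE -slide_cap // crossK //=; solve [exact/good_cross/gc | exact: gc | lia].
have cs := coarchable_step cu; rewrite swap in cs.
have {}cs := coarchable_cross_lo (leqnn _) cs.
rewrite swap coarch_cross_lo //.
have im' : (i.+2 <= (legs u).*2)%N by lia.
apply: planar_cross; first by rewrite coarch_legs.
  rewrite !coarch_reg_lo //=; last by lia.
  by reg_tac; case: (reg u i).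
by apply: IH => //; lia.
Qed.

(** The mirror image, with the right end of the arch on the left foot of a
    cap. *)
Lemma planar_coarch_cap_r n i q u : planar u -> ((i + n).+1 <= (legs u).*2)%N ->
  coarchable n i (cap (i + n).+1 q u) -> planar (coarch n i (cap (i + n).+1 q u)).
Proof.
elim: n i q u => [|n IH] i q u pu iu cu; have gu := planar_good pu.
  by rewrite /= addn0 in iu *; rewrite zigzag_l.
have gc q' k := good_cap k q' gu.
have [/= im li lk] := cu; rewrite addnS in iu im li lk cu *.
set j := (i + n).+1 in iu im li lk cu *.
rewrite letter_ins_l letter_ins_lo in li; last by lia.
have lj : letter (reg u) j = ~~ letter (reg u) i.
  by have := lk j ltac:(lia); rewrite !letter_ins_lo //; lia.
have qE : q = ~~ reg u j.
  move: li lj; rewrite /letter; case: (reg u i.+1); case: (reg u i);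
  by case: (reg u j.+1); case: (reg u j); case: (q).
have swap : cross j (cap j.+1 q u) = cross j.+1 (cap j (~~ reg u j.+1) u).
  rewrite qE -slide_cap ?crossK //=; solve [exact/good_cross/gc | lia].
have cw : coarchable n i (cap j (~~ reg u j.+1) u).
  split=> /=; first by lia.
    rewrite letter_ins_l letter_ins_lo; last by lia.
    by move: lj; rewrite /letter; case: (reg u j); case: (reg u j.+1);
       case: (reg u i); case: (reg u i.+1).
  by move=> k ik; have := lk k ltac:(lia); rewrite !letter_ins_lo //; lia.
rewrite -[coarch _ _ _]/(coarch n.+1 i (cap j.+1 q u)) coarch_shrink_r // -/j swap coarch_cross_hi //.
apply: planar_cross; first by rewrite coarch_legs /=; lia.
  rewrite coarch_reg_end // coarch_reg_hi /=; last by lia.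
  by rewrite -/j; reg_tac; rewrite /j /=; case: (reg u _).
by apply: IH => //; lia.
Qed.

(** A cap inside the arch is pulled out of it: the arch crosses both feet of the
    cap and slides off. *)
Lemma coarch_cap_in p n i q u : good u -> (p <= n)%N ->
  coarchable n.+2 i (cap (i + p).+1 q u) ->
  exists q', coarch n.+2 i (cap (i + p).+1 q u) = cap (i + p) q' (coarch n i u).
Proof.
elim: p n i q u => [|p IH] n i q u gu pn cu.
  rewrite addn0 in cu *; have [/= im _ /(_ i.+1)] := cu.
  rewrite letter_ins_l letter_ins_lo // => li.
  have qE : q = ~~ reg u i.
    have := li ltac:(lia); rewrite /letter.
    by case: (reg u i); case: (reg u _); case: (q).
  exists (~~ reg u i.+1); rewrite qE -slide_cap //; last by lia.
  have gc := good_cap i (~~ reg u i.+1) gu.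
  rewrite -[LHS]/(coarch n i.+2 (cross i.+1 (cross i _))).
  rewrite !crossK ?coarch_cap_lo //=; [lia|lia|exact: good_cross|lia].
rewrite addnS in cu *; case: n pn cu => [//|n] pn cu.
have := coarchable_step cu; rewrite cross_cap_lo //; last by lia.
rewrite -addSn => cs.
have [q' E] := IH n i.+1 q (cross i u) (good_cross i gu) pn cs.
by exists q'; rewrite -[LHS]/(coarch n.+2 i.+1 (cross i _)) cross_cap_lo // -?addSn ?E; lia.
Qed.

Lemma coarchable_cap_in p n i q u : (p <= n)%N ->
  coarchable n.+2 i (cap (i + p).+1 q u) -> coarchable n i u.
Proof.
move=> pn [/= im li lk].
have e : letter (reg_ins (i + p).+1 q (reg u)) i = letter (reg u) i.
  by rewrite letter_ins_lo //; lia.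
rewrite e in li lk.
split; first by lia.
  by move: li; rewrite !addnS letter_ins_hi //; lia.
move=> k ik; have [kp|kp] := leqP k (i + p).
  by have := lk k ltac:(lia); rewrite letter_ins_lo //; lia.
by have := lk k.+2 ltac:(lia); rewrite letter_ins_hi //; lia.
Qed.

Lemma inner_position i k n : (i < k)%N -> (k < i + n)%N ->
  exists p n', [/\ p <= n', k = (i + p).+1 & n = n'.+2]%N.
Proof. by move=> ik kn; exists (k - i.+1)%N, (n - 2)%N; split; lia. Qed.

(** By induction on the diagram, according to the position of its last operation
    relative to the arch. Away from the ends of the arch, a cap or a crossing
    commutes with it; a cap inside is pulled out; a cap with one foot on an end
    is straightened, and a cap with both feet on the ends closes a loop. Two
    strands inside the arch have the same letter, so they do not cross. A
    crossing of an end with a strand outside becomes part of a longer arch, and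
    a crossing of an end with a strand inside cancels against the arch. *)
Theorem planar_coarch u : planar u ->
  forall n i, coarchable n i u -> planar (coarch n i u).
Proof.
elim=> {u} [m t|a m t f g pf IHf pg IHg||k q u ku pu IH|k u ku tk pu IH] n i cu.
- exact: planar_coarch0.
- have [m' [t' [f' [g' [ef eg ->]]]]] := coarch_lin n i m t f g a.
  by apply: planar_lin; [rewrite -ef; apply: IHf | rewrite -eg; apply: IHg].
- by case: cu.
- have gu := planar_good pu; have [/= im li lk] := cu.
  have lkk : letter (reg_ins k q (reg u)) k = letter (reg_ins k q (reg u)) k.+1.
    by rewrite letter_ins_l letter_ins_r.
  have [k1i|ik1] := ltnP k.+1 i.
    case: i k1i cu im li lk => [|[|i]] // k1i cu im li lk.
    rewrite coarch_cap_lo //; last by case: (legs u) im.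
    apply: planar_cap; first by rewrite coarch_legs; lia.
    apply: IH; split; first by lia.
      by move: li; rewrite !addSn !letter_ins_hi //; lia.
    move=> j ij; have := lk j.+2 ltac:(lia); rewrite !letter_ins_hi //; lia.
  have [eik|nik] := eqVneq i k.+1; first by rewrite eik in cu *; apply: planar_coarch_cap_l.
  have [eik|nik'] := eqVneq i k.
    rewrite -eik in ku lkk li lk cu im *; case: n => [|n] in im li lk cu *.
      by rewrite /= loop //; apply: planarZ; case: (u) pu.
    by have := lk i.+1; rewrite -lkk; case: (letter _ _) => /(_ ltac:(lia)).
  have ltik : (i < k)%N by lia.
  have [kin|ink] := leqP k.+1 (i + n).
    have [p [n' [pn' kE nE]]] := inner_position ltik kin.
    rewrite kE nE in cu *; have [q' ->] := coarch_cap_in gu pn' cu.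
    apply: planar_cap; first by rewrite coarch_legs; lia.
    exact/IH/(coarchable_cap_in pn' cu).
  have [ekin|nkin] := eqVneq k (i + n)%N.
    have e : k.+1 = (i + n).+1 by rewrite ekin.
    by have := lk k ltac:(lia); rewrite lkk e li; case: (letter _ _).
  have [ekin|nkin'] := eqVneq k (i + n)%N.+1.
    by rewrite ekin in cu ku *; apply: planar_coarch_cap_r.
  have [k' kE] : exists k', k = k'.+2 by exists k.-2; lia.
  subst k; rename k' into k.
  have ink' : (i + n <= k)%N by lia.
  have cu' : coarchable n i u.
    split; first by lia.
      by move: li; rewrite !letter_ins_lo //; lia.
    by move=> j ij; have := lk j ltac:(lia); rewrite !letter_ins_lo //; lia.
  rewrite coarch_cap_hi //; apply: planar_cap; last exact: IH.
  by rewrite coarch_legs; lia.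
have gu := planar_good pu; have [/= im li lk] := cu.
have gc := good_cross k gu.
have lE j : j != k -> j != k.+1 ->
    letter (reg_flip k.+1 (reg u)) j = letter (reg u) j.
  by move=> /negPf jk /negPf jk1; rewrite letter_flip jk jk1 addbF.
have lkk : letter (reg_flip k.+1 (reg u)) k != letter (reg_flip k.+1 (reg u)) k.+1.
  by rewrite -letter_cross; move: tk; reg_tac.
have lku := tk; rewrite letter_cross in lku.
have [k1i|ik1] := ltnP k.+1 i.
  rewrite coarch_cross_lo //; apply: planar_cross.
  - by rewrite coarch_legs; lia.
  - by rewrite !coarch_reg_lo //; lia.
  exact/IH/(coarchable_cross_lo k1i cu).
have [eik|nik] := eqVneq i k.+1.
  rewrite eik in cu im li lk *.
  rewrite -[coarch _ _ _]/(coarch n.+1 k u); apply: IH; split; first by lia.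
    move: li; rewrite addSn lE; [|lia|lia].
    by rewrite addnS => ->; rewrite letter_flip eqxx orbT addbT;
       move: lku; case: (letter _ _); case: (letter _ _).
  move=> j jk; have [->|njk] := eqVneq j k.+1.
    by move: lku; case: (letter _ _); case: (letter _ _).
  have := lk j ltac:(lia); rewrite lE //; last by lia.
  move=> ->; rewrite letter_flip eqxx orbT addbT;
       by move: lku; case: (letter _ _); case: (letter _ _).
have [eik|nik'] := eqVneq i k.
  rewrite -eik in cu im li lk lkk gc *; case: n => [|n] in cu im li lk *.
    by rewrite addn0 in li; rewrite li eqxx in lkk.
  have := coarchable_step cu; rewrite /= crossK //; last by rewrite eik.
  exact: IH.
have ltik : (i < k)%N by lia.
have [kin|ink] := ltnP k (i + n).
  by move: lkk; rewrite (lk k) ?(lk k.+1) ?eqxx //; lia.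
have [ekin|nkin] := eqVneq k (i + n)%N.
  case: n => [|n] in cu im li lk ink ekin *; first by lia.
  have nE : k = (i + n).+1 by lia.
  rewrite coarch_shrink_r // -nE crossK //; apply: IH; split; first by lia.
    rewrite -nE -[letter (reg u) i]lE; [|lia|lia].
    rewrite -li -ekin letter_flip eqxx orbT addbT.
    by move: lku; case: (letter _ _); case: (letter _ _).
  by move=> j ij; have := lk j ltac:(lia); rewrite !lE //; lia.
have [ekin|nkin'] := eqVneq k (i + n)%N.+1.
  have cu' : coarchable n.+1 i u.
    split; first by lia.
      rewrite addnS -ekin; move: li; rewrite -ekin letter_flip eqxx /= addbT lE //.
      by move=> <-; move: lku; case: (letter _ _); case: (letter _ _).
    move=> j ij; have [->|njk] := eqVneq j k.
      by move: li; rewrite -ekin letter_flip eqxx /= addbT lE // => <-; rewrite negbK.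
    have := lk j ltac:(lia); rewrite !lE //; lia.
  have := IH _ _ cu'; rewrite coarch_shrink_r //.
  by rewrite -ekin.
have [k' kE] : exists k', k = k'.+2 by exists k.-2; lia.
subst k; rename k' into k.
have cu' : coarchable n i u.
  split; first by lia.
    by move: li; rewrite !lE //; lia.
  by move=> j ij; have := lk j ltac:(lia); rewrite !lE //; lia.
rewrite coarch_cross_hi //; last by lia.
apply: planar_cross; last exact: IH.
  by rewrite coarch_legs; lia.
have [ek|nk] := eqVneq k (i + n)%N.
  by rewrite ek coarch_reg_end // coarch_reg_hi // -ek; lia.
by rewrite !coarch_reg_hi //; lia.
Qed.

Corollary planar_cup i u : planar u -> (i.+2 <= (legs u).*2)%N ->
  reg u i = reg u i.+2 -> planar (cup i u).
Proof.
move=> pu iu ri; apply: (planar_coarch pu (n := 0)); split.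
- by rewrite addn0.
- by rewrite addn0 /letter -ri addbC.
by move=> k; rewrite addn0; lia.
Qed.

(** Operations on missing strands give 0, so the bounds on positions can be
    dropped. *)
Lemma planar_capT i q u : planar u -> planar (cap i q u).
Proof.
move=> pu; have [|iu] := leqP i (legs u).*2; first by move/planar_cap; apply.
rewrite (_ : cap i q u = State (legs u).+1 (reg_ins i q (reg u)) (fun S _ => 0)); first exact: planar0.
apply: state_eq => // S; have [_ sf] := planar_good pu S.
by apply: (act_out sf); rewrite addn0.
Qed.

Lemma planar_crossT i u : planar u -> reg u i != reg u i.+2 -> planar (cross i u).
Proof.
move=> pu ri; have [iu|iu] := leqP i.+2 (legs u).*2; first exact: planar_cross.
rewrite (_ : cross i u = State (legs u) (reg_flip i.+1 (reg u)) (fun S _ => 0)); first exact: planar0.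
apply: state_eq => // S; have [_ sf] := planar_good pu S.
by apply: (act_out sf); rewrite addn2.
Qed.

Lemma planar_cupT i u : planar u -> reg u i = reg u i.+2 -> planar (cup i u).
Proof.
move=> pu ri; have [iu|iu] := leqP i.+2 (legs u).*2; first exact: planar_cup.
rewrite (_ : cup i u = State (legs u).-1 (reg_del i (reg u)) (fun S _ => 0)); first exact: planar0.
apply: state_eq => // S; have [_ sf] := planar_good pu S.
by apply: (act_out sf); rewrite addn2.
Qed.

(** A cap or a crossing has at least one leg, so the empty diagram is the only
    generator with a value on the empty list. *)
Lemma planar_scalar u : planar u -> exists c, forall S, fn u S [::] = c.
Proof.
elim=> {u} [m t|a m t f g _ [c fc] _ [d gd]||i q u _ _ _|i u _ _ _ _].
- by exists 0.
- by exists (a * c + d) => S; have := fc S; have := gd S => /= -> ->.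
- by exists 1.
- exists 0 => S; rewrite /= /act; case: (odd i); case: (i./2) => //.
exists 0 => S; rewrite /= /act; case: (odd i); case: (i./2) => //.
Qed.

End States.

Arguments fn {K r} _ _ _.

(** * Positivity of tensor powers *)

Section PositiveForms.
Variables (C : numClosedFieldType) (V : vectType C).
Implicit Types b : V -> V -> C.

Definition pos_form b :=
  [/\ forall a u u' v, b (a *: u + u') v = a^* * b u v + b u' v,
      forall u v, (b u v)^* = b v u & forall u, 0 <= b u u].

Lemma pos_form_linr b : pos_form b ->
  forall a u v v', b u (a *: v + v') = a * b u v + b u v'.
Proof.
move=> [bl bh _] a u v v'; rewrite -bh bl rmorphD rmorphM /= conjCK.
by rewrite !bh.
Qed.

(** Cauchy-Schwarz in the degenerate case. *)
Lemma pos_form_radical b u : pos_form b -> b u u = 0 -> forall w, b u w = 0.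
Proof.
move=> pb b0 w; have blr := pos_form_linr pb; have [bl bh bp] := pb.
apply/eqP/negPn/negP => nz.
pose z := b u w; have zz : 0 < z * z^* by rewrite mul_conjC_gt0.
(* The vector [(c * z) *: u + w] would have the norm [- (b w w + 2)]. *)
pose c := - ((b w w + 1) / (z * z^*)).
have cr : c^* = c.
  rewrite /c rmorphN rmorphM rmorphD rmorph1 /= bh fmorphV rmorphM /= conjCK.
  by rewrite [z^* * z]mulrC.
have := bp ((c * z) *: u + w); rewrite bl blr blr b0.
rewrite -[b w u]bh -/z rmorphM /= cr mulr0 add0r.
have -> : c * z^* * z + (c * z * z^* + b w w) = 2%:R * (c * (z * z^*)) + b w w.
  by ring.
have -> : c * (z * z^*) = - (b w w + 1) by rewrite /c mulNr divfK // gt_eqF.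
have -> : 2%:R * - (b w w + 1) + b w w = - (b w w + 2%:R) by ring.
rewrite oppr_ge0 => le0; have : 0 < b w w + 2%:R by rewrite ltr_wpDl // ltr0n.
by move=> /lt_le_trans/(_ le0); rewrite ltxx.
Qed.

(** The Gram-Schmidt process, which takes one basis vector at a time to the
    radical of the form. It yields functionals and not vectors, because the form
    may be degenerate. *)
Lemma pos_form_frame b : pos_form b ->
  exists s : seq (V -> C), forall v w, b v w = \sum_(phi <- s) (phi v)^* * phi w.
Proof.
pose e := vbasis {:V}.
suff H k : forall b, pos_form b ->
    (forall i : 'I_(\dim {:V}), (k <= i)%N -> forall w, b e`_i w = 0) ->
    exists s : seq (V -> C), forall v w, b v w = \sum_(phi <- s) (phi v)^* * phi w.
  by move=> pb; apply: (H (\dim {:V})) => // i; rewrite leqNgt ltn_ord.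
elim: k => [|k IH] {}b pb b0; have [bl bh bp] := pb; have blr := pos_form_linr pb.
  exists [::] => v w; rewrite big_nil (coord_vbasisf v).
  rewrite (form_suml bl) big1 // => i _.
  by rewrite b0 ?mulr0.
have [kd|dk] := ltnP k (\dim {:V}); last first.
  by apply: IH => // i ki; have := ltn_ord i; rewrite ltnNge (leq_trans dk ki).
pose u := e`_k; have [bu|nbu] := eqVneq (b u u) 0.
  apply: IH => // i; rewrite leq_eqVlt => /orP[/eqP ki w|]; last exact: b0.
  by rewrite -ki; apply: pos_form_radical.
have bu0 : 0 < b u u by rewrite lt_neqAle eq_sym nbu bp.
pose c := sqrtC (b u u).
have cc : c * c = b u u by rewrite -expr2 sqrtCK.
have c0 : c != 0 by rewrite sqrtC_eq0.
have cr : c^* = c by apply: geC0_conj; rewrite sqrtC_ge0.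
pose phi w := c^-1 * b u w.
pose b' v w := b v w - (phi v)^* * phi w.
have phil a v v' : phi (a *: v + v') = a * phi v + phi v'.
  by rewrite /phi blr; ring.
have pb' : pos_form b'.
  split=> [a v v' w|v w|v]; rewrite /b'.
  - by rewrite bl phil rmorphD rmorphM /=; ring.
  - by rewrite rmorphB rmorphM /= conjCK bh mulrC.
  pose d := - (c^-1 * phi v).
  have := bp (d *: u + v); rewrite bl blr blr -cc.
  have buv : b u v = c * phi v by rewrite /phi mulVKf.
  have bvu : b v u = c * (phi v)^* by rewrite -bh buv rmorphM /= cr.
  rewrite bvu buv.
  have -> : d^* = - (c^-1 * (phi v)^*).
    by rewrite /d rmorphN rmorphM fmorphV /= cr.
  have -> : - (c^-1 * (phi v)^*) * (d * (c * c) + c * phi v) + (d * (c * (phi v)^*) + b v v)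
     = b v v - (phi v)^* * phi v.
    by rewrite /d; field.
  by [].
have [|s bs] := IH b' pb'.
  move=> i ki w; rewrite /b'.
  have [ik|ik] := eqVneq (i : nat) k.
    by rewrite ik -/u /phi rmorphM /= bh fmorphV /= cr -cc; field.
  rewrite b0 /phi; last by rewrite ltn_neqAle eq_sym ik.
  by rewrite -[b u e`_i]bh b0 ?rmorph0 ?mulr0 ?rmorph0 ?mul0r ?subrr // ltn_neqAle eq_sym ik.
by exists (phi :: s) => v w; rewrite big_cons -bs /b'; ring.
Qed.

End PositiveForms.

(** * Elementary tensors and adjoints *)

Section Lists.
Variables (K : fieldType) (V : vectType K).
Implicit Types (k : nat) (w : seq V).

(** Missing entries count as 0 and surplus ones are ignored, which avoids
    dependent lengths. *)
Definition ptensor k w : tpow V k := tpure [ffun s : 'I_k => nth 0 w s].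

Definition tlist k (i : tidx V k) : seq V := [seq tbasis i s | s <- enum 'I_k].

Lemma size_tlist k (i : tidx V k) : size (tlist i) = k.
Proof. by rewrite size_map size_enum_ord. Qed.

Lemma ptensor_tlist k (i : tidx V k) : ptensor k (tlist i) = tpure (tbasis i).
Proof.
congr tpure; apply/ffunP => s.
by rewrite ffunE (nth_map s) ?size_enum_ord // nth_ord_enum.
Qed.

Lemma ptensor_surj k (v : {ffun 'I_k -> V}) : exists2 w, size w = k & tpure v = ptensor k w.
Proof.
exists [seq v s | s <- enum 'I_k]; first by rewrite size_map size_enum_ord.
congr tpure; apply/ffunP => s.
by rewrite ffunE (nth_map s) ?size_enum_ord // nth_ord_enum.
Qed.

Lemma ptensor_cat k l w1 w2 : size w1 = k ->
  ptensor (k + l) (w1 ++ w2) = tcat (ptensor k w1) (ptensor l w2).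
Proof.
move=> sw; rewrite /ptensor tpure_tcat; congr (tcat (tpure _) (tpure _));
  apply/ffunP => s; rewrite !ffunE nth_cat /= sw ?ltn_ord //.
by rewrite ltnNge leq_addr /= addKn.
Qed.

Lemma ptensor_cons k x w : ptensor k.+1 (x :: w) = tcat (ptensor 1 [:: x]) (ptensor k w).
Proof. by rewrite -ptensor_cat. Qed.

Lemma ptensor1E x c : ptensor 1 [:: x] c = coord (vbasis {:V}) (c ord0) x.
Proof. by rewrite !ffunE big_ord1 ffunE. Qed.

Lemma ptensor1_lin a x y :
  ptensor 1 [:: a *: x + y] = a *: ptensor 1 [:: x] + ptensor 1 [:: y].
Proof. by apply/ffunP => c; rewrite !ffunE !big_ord1 !ffunE /= linearP. Qed.

Lemma sum_tjoin k l (T : nmodType) (F : tidx V (k + l) -> T) :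
  \sum_i F i = \sum_(a : tidx V k) \sum_(c : tidx V l) F (tjoin (a, c)).
Proof.
rewrite (reindex (@tjoin _ k l)) /=; last first.
  by apply: onW_bij; exists (fun v => (tleft v, tright v)); [exact: tjoinK | exact: tsplitK].
by rewrite pair_bigA; apply: eq_bigr => -[].
Qed.

Lemma tcat_tjoin k l (x : tpow V k) (y : tpow V l) a c :
  tcat x y (tjoin (a, c)) = x a * y c.
Proof. by rewrite ffunE; have [-> ->] := tjoinK (a, c). Qed.

Lemma tlist_tjoin k l (a : tidx V k) (c : tidx V l) :
  tlist (tjoin (a, c)) = tlist a ++ tlist c.
Proof.
apply: (@eq_from_nth _ 0); first by rewrite size_cat !size_tlist.
move=> j; rewrite size_tlist => jkl; rewrite nth_cat size_tlist.
have nthb m (i : tidx V m) (s : 'I_m) : nth 0 (tlist i) s = tbasis i s.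
  by rewrite (nth_map s) ?size_enum_ord // nth_ord_enum.
have := nthb _ (tjoin (a, c)) (Ordinal jkl); rewrite /= => ->.
case: ltnP => [jk|kj].
  have := nthb _ a (Ordinal jk); rewrite /= => ->; rewrite !ffunE.
  rewrite (_ : Ordinal jkl = lshift l (Ordinal jk)); last exact: val_inj.
  by rewrite -[lshift _ _]/(unsplit (inl _)) unsplitK.
have jl : (j - k < l)%N by rewrite ltn_subLR.
have := nthb _ c (Ordinal jl); rewrite /= => ->; rewrite !ffunE.
rewrite (_ : Ordinal jkl = rshift k (Ordinal jl)); last by apply: val_inj; rewrite /= subnKC.
by rewrite -[rshift _ _]/(unsplit (inr _)) unsplitK.
Qed.

Lemma tlist1 (c : tidx V 1) : tlist c = [:: (vbasis {:V})`_(c ord0)].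
Proof.
apply: (@eq_from_nth _ 0); first by rewrite size_tlist.
move=> [|j]; rewrite size_tlist // => _.
by rewrite (nth_map ord0) ?size_enum_ord // (nth_ord_enum _ ord0) ffunE.
Qed.

Lemma sum_tidx1 (T : nmodType) (F : 'I_(\dim {:V}) -> T) :
  \sum_(c : tidx V 1) F (c ord0) = \sum_i F i.
Proof.
rewrite (reindex (fun i => [ffun _ : 'I_1 => i] : tidx V 1)) /=.
  by apply: eq_bigr => i _; rewrite ffunE.
exists (fun c : tidx V 1 => c ord0) => [i _|c _]; first by rewrite ffunE.
by apply/ffunP => s; rewrite ffunE (ord1 s).
Qed.

Lemma tidx0 (i j : tidx V 0) : i = j.
Proof. by apply/ffunP => -[]. Qed.

Definition idx0 : tidx V 0 := [ffun s : 'I_0 => match s with Ordinal _ p => False_rect _ (notF p) end].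

Lemma sum_tidx0 (T : nmodType) (F : tidx V 0 -> T) : \sum_i F i = F idx0.
Proof. by rewrite (bigD1 idx0) //= big1 ?addr0 // => i /eqP[]; apply: tidx0. Qed.

Lemma ptensor0E w i : ptensor 0 w i = 1.
Proof. by rewrite ffunE big_ord0. Qed.

(** The linear extension of [phi] from elementary tensors, in the [k] entries
    between [l1] and [l2]. It is defined on basis tensors, so its value on other
    elementary tensors needs [phi] to be multilinear ([ev_ptensor]). *)
Definition ev (phi : seq V -> K) l1 l2 k (y : tpow V k) : K :=
  \sum_i y i * phi (l1 ++ tlist i ++ l2).

Lemma ev_lin phi l1 l2 k a (y z : tpow V k) :
  ev phi l1 l2 (a *: y + z) = a * ev phi l1 l2 y + ev phi l1 l2 z.
Proof.
rewrite /ev mulr_sumr -big_split; apply: eq_bigr => i _ /=.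
by rewrite !ffunE mulrDl mulrA.
Qed.

Lemma ev_sum phi l1 l2 k (J : Type) (s : seq J) (c : J -> K) (y : J -> tpow V k) :
  ev phi l1 l2 (\sum_(j <- s) c j *: y j) = \sum_(j <- s) c j * ev phi l1 l2 (y j).
Proof.
have ev0 : ev phi l1 l2 (0 : tpow V k) = 0.
  by have := ev_lin phi l1 l2 (-1) (0 : tpow V k) 0; rewrite scaler0 addr0 mulN1r addNr.
by apply: (big_rec2 (fun a b => ev phi l1 l2 a = b)) => // i a b _ <-; rewrite ev_lin.
Qed.

Lemma ev_tcat phi l1 l2 k l (x : tpow V k) (y : tpow V l) :
  ev phi l1 l2 (tcat x y) = \sum_i x i * ev phi (l1 ++ tlist i) l2 y.
Proof.
rewrite /ev sum_tjoin; apply: eq_bigr => a _; rewrite mulr_sumr.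
by apply: eq_bigr => c _; rewrite tcat_tjoin tlist_tjoin mulrA !catA.
Qed.

Lemma ev_ptensor phi l1 l2 k w : multilinear phi -> size w = k ->
  ev phi l1 l2 (ptensor k w) = phi (l1 ++ w ++ l2).
Proof.
move=> mp; elim: k w l1 => [|k IH] [|x w] l1 //=.
  by rewrite /ev sum_tidx0 ptensor0E mul1r; have /size0nil-> := size_tlist idx0.
move=> [sw]; rewrite ptensor_cons (ev_tcat phi l1 l2 (ptensor 1 [:: x]) (ptensor k w)).
under eq_bigr do rewrite IH // tlist1 ptensor1E -catA /= -multilinearZ //.
rewrite (sum_tidx1 (fun i => phi (l1 ++ (coord (vbasis {:V}) i x *: (vbasis {:V})`_i) :: w ++ l2))).
by rewrite -multilinear_sum // -coord_vbasisf.
Qed.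

End Lists.

Arguments idx0 {K V}.

Section Dagger.
Variables (R : realType) (Z : fqspace R).
Local Notation C := R[i].

Lemma tinner_herm k (x y : tpow Z k) : (tinner x y)^* = tinner y x.
Proof.
rewrite /tinner rmorph_sum exchange_big /=; apply: eq_bigr => j _.
rewrite rmorph_sum; apply: eq_bigr => i _ /=.
rewrite !rmorphM /= conjCK rmorph_prod; congr (_ * _).
  by rewrite mulrC.
by apply: eq_bigr => s _; apply: finner_herm.
Qed.

Lemma fq_star : star_algebra_axiom Z. Proof. by case: (fq_axiom Z). Qed.

Lemma tinner_inj k (x y : tpow Z k) : (forall z, tinner x z = tinner y z) -> x = y.
Proof.
have [sZ _ [ndl ndr] _] := fq_axiom Z.
move=> xy; apply/eqP; rewrite -subr_eq0; apply/eqP; apply: tinner_nl => // z.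
have := tinner_conj (-1) y x z; rewrite scaleN1r addrC => ->.
by rewrite rmorphN1 xy mulN1r addNr.
Qed.

Lemma daggerE k l (f : 'Hom(tpow Z k, tpow Z l)) (g : 'Hom(tpow Z l, tpow Z k)) :
  (forall x y, tinner (g y) x = tinner y (f x)) -> dagger f = g.
Proof.
move=> fg; apply/lfunP => y; apply: tinner_inj => x.
by rewrite daggerP ?fg //; exact: fq_axiom.
Qed.

Lemma daggerA k l (f : 'Hom(tpow Z k, tpow Z l)) x y :
  tinner (dagger f y) x = tinner y (f x).
Proof. by apply: daggerP; exact: fq_axiom. Qed.

Lemma daggerK k l (f : 'Hom(tpow Z k, tpow Z l)) : dagger (dagger f) = f.
Proof. by apply: daggerE => x y; rewrite -tinner_herm -daggerA tinner_herm. Qed.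

Lemma dagger_id k : dagger (\1%VF : 'End(tpow Z k)) = \1%VF.
Proof. by apply: daggerE => x y; rewrite !id_lfunE. Qed.

Lemma dagger_comp k l n (f : 'Hom(tpow Z k, tpow Z l)) (g : 'Hom(tpow Z l, tpow Z n)) :
  dagger (g \o f)%VF = (dagger f \o dagger g)%VF.
Proof. by apply: daggerE => x y; rewrite !comp_lfunE !daggerA. Qed.

Lemma dagger_lin k l a b (f g : 'Hom(tpow Z k, tpow Z l)) :
  dagger (a *: f + b *: g) = a^* *: dagger f + b^* *: dagger g.
Proof.
have sZ := fq_star.
apply: daggerE => x y; rewrite !(add_lfunE, scale_lfunE) tinner_conj // !tinner_lin.
have tZ k' (u v : tpow Z k') c : tinner (c *: u) v = c^* * tinner u v.
  rewrite -[c *: u]addr0 tinner_conj // -[X in _ + X](_ : 0 = _) ?addr0 //.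
  have := tinner_conj (-1) (0 : tpow Z k') 0 v.
  by rewrite scaler0 addr0 rmorphN1 mulN1r addNr.
have tZr k' (u v : tpow Z k') c : tinner u (c *: v) = c * tinner u v.
  by rewrite -tinner_herm tZ rmorphM /= conjCK tinner_herm.
by rewrite tZ tZr !conjCK !daggerA.
Qed.

Lemma tinner_tcat k l (x x' : tpow Z k) (y y' : tpow Z l) :
  tinner (tcat x y) (tcat x' y') = tinner x x' * tinner y y'.
Proof.
rewrite /tinner sum_tjoin big_distrlr /=; apply: eq_bigr => a _.
apply: eq_bigr => c _; rewrite sum_tjoin big_distrlr /=; apply: eq_bigr => a' _.
apply: eq_bigr => c' _; rewrite !tcat_tjoin rmorphM big_split_ord /=.
rewrite [RHS]mulrACA; congr (_ * _); first by rewrite mulrACA.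
by congr (_ * _); apply: eq_bigr => s _; congr (finner _ _); rewrite !ffunE;
   rewrite -?[lshift _ _]/(unsplit (inl _)) -?[rshift _ _]/(unsplit (inr _)) unsplitK.
Qed.

Lemma tinner_sumr k (I : finType) (c : I -> R[i]) (v : I -> tpow Z k) u :
  tinner u (\sum_i c i *: v i) = \sum_i c i * tinner u (v i).
Proof. exact: (form_sumr (@tinner_lin _ Z k)). Qed.

Lemma tinner_suml k (I : finType) (c : I -> R[i]) (v : I -> tpow Z k) u :
  tinner (\sum_i c i *: v i) u = \sum_i (c i)^* * tinner (v i) u.
Proof. exact: (form_suml (@tinner_conj _ Z k)). Qed.

Lemma daggerE_pure k l (f : 'Hom(tpow Z k, tpow Z l)) (g : 'Hom(tpow Z l, tpow Z k)) :
  (forall v w, tinner (g (tpure w)) (tpure v) = tinner (tpure w) (f (tpure v))) ->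
  dagger f = g.
Proof.
move=> fg; apply: daggerE => x y; rewrite [x]tpow_basis [y]tpow_basis !linear_sum /=.
under eq_bigr do rewrite linearZ /=.
rewrite !tinner_suml.
apply: eq_bigr => j _; congr (_ * _).
under [in RHS]eq_bigr do rewrite linearZ /=.
rewrite !tinner_sumr.
by apply: eq_bigr => i _; rewrite fg.
Qed.

Lemma dagger_tmap k k' l l' (f : 'Hom(tpow Z k, tpow Z k')) (g : 'Hom(tpow Z l, tpow Z l')) :
  dagger (tmap f g) = tmap (dagger f) (dagger g).
Proof.
by apply: daggerE_pure => v w; rewrite !tpure_tcat !tmapE !tinner_tcat !daggerA.
Qed.

Lemma finner_pos_form : pos_form (@finner R Z).
Proof.
have [sZ pos _ _] := fq_axiom Z; split => //.
- by move=> *; apply: finner_conj.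
- exact: finner_herm.
Qed.

(** Positivity is only given on one tensor factor. A frame of functionals for
    that factor gives one for the tensor power, so a vector of norm 0 is killed
    by all of them and is orthogonal to everything. *)
Lemma tinner_definite k (x : tpow Z k) : tinner x x = 0 -> x = 0.
Proof.
have [s fs] := pos_form_frame finner_pos_form.
pose phi (a : 'I_(size s)) := nth (fun _ => 0) s a.
have {}fs v w : finner v w = \sum_a (phi a v)^* * phi a w by rewrite fs (big_nth (fun _ => 0)) big_mkord.
pose L (A : {ffun 'I_k -> 'I_(size s)}) (y : tpow Z k) :=
  \sum_i y i * \prod_s phi (A s) (tbasis i s).
have tE y z : tinner y z = \sum_A (L A y)^* * L A z.
  rewrite /tinner; under [RHS]eq_bigr do rewrite /L rmorph_sum big_distrlr /=.
  rewrite [RHS]exchange_big; apply: eq_bigr => i _ /=.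
  rewrite [RHS]exchange_big; apply: eq_bigr => j _ /=.
  under eq_bigr do rewrite fs.
  rewrite bigA_distr_bigA mulr_sumr; apply: eq_bigr => A _ /=.
  by rewrite rmorphM rmorph_prod mulrACA big_split.
move=> x0; apply: tinner_inj => z; rewrite -tinner_herm -[RHS]tinner_herm; congr (_^*).
have Lx A : L A x = 0.
  apply/eqP; rewrite -normr_eq0 -sqrf_eq0 normCK mulrC; move: x0; rewrite tE => /eqP.
  rewrite psumr_eq0 => [/allP/(_ A (mem_index_enum _))//|B _].
  by rewrite mulrC mul_conjC_ge0.
rewrite !tE big1 => [|A _]; last by rewrite Lx mulr0.
rewrite big1 // => A _; rewrite [L A 0]big1 ?mulr0 // => i _.
by rewrite ffunE mul0r.
Qed.

End Dagger.

(** * The copairing of a finite quantum space *)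

Section FrobeniusElement.
Variables (R : realType) (Z : fqspace R).
Local Notation C := R[i].
Local Notation psi := (fpsi Z).

(** [E] lists the terms of [m^dagger eta], the element dual to the form
    [psi (x * y)]; all uses of that element are sums over its terms. *)
Definition copairing (E : seq (Z * Z)) :=
  forall z, \sum_(e <- E) psi (z * e.1) *: e.2 = z.

Lemma fpsi_nd (a b : Z) : (forall z, psi (z * a) = psi (z * b)) -> a = b.
Proof.
have [_ _ [_ ndr] _] := fq_axiom Z => ab; apply/eqP; rewrite -subr_eq0; apply/eqP.
by apply: ndr => z; rewrite mulrBr linearB /= ab subrr.
Qed.

Lemma fpsi_ndl (a b : Z) : (forall z, psi (a * z) = psi (b * z)) -> a = b.
Proof.
have [_ _ [ndl _] _] := fq_axiom Z => ab; apply/eqP; rewrite -subr_eq0; apply/eqP.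
by apply: ndl => z; rewrite mulrBl linearB /= ab subrr.
Qed.

Lemma copairing_r E : copairing E ->
  forall z, \sum_(e <- E) psi (e.2 * z) *: e.1 = z.
Proof.
move=> cE z; apply: fpsi_nd => w; rewrite -[in RHS](cE w) mulr_sumr mulr_suml !linear_sum.
by apply: eq_bigr => e _ /=; rewrite -scalerAr -scalerAl !linearZ /= mulrC.
Qed.

(** The dual basis for the inner product, with stars removed, is dual for
    [psi (x * y)]. *)
Lemma copairing_exists : exists E, copairing E.
Proof.
have [sZ _ [ndl ndr] _] := fq_axiom Z.
have [d dE] := form_dual (finner_conj sZ) (@finner_lin _ _) (finner_nr sZ ndr).
pose e := vbasis {:Z}.
exists [seq (e`_(val i), fstar (d i)) | i <- index_enum 'I_(\dim {:Z})].
have H z : z = \sum_(i < \dim {:Z}) psi (fstar (d i) * z) *: e`_i.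
  rewrite [LHS]coord_vbasisf; apply: eq_bigr => i _; congr (_ *: _).
  rewrite -[RHS]/(finner (d i) z) {2}[z]coord_vbasisf (form_sumr (@finner_lin _ _)).
  rewrite (bigD1 i) //= big1 ?addr0 => [|j ji].
    by rewrite -finner_herm dE eqxx rmorph1 mulr1.
  by rewrite -finner_herm dE (negPf ji) rmorph0 mulr0.
move=> z; apply: fpsi_ndl => w.
rewrite big_map /= [in RHS](H w) mulr_suml mulr_sumr !linear_sum.
by apply: eq_bigr => i _; rewrite /= -scalerAl -scalerAr !linearZ /= mulrC.
Qed.

Lemma star1 : fstar 1 = 1 :> Z.
Proof.
have [inv _ mulS] := fq_star Z.
by rewrite -[LHS]mulr1 -{2}(inv 1) -mulS mulr1 inv.
Qed.

Lemma psi_star (u : Z) : (psi u)^* = psi (fstar u).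
Proof.
have -> : psi u = finner 1 u by rewrite /finner star1 mul1r.
by rewrite finner_herm /finner mulr1.
Qed.

Lemma tinner_ext k (x y : tpow Z k) :
  (forall w, size w = k -> tinner x (ptensor k w) = tinner y (ptensor k w)) -> x = y.
Proof.
move=> xy; apply: tinner_inj => z; rewrite [z]tpow_basis.
rewrite !tinner_sumr.
by apply: eq_bigr => i _; have [w sw ->] := ptensor_surj (tbasis i); rewrite xy.
Qed.

Lemma tinner_ptensor1 (x y : Z) : tinner (ptensor 1 [:: x]) (ptensor 1 [:: y]) = finner x y :> C.
Proof. by rewrite tinner_pure ?big_ord1 ?ffunE //; exact: fq_star. Qed.

Lemma tinner_ptensor2 (x y z t : Z) :
  tinner (ptensor 2 [:: x; y]) (ptensor 2 [:: z; t]) = finner x z * finner y t :> C.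
Proof.
rewrite tinner_pure; last exact: fq_star.
by rewrite !big_ord_recl big_ord0 mulr1 !ffunE.
Qed.

Lemma tinner_ptensor0 (w w' : seq Z) : tinner (ptensor 0 w) (ptensor 0 w') = 1 :> C.
Proof. by rewrite tinner_pure ?big_ord0 //; exact: fq_star. Qed.

Lemma ptensor1_inj (x y : Z) : ptensor 1 [:: x] = ptensor 1 [:: y] -> x = y.
Proof.
move=> xy; apply/eqP; rewrite -subr_eq0; apply/eqP; apply: (finner_nl (fq_star Z)) => [|v].
  by have [_ _ [ndl _] _] := fq_axiom Z.
have := congr1 (fun t => tinner t (ptensor 1 [:: v])) xy; rewrite /= !tinner_ptensor1 => e.
have := finner_conj (fq_star Z) (-1) y x v; rewrite scaleN1r addrC => ->.
by rewrite e rmorphN1 mulN1r addNr.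
Qed.

Lemma ptensor0 w w' : ptensor 0 w = ptensor 0 w' :> tpow Z 0.
Proof. by apply/ffunP => i; rewrite !ptensor0E. Qed.

Lemma fmul_ptensor (x y : Z) : fmul Z (ptensor 2 [:: x; y]) = ptensor 1 [:: x * y].
Proof.
rewrite fmulE /ptensor; congr tpure; apply/ffunP => s.
by rewrite !ffunE (ord1 s).
Qed.

Lemma funit_ptensor w : funit Z (ptensor 0 w) = ptensor 1 [:: 1].
Proof.
rewrite /funit tliftE sum_tidx0 ptensor0E scale1r; congr tpure.
by apply/ffunP => s; rewrite !ffunE (ord1 s).
Qed.

Lemma funit_dag (x : Z) : dagger (funit Z) (ptensor 1 [:: x]) = psi x *: ptensor 0 [::].
Proof.
apply: tinner_ext => w _; rewrite daggerA funit_ptensor tinner_ptensor1.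
have tZ (u v : tpow Z 0) c : tinner (c *: u) v = c^* * tinner u v.
  have := tinner_conj c u 0 v; rewrite addr0 => ->.
  have := tinner_conj (-1) (0 : tpow Z 0) 0 v.
  by rewrite scaler0 addr0 rmorphN1 mulN1r addNr => ->; rewrite addr0.
by rewrite tZ tinner_ptensor0 mulr1 psi_star /finner mulr1.
Qed.

(** This rewrites the adjoint of [m], which depends on the involution, in terms
    of [psi] alone. *)
Lemma fmul_dag E (z : Z) : copairing E ->
  dagger (fmul Z) (ptensor 1 [:: z]) = \sum_(e <- E) ptensor 2 [:: z * e.1; e.2].
Proof.
move=> cE; have [inv _ mulS] := fq_star Z.
apply: tinner_ext => -[|a [|b [|//]]] // _.
rewrite daggerA fmul_ptensor tinner_ptensor1.
rewrite (_ : \sum_(e <- E) _ = \sum_(e <- E) 1 *: ptensor 2 [:: z * e.1; e.2]); last first.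
  by apply: eq_bigr => e _; rewrite scale1r.
have suml (s : seq (Z * Z)) (f : Z * Z -> tpow Z 2) v :
    tinner (\sum_(e <- s) 1 *: f e) v = \sum_(e <- s) tinner (f e) v.
  have t0 : tinner (0 : tpow Z 2) v = 0.
    by have := tinner_conj (-1) (0 : tpow Z 2) 0 v;
       rewrite scaler0 addr0 rmorphN1 mulN1r addNr.
  by apply: (big_rec2 (fun a b => tinner a v = b)) => // i p q _ <-;
     rewrite tinner_conj rmorph1 mul1r.
rewrite suml; under eq_bigr do rewrite tinner_ptensor2.
rewrite -[LHS]finner_herm -[RHS]conjCK rmorph_sum; congr (_^*).
under eq_bigr do rewrite rmorphM /= !finner_herm /finner mulrA.
rewrite /finner mulS -mulrA -[in LHS](cE (fstar a * z)) mulr_sumr linear_sum.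
by apply: eq_bigr => e _ /=; rewrite -scalerAr linearZ.
Qed.

Lemma fcup_ptensor E w : copairing E ->
  fcup Z (ptensor 0 w) = \sum_(e <- E) ptensor 2 [:: e.1; e.2].
Proof.
move=> cE; rewrite comp_lfunE funit_ptensor (fmul_dag _ cE).
by apply: eq_bigr => e _; rewrite mul1r.
Qed.

Lemma fcap_ptensor (x y : Z) : fcap Z (ptensor 2 [:: x; y]) = psi (x * y) *: ptensor 0 [::].
Proof.
by rewrite /fcap /fcup dagger_comp daggerK comp_lfunE fmul_ptensor funit_dag.
Qed.

Lemma copairing_special E : copairing E -> \sum_(e <- E) e.1 * e.2 = 1.
Proof.
move=> cE; apply: ptensor1_inj; have [_ _ _ mm] := fq_axiom Z.
have := congr1 (fun f : 'End(tpow Z 1) => f (ptensor 1 [:: 1])) mm.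
rewrite comp_lfunE id_lfunE (fmul_dag _ cE) => <-.
have p1D (x y : Z) : ptensor 1 [:: x + y] = ptensor 1 [:: x] + ptensor 1 [:: y].
  by have := ptensor1_lin 1 x y; rewrite !scale1r.
have p10 : ptensor 1 [:: 0 : Z] = 0.
  by have := p1D 0 0; rewrite addr0 -{1}[ptensor 1 _]addr0 => /addrI.
elim: E {cE} => [|e E IH]; first by rewrite !big_nil linear0.
by rewrite !big_cons p1D IH linearD /= fmul_ptensor mul1r.
Qed.

Lemma tendo_ptensor (f : 'End(Z)) x : tendo f (ptensor 1 [:: x]) = ptensor 1 [:: f x].
Proof.
rewrite tendoE; congr tpure; apply/ffunP => s.
by rewrite !ffunE (ord1 s).
Qed.

Lemma tendo_dag (f : 'End(Z)) : dagger (tendo f) = tendo (edagger f).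
Proof.
have := edaggerP (fq_axiom Z) f; move: (edagger f) => g fg.
apply: daggerE_pure => v w.
rewrite [X in tinner X _ = _]tendoE [X in _ = tinner _ X]tendoE !(tinner_pure (fq_star Z)).
by rewrite !big_ord1 !ffunE fg.
Qed.

(** Frobenius reciprocity: the cup turns the first input into an output. *)
Definition bend k l (f : 'Hom(tpow Z k.+1, tpow Z l)) : 'Hom(tpow Z k, tpow Z l.+1) :=
  (tmap (\1%VF : 'End(tpow Z 1)) f \o tmap (fcup Z) (\1%VF : 'End(tpow Z k)))%VF.

Lemma tmap_id_cons k l (f : 'Hom(tpow Z k, tpow Z l)) x w :
  tmap (\1%VF : 'End(tpow Z 1)) f (ptensor k.+1 (x :: w)) =
  tcat (ptensor 1 [:: x]) (f (ptensor k w)).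
Proof.
by rewrite ptensor_cons (tmapE \1%VF f (ptensor 1 [:: x]) (ptensor k w)) id_lfunE.
Qed.

Lemma tmap_cup E k w : copairing E ->
  tmap (fcup Z) (\1%VF : 'End(tpow Z k)) (ptensor k w) =
  \sum_(e <- E) ptensor k.+2 [:: e.1, e.2 & w] :> tpow Z k.+2.
Proof.
move=> cE; have -> : ptensor k w = tcat (ptensor 0 [::]) (ptensor k w) by rewrite -ptensor_cat.
rewrite (tmapE (fcup Z) \1%VF (ptensor 0 [::]) (ptensor k w)).
rewrite (fcup_ptensor _ cE) id_lfunE.
apply/ffunP => i; rewrite ffunE !sum_ffunE mulr_suml; apply: eq_bigr => e _.
have := congr1 (fun t : tpow Z (2 + k) => t i) (@ptensor_cat _ _ 2 k [:: e.1; e.2] w erefl).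
move=> h; transitivity (tcat (ptensor 2 [:: e.1; e.2]) (ptensor k w) i); last exact: esym h.
by rewrite [RHS]ffunE.
Qed.

Lemma bend_ptensor E k l (f : 'Hom(tpow Z k.+1, tpow Z l)) w : copairing E ->
  bend f (ptensor k w) =
  \sum_(e <- E) tcat (ptensor 1 [:: e.1]) (f (ptensor k.+1 (e.2 :: w))).
Proof.
move=> cE; rewrite /bend comp_lfunE (tmap_cup k w cE).
transitivity (\sum_(e <- E) tmap (\1%VF : 'End(tpow Z 1)) f (ptensor k.+2 [:: e.1, e.2 & w])).
  exact: (linear_sum (tmap (\1%VF : 'End(tpow Z 1)) f)).
by apply: eq_bigr => e _; rewrite tmap_id_cons.
Qed.

(** Bending is injective: contracting the new output with [psi] gives the input
    back. *)
Lemma bend_eq0 k l (f : 'Hom(tpow Z k.+1, tpow Z l)) : bend f = 0 -> f = 0.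
Proof.
move=> bf0; have [E cE] := copairing_exists.
apply: eq_tpow => v; rewrite zero_lfunE; have [[|x w] // [sw] ->] := ptensor_surj v.
apply/ffunP => j; rewrite ffunE.
have F0 (c : 'I_(\dim {:Z})) :
    \sum_(e <- E) coord (vbasis {:Z}) c e.1 * f (ptensor k.+1 (e.2 :: w)) j = 0.
  have := congr1 (fun g : 'Hom(tpow Z k, tpow Z (1 + l)) =>
    g (ptensor k w) (tjoin ([ffun _ : 'I_1 => c] : tidx Z 1, j))) bf0.
  rewrite (bend_ptensor _ _ cE) zero_lfunE sum_ffunE [in RHS]ffunE => {2}<-.
  by apply: eq_bigr => e _; rewrite tcat_tjoin ptensor1E ffunE.
pose T (y : Z) : C := f (ptensor k.+1 (y :: w)) j.
have Tlin a y z : T (a *: y + z) = a * T y + T z.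
  rewrite /T !(ptensor_cons k _ w) ptensor1_lin.
  rewrite (_ : tcat _ _ = a *: tcat (ptensor 1 [:: y]) (ptensor k w)
                          + tcat (ptensor 1 [:: z]) (ptensor k w)); last first.
    by apply/ffunP => i; rewrite !ffunE mulrDl /GRing.scale /= mulrA.
  by rewrite linearP !ffunE.
have Tsum (c : Z * Z -> C) (u : Z * Z -> Z) :
    T (\sum_(e <- E) c e *: u e) = \sum_(e <- E) c e * T (u e).
  have T0 : T 0 = 0 by have := Tlin (-1) 0 0; rewrite scaler0 addr0 mulN1r addNr.
  by apply: (big_rec2 (fun a b => T a = b)) => // e a b _ <-; rewrite Tlin.
rewrite -/(T x) -(cE x) Tsum.
under eq_bigr => e _.
  rewrite {1}[e.1]coord_vbasisf mulr_sumr linear_sum mulr_suml.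
  under eq_bigr do rewrite -scalerAr linearZ /= -mulrAC -mulrA.
over.
rewrite exchange_big big1 //= => c _.
under eq_bigr do rewrite mulrA.
rewrite -mulr_suml.
by rewrite F0 ?mul0r.
Qed.

End FrobeniusElement.

(** * Isomorphisms from closed diagrams *)

Section Twins.
Variables (R : realType) (Z Z' : fqspace R).
Local Notation C := R[i].
Variable G : forall k l, 'Hom(tpow Z k, tpow Z l) -> 'Hom(tpow Z' k, tpow Z' l) -> Prop.

(** The graph of the isomorphism that pairs the generators in [G]: both members
    of a pair are built from generators in the same way. That it is the graph of
    a bijection is [twin_inj]. *)
Inductive twin : forall k l, 'Hom(tpow Z k, tpow Z l) -> 'Hom(tpow Z' k, tpow Z' l) -> Prop :=
| twin_base k l f f' of G f f' : @twin k l f f'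
| twin_id k : twin (\1%VF : 'End(tpow Z k)) (\1%VF : 'End(tpow Z' k))
| twin_comp k l n (f : 'Hom(tpow Z k, tpow Z l)) (g : 'Hom(tpow Z l, tpow Z n))
    (f' : 'Hom(tpow Z' k, tpow Z' l)) (g' : 'Hom(tpow Z' l, tpow Z' n))
    of twin f f' & twin g g' : twin (g \o f)%VF (g' \o f')%VF
| twin_tmap k k' l l' (f : 'Hom(tpow Z k, tpow Z k')) (g : 'Hom(tpow Z l, tpow Z l'))
    (f' : 'Hom(tpow Z' k, tpow Z' k')) (g' : 'Hom(tpow Z' l, tpow Z' l'))
    of twin f f' & twin g g' : twin (tmap f g) (tmap f' g')
| twin_lin k l (a b : C) (f g : 'Hom(tpow Z k, tpow Z l)) (f' g' : 'Hom(tpow Z' k, tpow Z' l))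
    of twin f f' & twin g g' : twin (a *: f + b *: g) (a *: f' + b *: g')
| twin_dagger k l (f : 'Hom(tpow Z k, tpow Z l)) (f' : 'Hom(tpow Z' k, tpow Z' l))
    of twin f f' : twin (dagger f) (dagger f').

(** [chi] is the composite of [phi] with [id * f * id], where [f] starts at
    entry [p]. This is a relation, for the values of [chi] on lists that are too
    short for [f] do not matter. *)
Definition pulls (Y : fqspace R) k l (f : 'Hom(tpow Y k, tpow Y l)) p
    (phi chi : seq Y -> C) :=
  forall l1 w l2, size l1 = p -> size w = k ->
    chi (l1 ++ w ++ l2) = ev phi l1 l2 (f (ptensor k w)).

Lemma pulls_id (Y : fqspace R) k p phi : multilinear phi ->
  pulls (\1%VF : 'End(tpow Y k)) p phi phi.
Proof. by move=> mp l1 w l2 _ sw; rewrite id_lfunE ev_ptensor. Qed.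

Lemma pulls_comp (Y : fqspace R) k l n (f : 'Hom(tpow Y k, tpow Y l))
    (g : 'Hom(tpow Y l, tpow Y n)) p phi chi om :
  pulls g p phi chi -> pulls f p chi om -> pulls (g \o f)%VF p phi om.
Proof.
move=> pg pf l1 w l2 s1 sw; rewrite pf // comp_lfunE; move: (f _) => y.
rewrite [in RHS](tpow_basis y) linear_sum /=.
under [X in _ = ev _ _ _ X]eq_bigr do rewrite linearZ /=.
rewrite ev_sum; apply: eq_bigr => i _; congr (_ * _).
by rewrite pg ?size_tlist // ptensor_tlist.
Qed.

Lemma pulls_tmap (Y : fqspace R) k k' l l' (f : 'Hom(tpow Y k, tpow Y k'))
    (g : 'Hom(tpow Y l, tpow Y l')) p phi chi om :
  pulls g (p + k') phi chi -> pulls f p chi om -> pulls (tmap f g) p phi om.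
Proof.
move=> pg pf l1 w l2 s1 sw.
have s1' : size (take k w) = k by rewrite size_take sw; case: ltnP => //; lia.
have s2' : size (drop k w) = l by rewrite size_drop sw addKn.
rewrite -(cat_take_drop k w) -catA pf // ptensor_cat // tmapE ev_tcat.
apply: eq_bigr => i _; congr (_ * _).
by rewrite catA pg // size_cat s1 size_tlist.
Qed.

Lemma pulls_lin (Y : fqspace R) k l (f g : 'Hom(tpow Y k, tpow Y l)) a b p phi chi om :
  pulls f p phi chi -> pulls g p phi om ->
  pulls (a *: f + b *: g) p phi (fun s => a * chi s + b * om s).
Proof.
move=> pf pg l1 w l2 s1 sw; rewrite pf // pg // add_lfunE !scale_lfunE.
rewrite ev_lin -[b *: _]addr0 ev_lin -[X in _ = _ + (_ + X)](_ : 0 = _) ?addr0 //.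
by rewrite /ev big1 // => i _; rewrite ffunE mul0r.
Qed.

(* [F] pairs the functionals that closed diagrams over the two spaces pass
   through when they are evaluated from their top; so it must be preserved by
   the generators and have equal values when no leg is left. *)
Variable F : (seq Z -> C) -> (seq Z' -> C) -> Prop.
Hypothesis F_multilinear : forall phi phi', F phi phi' -> multilinear phi /\ multilinear phi'.
Hypothesis F_lin : forall a b phi phi' chi chi', F phi phi' -> F chi chi' ->
  F (fun s => a * phi s + b * chi s) (fun s => a * phi' s + b * chi' s).
Hypothesis F_nil : F (@nil_form _ Z) (@nil_form _ Z').
Hypothesis F_scalar : forall phi phi', F phi phi' -> phi [::] = phi' [::].

Definition stable k l (f : 'Hom(tpow Z k, tpow Z l)) (f' : 'Hom(tpow Z' k, tpow Z' l)) :=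
  forall p phi phi', F phi phi' ->
    exists chi chi', [/\ F chi chi', pulls f p phi chi & pulls f' p phi' chi'].

Hypothesis G_stable : forall k l (f : 'Hom(tpow Z k, tpow Z l)) f',
  G f f' -> stable f f' /\ stable (dagger f) (dagger f').

Lemma twin_stable k l (f : 'Hom(tpow Z k, tpow Z l)) f' :
  twin f f' -> stable f f' /\ stable (dagger f) (dagger f').
Proof.
have stable_comp k1 l1 n1 (f1 : 'Hom(tpow Z k1, tpow Z l1)) (g1 : 'Hom(tpow Z l1, tpow Z n1))
    f1' g1' : stable f1 f1' -> stable g1 g1' -> stable (g1 \o f1)%VF (g1' \o f1')%VF.
  move=> sf sg p phi phi' Fp; have [chi [chi' [Fc pc pc']]] := sg p _ _ Fp.
  have [om [om' [Fo po po']]] := sf p _ _ Fc.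
  by exists om, om'; split=> //; apply: pulls_comp; eassumption.
have stable_tmap k1 l1 k2 l2 (f1 : 'Hom(tpow Z k1, tpow Z l1)) (g1 : 'Hom(tpow Z k2, tpow Z l2))
    f1' g1' : stable f1 f1' -> stable g1 g1' -> stable (tmap f1 g1) (tmap f1' g1').
  move=> sf sg p phi phi' Fp; have [chi [chi' [Fc pc pc']]] := sg (p + l1)%N _ _ Fp.
  have [om [om' [Fo po po']]] := sf p _ _ Fc.
  by exists om, om'; split=> //; apply: pulls_tmap; eassumption.
have stable_id k1 : stable (\1%VF : 'End(tpow Z k1)) (\1%VF : 'End(tpow Z' k1)).
  move=> p phi phi' Fp; have [mp mp'] := F_multilinear Fp.
  by exists phi, phi'; split=> //; apply: pulls_id.
have stable_lin k1 l1 a b (f1 g1 : 'Hom(tpow Z k1, tpow Z l1)) f1' g1' :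
    stable f1 f1' -> stable g1 g1' -> stable (a *: f1 + b *: g1) (a *: f1' + b *: g1').
  move=> sf sg p phi phi' Fp; have [chi [chi' [Fc pc pc']]] := sf p _ _ Fp.
  have [om [om' [Fo po po']]] := sg p _ _ Fp.
  by exists (fun s => a * chi s + b * om s), (fun s => a * chi' s + b * om' s);
     split; [exact: F_lin | exact: pulls_lin | exact: pulls_lin].
elim=> {k l f f'}.
- by move=> k l f f' /G_stable.
- by move=> k; rewrite !dagger_id.
- move=> k l n f g f' g' _ [sf sfd] _ [sg sgd]; rewrite !dagger_comp.
  by split; apply: stable_comp.
- move=> k k' l l' f g f' g' _ [sf sfd] _ [sg sgd]; rewrite !dagger_tmap.
  by split; apply: stable_tmap.
- move=> k l a b f g f' g' _ [sf sfd] _ [sg sgd]; rewrite !dagger_lin.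
  by split; apply: stable_lin.
by move=> k l f f' _ [sf sfd]; rewrite !daggerK.
Qed.

Lemma twin_scalar (f : 'End(tpow Z 0)) f' : twin f f' ->
  f (ptensor 0 [::]) idx0 = f' (ptensor 0 [::]) idx0.
Proof.
move=> /twin_stable[/(_ 0 _ _ F_nil)[chi [chi' [Fc pc pc']]] _].
have := pc [::] [::] [::] erefl erefl; have := pc' [::] [::] [::] erefl erefl.
rewrite /= (F_scalar Fc) => -> /=.
rewrite /ev !sum_tidx0.
have /size0nil -> := size_tlist (@idx0 _ Z); have /size0nil -> := size_tlist (@idx0 _ Z').
by rewrite /nil_form /= !mulr1.
Qed.

Hypothesis G_mul : G (fmul Z) (fmul Z').
Hypothesis G_counit : G (dagger (funit Z)) (dagger (funit Z')).

Lemma twin_bend k l (f : 'Hom(tpow Z k.+1, tpow Z l)) f' :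
  twin f f' -> twin (bend f) (bend f').
Proof.
move=> ff'; apply: (@twin_comp k k.+2 l.+1).
  apply: (@twin_tmap 0 2 k k); last exact: twin_id.
  apply: twin_comp; last by apply: twin_dagger; apply: twin_base.
  by rewrite -[funit Z]daggerK -[funit Z']daggerK; apply: twin_dagger; apply: twin_base.
by apply: (@twin_tmap 1 1 k.+1 l); first exact: twin_id.
Qed.

(** The scalar [f^dagger f] is the squared norm of the vector [f]. *)
Lemma norm0 (Y : fqspace R) l (f : 'Hom(tpow Y 0, tpow Y l)) :
  (dagger f \o f)%VF (ptensor 0 [::]) idx0 = 0 -> f = 0.
Proof.
move=> f0; suff f00 : f (ptensor 0 [::]) = 0.
  apply: eq_tpow => v; rewrite zero_lfunE; have [w _ ->] := ptensor_surj v.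
  by rewrite (ptensor0 w [::]).
apply: tinner_definite; rewrite -daggerA -comp_lfunE.
by rewrite /tinner big1 // => i _; rewrite big1 // => j _;
   rewrite (tidx0 i idx0) f0 rmorph0 !mul0r.
Qed.

(** All inputs are bent to outputs, and then the norm is a closed diagram. *)
Lemma twin_eq0 k l (f : 'Hom(tpow Z k, tpow Z l)) f' : twin f f' -> f = 0 <-> f' = 0.
Proof.
elim: k l f f' => [|k IH] l f f' ff'; last first.
  have bb := IH _ _ _ (twin_bend ff'); split=> [f0|f0]; apply: bend_eq0; apply/bb;
    by rewrite f0 /bend (_ : tmap _ 0 = 0) ?comp_lfun0l //; apply: eq_tpow => v;
       rewrite (tpure_tcat (k := 1) (l := k.+1) v) (tmapE (k := 1) (l := k.+1)) !zero_lfunE;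
       apply/ffunP => i; rewrite !ffunE mulr0.
have tff : twin (dagger f \o f)%VF (dagger f' \o f')%VF.
  by apply: twin_comp => //; apply: twin_dagger.
have e := twin_scalar tff.
by split=> f0; apply: norm0; [rewrite -e f0 | rewrite e f0]; rewrite comp_lfun0r zero_lfunE ffunE.
Qed.

Lemma twin_inj k l (f g : 'Hom(tpow Z k, tpow Z l)) f' g' :
  twin f f' -> twin g g' -> f = g <-> f' = g'.
Proof.
move=> ff' gg'; have := twin_eq0 (twin_lin 1 (-1) ff' gg').
rewrite !scale1r !scaleN1r => e.
by split=> /eqP; rewrite -subr_eq0 => /eqP/e/eqP; rewrite subr_eq0 => /eqP.
Qed.

Variables (D : hom_family Z) (D' : hom_family Z').
Hypothesis G_gens : forall k l (f : 'Hom(tpow Z k, tpow Z l)) f', G f f' -> D f /\ D' f'.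
Hypothesis D_twin : forall k l (f : 'Hom(tpow Z k, tpow Z l)), D f -> exists f', G f f'.
Hypothesis D'_twin : forall k l (f' : 'Hom(tpow Z' k, tpow Z' l)), D' f' -> exists f, G f f'.

Lemma twin_generated k l (f : 'Hom(tpow Z k, tpow Z l)) f' :
  twin f f' -> generated D f /\ generated D' f'.
Proof.
elim=> {k l f f'}.
- by move=> k l f f' /G_gens[df df']; split; apply: gen_base.
- by move=> k; split; apply: gen_id.
- by move=> k l n f g f' g' _ [? ?] _ [? ?]; split; apply: gen_comp.
- by move=> k k' l l' f g f' g' _ [? ?] _ [? ?]; split; apply: gen_tmap.
- by move=> k l a b f g f' g' _ [? ?] _ [? ?]; split; apply: gen_lin.
by move=> k l f f' _ [? ?]; split; apply: gen_dagger.
Qed.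

Lemma generated_twin k l (f : 'Hom(tpow Z k, tpow Z l)) :
  generated D f -> exists f', twin f f'.
Proof.
elim=> {k l f}.
- by move=> k l f /D_twin[f' ff']; exists f'; apply: twin_base.
- by move=> k; exists \1%VF; apply: twin_id.
- by move=> k l n f g _ [f' ?] _ [g' ?]; exists (g' \o f')%VF; apply: twin_comp.
- by move=> k k' l l' f g _ [f' ?] _ [g' ?]; exists (tmap f' g'); apply: twin_tmap.
- by move=> k l a b f g _ [f' ?] _ [g' ?]; exists (a *: f' + b *: g'); apply: twin_lin.
by move=> k l f _ [f' ?]; exists (dagger f'); apply: twin_dagger.
Qed.

Lemma generated_twin' k l (f' : 'Hom(tpow Z' k, tpow Z' l)) :
  generated D' f' -> exists f, twin f f'.
Proof.
elim=> {k l f'}.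
- by move=> k l f' /D'_twin[f ff']; exists f; apply: twin_base.
- by move=> k; exists \1%VF; apply: twin_id.
- by move=> k l n f' g' _ [f ?] _ [g ?]; exists (g \o f)%VF; apply: twin_comp.
- by move=> k k' l l' f' g' _ [f ?] _ [g ?]; exists (tmap f g); apply: twin_tmap.
- by move=> k l a b f' g' _ [f ?] _ [g ?]; exists (a *: f + b *: g); apply: twin_lin.
by move=> k l f' _ [f ?]; exists (dagger f); apply: twin_dagger.
Qed.

Definition twin_map : hom_map Z Z' := fun k l f => xget 0 [set f' | twin f f'].

Lemma twin_mapE k l (f : 'Hom(tpow Z k, tpow Z l)) f' : twin f f' -> twin_map f = f'.
Proof.
move=> ff'; have := xgetI (0 : 'Hom(_, _)) (P := [set f' | twin f f']) ff'.
by move=> /= ff''; apply/(twin_inj ff'' ff').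
Qed.

Theorem twin_iso :
  monoidal_dagger_iso (generated D) (generated D') twin_map.
Proof.
have tm k l (f : 'Hom(tpow Z k, tpow Z l)) : generated D f -> twin f (twin_map f).
  by move=> /generated_twin[f' ff']; rewrite (twin_mapE ff').
split.
- move=> k l; split.
  + by move=> f /tm/twin_generated[].
  + by move=> f g /set_mem/tm tf /set_mem/tm tg e; apply/(twin_inj tf tg).
  move=> f' /generated_twin'[f ff']; exists f; last exact: twin_mapE.
  by case: (twin_generated ff').
- by move=> k; apply: twin_mapE; apply: twin_id.
- by move=> k l n f g /tm tf /tm tg; apply: twin_mapE; apply: twin_comp.
- by move=> k k' l l' f g /tm tf /tm tg; apply: twin_mapE; apply: twin_tmap.
- by move=> k l a b f g /tm tf /tm tg; apply: twin_mapE; apply: twin_lin.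
by move=> k l f /tm tf; apply: twin_mapE; apply: twin_dagger.
Qed.

End Twins.

(** * The operations given by a quantum Hadamard matrix *)

Section Adjoints.
Variables (R : realType) (X : fqspace R).
Local Notation C := R[i].
Local Notation psi := (fpsi X).

Lemma edaggerE (f g : 'End(X)) :
  (forall x y, finner (g y) x = finner y (f x)) -> edagger f = g.
Proof.
move=> fg; have := edaggerP (fq_axiom X) f; move: (edagger f) => h fh.
have [sX _ [ndl _] _] := fq_axiom X.
apply/lfunP => y; apply/eqP; rewrite -subr_eq0; apply/eqP.
apply: (finner_nl sX ndl) => v.
have -> : h y - g y = (-1) *: g y + h y by rewrite scaleN1r addrC.
by rewrite (finner_conj sX) fg fh rmorphN1 mulN1r addNr.
Qed.

Lemma all_one_E x : all_one X x = psi x *: 1.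
Proof. by rewrite comp_lfunE unit_dagE unit_mapE. Qed.

Lemma edagger_all_one : edagger (all_one X) = all_one X.
Proof.
apply: edaggerE => x y; rewrite !all_one_E.
have -> : finner (psi y *: 1) x = (psi y)^* * finner 1 x.
  rewrite -[_ *: 1]addr0 (finner_conj (fq_star X)) /finner (fstar0 (fq_star X)) mul0r linear0.
  by rewrite addr0.
by rewrite /finner (star1 X) mul1r psi_star -scalerAr linearZ /= mulr1 mulrC.
Qed.

Lemma edagger_lin a b (f g : 'End(X)) :
  edagger (a *: f + b *: g) = a^* *: edagger f + b^* *: edagger g.
Proof.
have := edaggerP (fq_axiom X) f; have := edaggerP (fq_axiom X) g.
move=> gP fP; apply: edaggerE => x y.
move: (edagger f) (edagger g) fP gP => f' g' fP gP.
have flin (u v : X) c : finner u (c *: v) = c * finner u v.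
  by rewrite /finner -scalerAr linearZ.
rewrite !(add_lfunE, scale_lfunE) (finner_conj (fq_star X)) (finner_lin a) conjCK fP flin.
have fconj (u v : X) c : finner (c *: u) v = c^* * finner u v.
  by rewrite -finner_herm flin rmorphM /= finner_herm.
by rewrite fconj gP conjCK.
Qed.

End Adjoints.

Section Systems.
Variables (R : realType) (X : fqspace R) (H : 'End(X)).
Local Notation C := R[i].
Local Notation psi := (fpsi X).

Hypothesis hH : quantum_hadamard H.

(** [H = H^*], written with [psi] instead of [R]. *)
Lemma hadamard_transpose x y : psi (y * H x) = psi (edagger H y * x).
Proof.
have [h1 _ _ _] := hH; have [E cE] := copairing_exists X.
have e : ptensor 1 [:: H x] = \sum_(e <- E) psi (edagger H e.2 * x) *: ptensor 1 [:: e.1].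
  rewrite -tendo_ptensor h1 /real_conj !comp_lfunE tendo_dag.
  move: (edagger H) => H'.
  rewrite (tmap_cup 1 [:: x] cE).
  pose T : 'Hom(tpow X 3, tpow X 1) :=
    (tmap (\1%VF : 'End(tpow X 1)) (fcap X) \o
     tmap (\1%VF : 'End(tpow X 1)) (tmap (tendo H') (\1%VF : 'End(tpow X 1))))%VF.
  transitivity (T (\sum_(e <- E) ptensor 3 [:: e.1; e.2; x])); first by rewrite comp_lfunE.
  rewrite linear_sum; apply: eq_bigr => e _ /=.
  rewrite comp_lfunE (tmap_id_cons (tmap (tendo H') (\1%VF : 'End(tpow X 1)))).
  rewrite (ptensor_cons 1 e.2) tmapE tendo_ptensor id_lfunE -!ptensor_cons.
  rewrite (tmap_id_cons (fcap X)) fcap_ptensor.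
  apply/ffunP => i; rewrite !ffunE /GRing.scale /= mulrCA; congr (_ * _).
  rewrite big_ord0 mulr1 !big_ord1 !ffunE; congr (coord _ _ _).
  by congr (i _); apply: val_inj.
have {}e : H x = \sum_(e <- E) psi (edagger H e.2 * x) *: e.1.
  apply: ptensor1_inj; rewrite e.
  have pD a (u v : X) : ptensor 1 [:: a *: u + v] = a *: ptensor 1 [:: u] + ptensor 1 [:: v].
    exact: ptensor1_lin.
  have p0 : ptensor 1 [:: 0 : X] = 0.
    by have := pD (-1) 0 0; rewrite scaler0 addr0 scaleN1r addNr.
  by apply: (big_rec2 (fun (a : tpow X 1) (b : X) => a = ptensor 1 [:: b])) => // i a b _ ->;
     rewrite pD.
rewrite e mulr_sumr linear_sum; under eq_bigr do rewrite -scalerAr linearZ /= mulrC.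
have lT : linear (fun z => psi (edagger H z * x) : C^o).
  by move=> a u v; rewrite linearP mulrDl -scalerAl linearP.
rewrite -[in RHS](cE y) linear_sum mulr_suml linear_sum; apply: eq_bigr => k _.
by rewrite linearZ -scalerAl /= linearZ.
Qed.

Lemma schur_ptensor E (f g : 'End(X)) x : copairing E ->
  schur_prod (tendo f) (tendo g) (ptensor 1 [:: x]) =
  ptensor 1 [:: \sum_(e <- E) f (x * e.1) * g e.2].
Proof.
move=> cE; rewrite /schur_prod !comp_lfunE (fmul_dag _ cE).
pose T : 'Hom(tpow X 2, tpow X 1) := (fmul X \o tmap (tendo f) (tendo g))%VF.
have TE a b : T (ptensor 2 [:: a; b]) = ptensor 1 [:: f a * g b].
  rewrite comp_lfunE -fmul_ptensor; congr (fmul X _).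
  have -> : ptensor 2 [:: f a; g b] = tcat (tendo f (ptensor 1 [:: a])) (tendo g (ptensor 1 [:: b])).
    rewrite [LHS](ptensor_cons 1) -(tendo_ptensor f a).
    by rewrite -(tendo_ptensor g b).
  rewrite -tmapE; congr (fun_of_lfun _ _); exact: (ptensor_cons 1).
transitivity (T (\sum_(e <- E) ptensor 2 [:: x * e.1; e.2])); first by rewrite comp_lfunE.
rewrite linear_sum /=; under eq_bigr do rewrite TE.
have pD (u v : X) : ptensor 1 [:: u + v] = ptensor 1 [:: u] + ptensor 1 [:: v].
  by have := ptensor1_lin 1 u v; rewrite !scale1r.
have p0 : ptensor 1 [:: 0 : X] = 0.
  by have := pD 0 0; rewrite addr0 -{1}[ptensor 1 _]addr0 => /addrI.
by apply: (big_rec2 (fun (a : tpow X 1) (b : X) => a = ptensor 1 [:: b])) => // e a b _ ->.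
Qed.

Lemma schur_dag (A B : 'End(tpow X 1)) :
  dagger (schur_prod A B) = schur_prod (dagger A) (dagger B).
Proof.
have e : dagger (tmap A B : 'End(tpow X 2)) = tmap (dagger A) (dagger B) := dagger_tmap A B.
by rewrite /schur_prod !dagger_comp e daggerK comp_lfunA.
Qed.

(** For the adjoint of [H], take the adjoint of the relation for [H]: Schur
    products are compatible with adjoints and [eta eta^dagger] is self-adjoint. *)
Lemma hadamard_schur E o x : copairing E ->
  let T := if o then edagger H else H in
  \sum_(e <- E) T (x * e.1) * T e.2 = psi x *: 1.
Proof.
move=> cE T; have [_ h2 _ _] := hH; apply: ptensor1_inj.
rewrite -(schur_ptensor T T x cE).
have -> : schur_prod (tendo T) (tendo T) = (funit X \o dagger (funit X))%VF.
  rewrite /T; case: (o); last exact: h2.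
  have e := schur_dag (tendo H) (tendo H); rewrite tendo_dag in e.
  by rewrite -e h2 dagger_comp daggerK.
rewrite comp_lfunE funit_dag linearZ /= funit_ptensor.
have := ptensor1_lin (psi x) (1 : X) 0; rewrite addr0 => ->.
have := ptensor1_lin (-1) (0 : X) 0; rewrite scaler0 addr0 scaleN1r addNr => ->.
by rewrite addr0.
Qed.

End Systems.

Section HadamardSystem.
Variables (R : realType) (X : fqspace R) (H : 'End(X)).
Local Notation C := R[i].
Local Notation psi := (fpsi X).

(** [psi 1] is the norm of 1, so if it were 0, then 1 would be in the radical of
    the inner product. *)
Lemma psi1_neq0 : psi 1 != 0.
Proof.
apply/eqP => p0; have := pos_form_radical (finner_pos_form X) (u := 1).
rewrite /finner star1 mul1r => /(_ p0) h.
have [_ _ [ndl _] _] := fq_axiom X.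
by have /eqP := ndl 1 h; rewrite oner_eq0.
Qed.

Lemma delta_sq : delta X ^+ 2 = psi 1.
Proof. by rewrite deltaE sqrtCK. Qed.

Hypothesis hH : quantum_hadamard H.

Definition hadamard_map o : 'End(X) := if o then edagger H else H.

Lemma hadamard_mapK o x : hadamard_map o (hadamard_map (~~ o) x) = psi 1 *: x.
Proof.
have [_ _ h3 h4] := hH; rewrite delta_sq in h3 h4.
rewrite /hadamard_map; move: (edagger H) h3 h4 => H' h3 h4.
by case: o => /=; rewrite -comp_lfunE ?h3 ?h4 scale_lfunE id_lfunE.
Qed.

(** For the adjoint this follows from the case of [H] by inserting [H H^dagger]
    and [H^dagger H] on the two sides. *)
Lemma hadamard_mapT o x y : psi (y * hadamard_map o x) = psi (hadamard_map (~~ o) y * x).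
Proof.
case: o; last exact: (hadamard_transpose hH).
apply: (mulfI psi1_neq0).
have e := hadamard_mapK false x; have e' := hadamard_mapK true y.
have t := hadamard_transpose hH (edagger H x) (H y).
rewrite /hadamard_map /= in e e' *; move: (edagger H) e e' t => H' e e' t.
transitivity (psi (H' (H y) * H' x)); first by rewrite e' -scalerAl linearZ.
by rewrite -t e -scalerAr linearZ.
Qed.

Variables (r : C) (E : seq (X * X)).
Hypothesis r4 : psi 1 = r ^+ 4.
Hypothesis cE : copairing E.

Lemma hadamard_mapK4 o x : hadamard_map o (hadamard_map (~~ o) x) = r ^+ 4 *: x.
Proof. by rewrite -r4 hadamard_mapK. Qed.

Definition hadamard_system : biunitary r :=
  @Biunitary _ r X psi E (fun o => fun_of_lfun (hadamard_map o) : {linear X -> X})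
    cE (copairing_r cE) (copairing_special cE) r4 hadamard_mapK4 hadamard_mapT
    (fun o x => hadamard_schur hH o x cE).

End HadamardSystem.

(** * Pulling functionals back along the generators *)

Section Pullbacks.
Variables (R : realType) (Z : fqspace R).
Local Notation C := R[i].
Implicit Types phi : seq Z -> C.

Lemma pulls_mul p phi chi : multilinear phi ->
  (forall l1 x y l2, size l1 = p -> chi (l1 ++ x :: y :: l2) = phi (l1 ++ (x * y) :: l2)) ->
  pulls (fmul Z) p phi chi.
Proof.
move=> mp h l1 [|x [|y [|]]] // l2 s1 _.
by rewrite h // fmul_ptensor ev_ptensor.
Qed.

Lemma pulls_comul p phi chi E : multilinear phi -> copairing E ->
  (forall l1 x l2, size l1 = p -> chi (l1 ++ x :: l2) =
     \sum_(e <- E) phi (l1 ++ (x * e.1) :: e.2 :: l2)) ->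
  pulls (dagger (fmul Z)) p phi chi.
Proof.
move=> mp cE h l1 [|x [|]] // l2 s1 _.
rewrite h // (fmul_dag _ cE).
under [in RHS]eq_bigr do rewrite -[ptensor 2 _]scale1r.
rewrite ev_sum; apply: eq_bigr => e _.
by rewrite ev_ptensor ?mul1r.
Qed.

Lemma pulls_counit p phi chi : multilinear phi ->
  (forall l1 x l2, size l1 = p -> chi (l1 ++ x :: l2) = fpsi Z x * phi (l1 ++ l2)) ->
  pulls (dagger (funit Z)) p phi chi.
Proof.
move=> mp h l1 [|x [|]] // l2 s1 _.
rewrite h // funit_dag -[_ *: _]addr0 ev_lin ev_ptensor //=.
by rewrite [X in _ + X]big1 ?addr0 // => i _; rewrite ffunE mul0r.
Qed.

Lemma pulls_unit p phi chi : multilinear phi ->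
  (forall l1 l2, size l1 = p -> chi (l1 ++ l2) = phi (l1 ++ 1 :: l2)) ->
  pulls (funit Z) p phi chi.
Proof.
move=> mp h l1 [|] // l2 s1 _.
by rewrite h // funit_ptensor ev_ptensor.
Qed.

Lemma pulls_endo p phi chi (f : 'End(Z)) : multilinear phi ->
  (forall l1 x l2, size l1 = p -> chi (l1 ++ x :: l2) = phi (l1 ++ f x :: l2)) ->
  pulls (tendo f) p phi chi.
Proof.
move=> mp h l1 [|x [|]] // l2 s1 _.
by rewrite h // tendo_ptensor ev_ptensor.
Qed.

Lemma pulls_phi_lin k l (f : 'Hom(tpow Z k, tpow Z l)) p a b phi phi' chi chi' :
  pulls f p phi chi -> pulls f p phi' chi' ->
  pulls f p (fun s => a * phi s + b * phi' s) (fun s => a * chi s + b * chi' s).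
Proof.
move=> pf pf' l1 w l2 s1 sw; rewrite pf // pf' // /ev !mulr_sumr -big_split.
by apply: eq_bigr => i _ /=; ring.
Qed.

End Pullbacks.

Section Span.
Variables (R : realType) (Z Z' : fqspace R).
Local Notation C := R[i].
Variable B : (seq Z -> C) -> (seq Z' -> C) -> Prop.

Inductive span2 : (seq Z -> C) -> (seq Z' -> C) -> Prop :=
| span2_base phi phi' of B phi phi' : span2 phi phi'
| span2_lin a b phi phi' chi chi' of span2 phi phi' & span2 chi chi' :
    span2 (fun s => a * phi s + b * chi s) (fun s => a * phi' s + b * chi' s).

Lemma span2_multilinear phi phi' : (forall phi phi', B phi phi' -> multilinear phi /\ multilinear phi') ->
  span2 phi phi' -> multilinear phi /\ multilinear phi'.
Proof.
move=> Bm; elim=> [? ? /Bm //|a b p p' c c' _ [mp mp'] _ [mc mc']].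
by split=> l1 l2 d u v; rewrite ?mp ?mc ?mp' ?mc'; ring.
Qed.

Lemma span2_scalar phi phi' : (forall phi phi', B phi phi' -> phi [::] = phi' [::]) ->
  span2 phi phi' -> phi [::] = phi' [::].
Proof. by move=> Bs; elim=> [? ? /Bs //|a b p p' c c' _ -> _ ->]. Qed.

Lemma span2_stable k l (f : 'Hom(tpow Z k, tpow Z l)) f' :
  (forall p phi phi', B phi phi' ->
    exists chi chi', [/\ span2 chi chi', pulls f p phi chi & pulls f' p phi' chi']) ->
  stable span2 f f'.
Proof.
move=> Bf p phi phi'; elim=> [? ? /Bf //|a b p1 p1' c c' _ IH1 _ IH2].
have [chi [chi' [s1 q1 q1']]] := IH1; have [om [om' [s2 q2 q2']]] := IH2.
exists (fun s => a * chi s + b * om s), (fun s => a * chi' s + b * om' s).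
by split; [exact: span2_lin | exact: pulls_phi_lin | exact: pulls_phi_lin].
Qed.

End Span.

(** * Rows of coloured legs *)

Section LocalMoves.
Variables (K : fieldType) (r : K) (S : biunitary r).
Implicit Types (f : seq S -> K) (p : op).

Lemma pop_cat (T : (seq S -> K) -> seq S -> K) k f l1 l2 : size l1 = k ->
  pop k T f (l1 ++ l2) = T (fun l => f (l1 ++ l)) l2.
Proof. by elim: k l1 f => [|k IH] [|x l1] f //= [sl]; rewrite IH. Qed.

Lemma act_even p k f l1 l2 : size l1 = k ->
  act p k.*2 f (l1 ++ l2) = act_plain p (fun l => f (l1 ++ l)) l2.
Proof. by move=> sl; rewrite /act doubleK odd_double pop_cat. Qed.

Lemma act_odd p k f l1 l2 : size l1 = k ->
  act p k.*2.+1 f (l1 ++ l2) = act_shaded p (fun l => f (l1 ++ l)) l2.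
Proof. by move=> sl; rewrite /act /= uphalf_double odd_double pop_cat. Qed.

End LocalMoves.

Section RegionLists.
Implicit Types P Q : seq bool.
Local Notation regs P := (fun j => nth false P j).

Lemma reg_ins_cat P x q Q :
  reg_ins (size P) q (nth false (P ++ x :: Q)) = nth false (P ++ [:: x, q, x & Q]).
Proof.
apply/funext => j; rewrite /reg_ins !nth_cat.
have [jP|Pj] := ltnP j (size P); first by rewrite ltnW.
have [d jE] : exists d, j = (size P + d)%N by exists (j - size P)%N; lia.
rewrite jE addKn; case: d {jE} => [|[|d]].
- by rewrite addn0 leqnn.
- by rewrite addn1 ltnn eqxx.
rewrite !addnS /=; have /negPf -> : ~~ ((size P + d).+2 <= size P)%N by lia.
have /negPf -> : (size P + d).+2 != (size P).+1 by lia.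
by rewrite ltnNge leq_addr /= addKn.
Qed.

Lemma reg_del_cat P x q x' Q :
  reg_del (size P) (nth false (P ++ [:: x, q, x' & Q])) = nth false (P ++ x :: Q).
Proof.
apply/funext => j; rewrite /reg_del !nth_cat.
have [jP|Pj] := ltnP j (size P); first by rewrite ltnW.
have [d jE] : exists d, j = (size P + d)%N by exists (j - size P)%N; lia.
rewrite jE addKn; case: d {jE} => [|d]; first by rewrite addn0 leqnn.
have /negPf -> : ~~ (size P + d.+1 <= size P)%N by lia.
have /negPf -> : ~~ ((size P + d.+1).+2 < size P)%N by lia.
by rewrite (_ : (size P + d.+1).+2 - size P = d.+3)%N //; lia.
Qed.

Lemma reg_flip_cat P x Q :
  reg_flip (size P) (nth false (P ++ x :: Q)) = nth false (P ++ ~~ x :: Q).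
Proof.
apply/funext => j; rewrite /reg_flip !nth_cat.
have [jP|Pj] := ltnP j (size P); first by rewrite ltn_eqF // addbF.
have [d jE] : exists d, j = (size P + d)%N by exists (j - size P)%N; lia.
rewrite jE addKn; case: d {jE} => [|d]; first by rewrite addn0 eqxx addbT.
have /negPf -> : (size P + d.+1)%N != size P by lia.
by rewrite addbF.
Qed.

End RegionLists.

Section Coloured.
Variables (K : fieldType) (V : lmodType K).
Implicit Types (kap : seq (bool * bool)) (g h c o : bool) (f : seq V -> K).
Local Notation Y := (V * V * V * V)%type.

Definition ysel c (y : Y) : V * V :=
  if c then (y.1.2, y.2) else (y.1.1.1, y.1.1.2).
(** The bit [c] selects the first or the last two of the four copies, the bit [o]
    their sum or their difference. *)
Definition yproj c o y : V := (ysel c y).1 + (-1) ^+ o *: (ysel c y).2.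

(** For every leg, [kap] lists the bit of the leg and the bit of the unshaded
    region on its right; [g] is the bit of the region on its left. Hence a leg
    carries the difference of two copies if the bits on its sides differ. The
    value is 0 unless there are as many entries as legs. *)
Fixpoint legwise kap g f (ys : seq Y) : K := match kap, ys with
  | [::], [::] => f [::]
  | (c, h) :: kap', y :: ys' => legwise kap' h (fun l => f (yproj c (g (+) h) y :: l)) ys'
  | _, _ => 0
  end.

Fixpoint projs kap g (ys : seq Y) : seq V := match kap, ys with
  | (c, h) :: kap', y :: ys' => yproj c (g (+) h) y :: projs kap' h ys'
  | _, _ => [::]
  end.

Definition ends g kap := last g [seq p.2 | p <- kap].

Lemma size_projs kap g ys : size kap = size ys -> size (projs kap g ys) = size ys.
Proof. by elim: kap g ys => [|[c h] kap IH] g [|y ys] //= [/IH->]. Qed.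

Lemma legwise_cat kap1 kap2 g f l1 l2 : size kap1 = size l1 ->
  legwise (kap1 ++ kap2) g f (l1 ++ l2) =
  legwise kap2 (ends g kap1) (fun l => f (projs kap1 g l1 ++ l)) l2.
Proof.
elim: kap1 g f l1 => [|[c h] kap1 IH] g f [|y l1] //= [s1].
by rewrite IH.
Qed.

Lemma legwise_short kap g f l1 l2 : (size kap < size l1 + size l2)%N ->
  legwise kap g f (l1 ++ l2) = 0.
Proof.
rewrite -size_cat; move: (l1 ++ l2) => l {l1 l2}.
by elim: kap g f l => [|[c h] kap IH] g f [|y l] //=; rewrite ltnS => /IH.
Qed.

Lemma eq_legwise kap g f f' ys : (forall l, f l = f' l) -> legwise kap g f ys = legwise kap g f' ys.
Proof. by move=> /funext ->. Qed.

Lemma legwise_lin kap g a b f f' ys :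
  legwise kap g (fun l => a * f l + b * f' l) ys = a * legwise kap g f ys + b * legwise kap g f' ys.
Proof.
elim: kap g f f' ys => [|[c h] kap IH] g f f' [|y ys] //=; by rewrite !mulr0 addr0.
Qed.

Lemma legwiseZ kap g a f ys : legwise kap g (fun l => a * f l) ys = a * legwise kap g f ys.
Proof. by elim: kap g f ys => [|[c h] kap IH] g f [|y ys] //=; rewrite mulr0. Qed.

Lemma legwise0 kap g ys : legwise kap g (fun _ => 0) ys = 0.
Proof. by elim: kap g ys => [|[c h] kap IH] g [|y ys] //=. Qed.

Lemma legwise_sum kap g (J : Type) (s : seq J) (f : J -> seq V -> K) ys :
  legwise kap g (fun l => \sum_(j <- s) f j l) ys = \sum_(j <- s) legwise kap g (f j) ys.
Proof.
elim: s => [|j s IH].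
  by rewrite big_nil -[RHS](legwise0 kap g ys); apply: eq_legwise => l; rewrite big_nil.
rewrite big_cons -IH -[legwise _ _ (f j) _]mul1r -[X in _ + X]mul1r -legwise_lin.
by apply: eq_legwise => l; rewrite big_cons !mul1r.
Qed.

Lemma yproj_lin c o a (u v : Y) : yproj c o (a *: u + v) = a *: yproj c o u + yproj c o v.
Proof.
rewrite /yproj; case: u v => [[[u1 u2] u3] u4] [[[v1 v2] v3] v4].
by case: c => /=; rewrite !scalerDr !scalerA [_ * a]mulrC addrACA.
Qed.

Lemma legwise_multilinear kap g f : multilinear f -> multilinear (legwise kap g f).
Proof.
elim: kap g f => [|[c h] kap IH] g f mf [|y l1] l2 a u v //=; rewrite ?mulr0 ?addr0 //.
  rewrite -[X in _ = _ + X]mul1r -legwise_lin; apply: eq_legwise => l.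
  by rewrite yproj_lin (mf [::]) mul1r.
by apply: IH; apply: multilinear_cons.
Qed.

Definition regseq kap := flatten [seq [:: p.1; p.2] | p <- kap].
Definition regs g kap := nth false (g :: regseq kap).

Lemma size_regseq kap : size (regseq kap) = (size kap).*2.
Proof. by elim: kap => [//|p kap IH]; rewrite /= IH doubleS. Qed.

Lemma regseq_cat kap1 kap2 : regseq (kap1 ++ kap2) = regseq kap1 ++ regseq kap2.
Proof. by rewrite /regseq map_cat flatten_cat. Qed.

Lemma regseq_ends g kap : exists2 P, size P = (size kap).*2 &
  g :: regseq kap = rcons P (ends g kap).
Proof.
exists (belast g (regseq kap)); first by rewrite size_belast size_regseq.
rewrite lastI; congr rcons.
elim: kap g => [//|[c h] kap IH] g /=; exact: IH.
Qed.

Lemma regs_split kap1 c h kap2 b g :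
  regs g (kap1 ++ (c, b) :: (c, h) :: kap2) =
  reg_ins (size kap1).*2.+1 b (regs g (kap1 ++ (c, h) :: kap2)).
Proof.
by rewrite /regs !regseq_cat -size_regseq -!cat_cons (reg_ins_cat (g :: _)).
Qed.

Lemma regs_insert kap1 c kap2 g :
  regs g (kap1 ++ (c, ends g kap1) :: kap2) = reg_ins (size kap1).*2 c (regs g (kap1 ++ kap2)).
Proof.
have [P sP E] := regseq_ends g kap1.
by rewrite /regs !regseq_cat -sP -!cat_cons E -!cats1 -!catA reg_ins_cat.
Qed.

Lemma regs_merge kap1 c b c' h kap2 g :
  regs g (kap1 ++ (c, h) :: kap2) =
  reg_del (size kap1).*2.+1 (regs g (kap1 ++ (c, b) :: (c', h) :: kap2)).
Proof.
by rewrite /regs !regseq_cat -size_regseq -!cat_cons (reg_del_cat (g :: _)).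
Qed.

Lemma regs_delete kap1 c h kap2 g :
  regs g (kap1 ++ kap2) = reg_del (size kap1).*2 (regs g (kap1 ++ (c, h) :: kap2)).
Proof.
have [P sP E] := regseq_ends g kap1.
by rewrite /regs !regseq_cat -sP -!cat_cons E -!cats1 -!catA reg_del_cat.
Qed.

Lemma regs_recolour kap1 c h kap2 g :
  regs g (kap1 ++ (~~ c, h) :: kap2) =
  reg_flip (size kap1).*2.+1 (regs g (kap1 ++ (c, h) :: kap2)).
Proof.
by rewrite /regs !regseq_cat -size_regseq -!cat_cons (reg_flip_cat (g :: _)).
Qed.

Lemma regs_at kap1 c h kap2 g (t := regs g (kap1 ++ (c, h) :: kap2)) :
  [/\ t (size kap1).*2 = ends g kap1, t (size kap1).*2.+1 = c & t (size kap1).*2.+2 = h].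
Proof.
rewrite /t /regs; have [P sP E] := regseq_ends g kap1.
rewrite regseq_cat -cat_cons E -sP; split; rewrite nth_cat size_rcons.
- by rewrite ltnSn nth_rcons ltnn eqxx.
- by rewrite ltnn subnn.
by rewrite ltnNge leqnSn /= subSnn.
Qed.

Lemma regs_at2 kap1 c b c' h kap2 g (t := regs g (kap1 ++ (c, b) :: (c', h) :: kap2)) :
  t (size kap1).*2.+1 = c /\ t (size kap1).*2.+3 = c'.
Proof.
split; first by have [] := regs_at kap1 c b ((c', h) :: kap2) g.
have := regs_at (rcons kap1 (c, b)) c' h kap2 g.
by rewrite /t size_rcons doubleS -cats1 -catA => -[].
Qed.

End Coloured.

(** * Operations of the fourfold sum as strand operations *)

Section FourfoldSum.
Variables (R : realType) (X : fqspace R).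
Local Notation C := R[i].
Local Notation psi := (fpsi X).
Local Notation Y := (fq_sum4 X).

Lemma ysel_mul c (y y' : Y) : ysel c (y * y') = ysel c y * ysel c y'.
Proof. by case: c. Qed.

(** The product of two copies in terms of sums and differences. The two terms
    belong to the two bits of the region that opens between the factors. *)
Lemma yproj_mul c g h (y y' : Y) :
  yproj c (g (+) h) (y * y') =
  2%:R^-1 *: (yproj c g y * yproj c h y') +
  2%:R^-1 *: (yproj c (~~ g) y * yproj c (~~ h) y').
Proof.
have two : (2%:R : C) != 0 by rewrite pnatr_eq0.
apply: (scalerI two); rewrite [in RHS]scalerDr !scalerA mulfV // !scale1r.
rewrite /yproj ysel_mul; case: (ysel c y) => a b; case: (ysel c y') => a' b' /=.
rewrite !signrN !scaleNr; set e := (-1) ^+ g; set e' := (-1) ^+ h.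
rewrite signr_addb -/e -/e' !mulrDl !mulrDr !mulNr !mulrN opprK.
rewrite -!scalerAl -!scalerAr !scalerA.
set p := a * a'; set q := e' *: _; set u := e *: (b * a'); set v := (e * e') *: _.
have -> : p + q + (u + v) + (p - q + (- u + v)) = p + p + (v + v).
  rewrite addrACA; congr (_ + _); first by rewrite addrACA subrr addr0.
  by rewrite addrACA subrr add0r.
by rewrite scaler_nat mulr2n addrACA.
Qed.

Lemma psi_sum4 (y : Y) : fpsi Y y = psi (yproj false false y) + psi (yproj true false y).
Proof.
case: y => [[[a b] c] d]; rewrite /yproj /= !scale1r !linearD addrA.
by [].
Qed.

Lemma yproj_one c o : yproj c o (1 : Y) = if o then 0 else 2%:R *: 1.
Proof.
rewrite /yproj (_ : ysel c 1 = (1, 1)); last by case: c.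
by case: o; rewrite /= ?expr1 ?expr0 ?scaleN1r ?subrr // scale1r scaler_nat mulr2n.
Qed.

Definition yinj c s (x : X) : Y := match c, s with
  | false, false => (x, 0, 0, 0) | false, true => (0, x, 0, 0)
  | true, false => (0, 0, x, 0) | true, true => (0, 0, 0, x) end.

Definition sum4_cop (E : seq (X * X)) : seq (Y * Y) :=
  [seq (yinj k.1 k.2 e.1, yinj k.1 k.2 e.2) |
    k <- [:: (false, false); (false, true); (true, false); (true, true)], e <- E].

Lemma sum_sum4_cop (T : zmodType) (F : Y * Y -> T) E :
  \sum_(e <- sum4_cop E) F e =
  \sum_(e <- E) F (yinj false false e.1, yinj false false e.2) +
  (\sum_(e <- E) F (yinj false true e.1, yinj false true e.2) +
  (\sum_(e <- E) F (yinj true false e.1, yinj true false e.2) +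
   \sum_(e <- E) F (yinj true true e.1, yinj true true e.2))).
Proof. by rewrite big_allpairs_dep 4!big_cons big_nil /= addr0. Qed.

Definition ycoord c s (y : Y) : X := if s then (ysel c y).2 else (ysel c y).1.

Lemma psi_yinj c s (x : X) (y : Y) : fpsi Y (y * yinj c s x) = psi (ycoord c s y * x).
Proof.
case: y => [[[y1 y2] y3] y4].
by case: c; case: s; rewrite /= /sum_psi /= /sum_psi /= /sum_psi /= !mulr0 !linear0 ?addr0 ?add0r.
Qed.

Lemma yinj_lin c s a (u v : X) : yinj c s (a *: u + v) = a *: yinj c s u + yinj c s v.
Proof. by case: c; case: s; congr (_, _, _, _); rewrite /= scaler0 addr0. Qed.

Lemma sum4_copairing E : copairing E -> copairing (sum4_cop E : seq (Y * Y)).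
Proof.
move=> cE z.
have H c s : \sum_(e <- E) fpsi Y (z * yinj c s e.1) *: yinj c s e.2 = yinj c s (ycoord c s z).
  under eq_bigr do rewrite psi_yinj.
  rewrite -[in RHS](cE (ycoord c s z)).
  have y0 : yinj c s 0 = 0 by have := yinj_lin c s (-1) 0 0; rewrite scaler0 addr0 scaleN1r addNr.
  by apply: (big_rec2 (fun (a : Y) (b : X) => a = yinj c s b)) => // i a b _ ->;
     rewrite yinj_lin.
pose T c s := \sum_(e <- E) fpsi Y (z * yinj c s e.1) *: yinj c s e.2.
transitivity (T false false + (T false true + (T true false + T true true))).
  exact: sum_sum4_cop.
have TE c s : T c s = yinj c s (ycoord c s z) by exact: H.
rewrite !TE; move: z {T H TE} => [[[a b] c] d].
by congr (_, _, _, _); rewrite /= ?addr0 ?add0r.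
Qed.

Lemma yproj_yinj c o c' s (x : X) :
  yproj c o (yinj c' s x) = if c == c' then (-1) ^+ (o && s) *: x else 0.
Proof.
by case: c; case: c'; case: s; case: o;
   rewrite /yproj /= ?scaler0 ?addr0 ?add0r ?scale1r ?expr0 ?scale1r.
Qed.

Lemma yproj_mul_yinj c o c' s (y : Y) (x : X) :
  yproj c o (y * yinj c' s x) =
  if c == c' then (-1) ^+ (o && s) *: (ycoord c' s y * x) else 0.
Proof.
case: y => [[[y1 y2] y3] y4].
by case: c; case: c'; case: s; case: o;
   rewrite /yproj /= ?mulr0 ?scaler0 ?addr0 ?add0r ?scale1r ?expr0 ?scale1r.
Qed.

Lemma edagger_plus (H : 'End(X)) :
  edagger (had_plus H) = 2%:R^-1 *: (all_one X + edagger H).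
Proof.
rewrite /had_plus scalerDr edagger_lin edagger_all_one fmorphV rmorph_nat.
by rewrite -scalerDr.
Qed.

Lemma edagger_minus (H : 'End(X)) :
  edagger (had_minus H) = 2%:R^-1 *: (all_one X - edagger H).
Proof.
rewrite /had_minus scalerBr -scalerN -scaleN1r scalerA mulrN1 edagger_lin edagger_all_one.
by rewrite rmorphN /= !fmorphV !rmorph_nat scaleNr -scalerBr.
Qed.

(** The adjacency matrix exchanges the two pairs of copies. Since
    [H^+ + H^- = J] and [H^+ - H^- = H], it is [J] on sums and [H] or its adjoint
    on differences. *)
Lemma yproj_adj (H : 'End(X)) c o (y : Y) :
  yproj c o (hadamard_adj H y) =
  if o then hadamard_map H c (yproj (~~ c) true y) else psi (yproj (~~ c) false y) *: 1.
Proof.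
rewrite hadamard_adjE /hadamard_map; case: y => [[[a b] d] e].
have two : (2%:R : C) != 0 by rewrite pnatr_eq0.
have half (u v : X) : 2%:R^-1 *: (u + v) + 2%:R^-1 *: (u - v) = u.
  apply: (scalerI two); rewrite scalerDr !scalerA mulfV // !scale1r.
  by rewrite scaler_nat mulr2n addrACA subrr addr0.
have halfB (u v : X) : 2%:R^-1 *: (u + v) - 2%:R^-1 *: (u - v) = v.
  apply: (scalerI two); rewrite scalerBr !scalerA mulfV // !scale1r.
  by rewrite scaler_nat mulr2n opprB [v - u]addrC addrACA subrr add0r.
have hp (T : 'End(X)) u : (2%:R^-1 *: (all_one X + T)) u = 2%:R^-1 *: (psi u *: 1 + T u).
  by rewrite scale_lfunE add_lfunE all_one_E.
have hm (T : 'End(X)) u : (2%:R^-1 *: (all_one X - T)) u = 2%:R^-1 *: (psi u *: 1 - T u).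
  by rewrite scale_lfunE add_lfunE opp_lfunE all_one_E.
have sum (T : 'End(X)) u v :
    2%:R^-1 *: (psi u *: 1 + T u) + 2%:R^-1 *: (psi v *: 1 - T v) +
    (2%:R^-1 *: (psi u *: 1 - T u) + 2%:R^-1 *: (psi v *: 1 + T v)) = psi (u + v) *: 1.
  by rewrite addrACA half [X in _ + X]addrC half linearD scalerDl.
have dif (T : 'End(X)) u v :
    2%:R^-1 *: (psi u *: 1 + T u) + 2%:R^-1 *: (psi v *: 1 - T v) -
    (2%:R^-1 *: (psi u *: 1 - T u) + 2%:R^-1 *: (psi v *: 1 + T v)) = T (u - v).
  by rewrite opprD addrACA halfB -[X in _ + X]opprB halfB linearB.
rewrite /had_adj_fun /had_plus /had_minus -/(had_plus H) -/(had_minus H).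
rewrite edagger_plus edagger_minus; move: (edagger H) => H'.
rewrite /had_plus /had_minus /yproj.
case: c; case: o => /=; rewrite !hm !hp ?expr1 ?expr0 ?scaleN1r ?scale1r ?sum ?dif //.
Qed.

End FourfoldSum.

Section Moves.
Variables (R : realType) (X : fqspace R) (H : 'End(X)).
Local Notation C := R[i].
Local Notation psi := (fpsi X).
Local Notation Y := (fq_sum4 X).
Hypothesis hH : quantum_hadamard H.
Variables (r : C) (E : seq (X * X)).
Hypothesis r0 : r != 0.
Hypothesis r4 : psi 1 = r ^+ 4.
Hypothesis cE : copairing E.
Let S := hadamard_system hH r4 cE.
Implicit Types (f : seq S -> C) (kap : seq (bool * bool)).

(** A functional on lists in [C(X)] becomes one on lists in [C(Y)] by the choice
    of bits; the leftmost region has the bit [false]. *)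
Definition coloured (kap : seq (bool * bool)) f : seq Y -> C := @legwise C X kap false f.

Lemma multilinear_coloured kap f : multilinear f -> multilinear (coloured kap f).
Proof. by move=> mf; apply: (@legwise_multilinear C X). Qed.

(** A structure map of [C(Y)] acts on coloured functionals as a strand operation,
    summed over the bits of the region that it creates, and 0 if the regions that
    it joins have different bits. The other maps follow up to [coloured_adj]. *)
Lemma coloured_mul kap1 c h kap2 f l1 (y y' : Y) l2 : multilinear f -> size kap1 = size l1 ->
  coloured (kap1 ++ (c, h) :: kap2) f (l1 ++ (y * y') :: l2) =
  (2%:R * r)^-1 * coloured (kap1 ++ (c, false) :: (c, h) :: kap2)
    (act Cap (size kap1).*2.+1 f) (l1 ++ y :: y' :: l2) +
  (2%:R * r)^-1 * coloured (kap1 ++ (c, true) :: (c, h) :: kap2)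
    (act Cap (size kap1).*2.+1 f) (l1 ++ y :: y' :: l2).
Proof.
move=> mf s1; rewrite /coloured !(@legwise_cat C X) //; set g := ends _ _.
rewrite /= -(@legwise_lin C X); apply: eq_legwise => l /=.
have sp := size_projs (V := X) false s1; rewrite !act_odd ?sp //=.
rewrite yproj_mul mf multilinearZ //.
have k z : (2%:R * r)^-1 * (r * z) = 2%:R^-1 * z by rewrite invfM -mulrA mulKf.
by rewrite !k; case: (g); case: (h).
Qed.

Lemma coloured_counit kap1 kap2 f l1 (y : Y) l2 : size kap1 = size l1 ->
  fpsi Y y * coloured (kap1 ++ kap2) f (l1 ++ l2) =
  r * coloured (kap1 ++ (false, ends false kap1) :: kap2)
        (act Cap (size kap1).*2 f) (l1 ++ y :: l2) +
  r * coloured (kap1 ++ (true, ends false kap1) :: kap2)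
        (act Cap (size kap1).*2 f) (l1 ++ y :: l2).
Proof.
move=> s1; rewrite /coloured !(@legwise_cat C X) //; set g := ends _ _.
rewrite /= -(@legwise_lin C X) -(@legwiseZ C X); apply: eq_legwise => l /=.
have sp := size_projs (V := X) false s1; rewrite !act_even ?sp //= addbb psi_sum4.
by rewrite !mulVKf // -mulrDl.
Qed.

Lemma coloured_unit kap1 c h kap2 f l1 l2 : multilinear f -> size kap1 = size l1 ->
  coloured (kap1 ++ (c, h) :: kap2) f (l1 ++ (1 : Y) :: l2) =
  if ends false kap1 == h then
    2%:R * r * coloured (kap1 ++ kap2) (act Cup (size kap1).*2 f) (l1 ++ l2)
  else 0.
Proof.
move=> mf s1; rewrite /coloured !(@legwise_cat C X) //; set g := ends _ _.
have sp := size_projs (V := X) false s1.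
case: eqP => [->|gh] /=; last first.
  rewrite -[RHS](@legwise0 C X kap2 h l2); apply: eq_legwise => l.
  by rewrite yproj_one; case: (g) gh; case: (h) => // _; rewrite /= multilinear0.
rewrite -(@legwiseZ C X); apply: eq_legwise => l.
by rewrite addbb yproj_one /= multilinearZ // act_even ?sp //= -mulrA mulVKf.
Qed.

Lemma coloured_comul kap1 c b c' h kap2 f l1 (y : Y) l2 : multilinear f -> size kap1 = size l1 ->
  \sum_(e <- sum4_cop E) coloured (kap1 ++ (c, b) :: (c', h) :: kap2) f
     (l1 ++ (y * e.1) :: e.2 :: l2) =
  if c == c' then
    r^-1 * coloured (kap1 ++ (c, h) :: kap2) (act Cup (size kap1).*2.+1 f) (l1 ++ y :: l2)
  else 0.
Proof.
move=> mf s1; rewrite /coloured.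
under eq_bigr do rewrite (@legwise_cat C X) //.
rewrite (@legwise_cat C X) //; set g := ends _ _.
have sp := size_projs (V := X) false s1.
set pl := projs _ _ _ in sp *.
pose F l (e : Y * Y) := f (pl ++ yproj c (g (+) b) (y * e.1) :: yproj c' (b (+) h) e.2 :: l).
transitivity (legwise kap2 h (fun l => \sum_(e <- sum4_cop E) F l e) l2).
  by rewrite (@legwise_sum C X).
have FE l : \sum_(e <- sum4_cop E) F l e =
    if c == c' then \sum_(e <- E) f (pl ++ (yproj c (g (+) h) y * e.1) :: e.2 :: l) else 0.
  have term k s e : F l (yinj k s e.1, yinj k s e.2) =
      if (c == k) && (c' == k) then
        (-1) ^+ ((g (+) h) && s) * f (pl ++ (ycoord k s y * e.1) :: e.2 :: l) else 0.
    rewrite /F yproj_mul_yinj yproj_yinj; case: (c =P k) => [_|_] /=; last by rewrite multilinear0.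
    case: (c' =P k) => [_|_] /=; last by rewrite -cat_rcons multilinear0.
    rewrite multilinearZ // -[in LHS]cat_rcons multilinearZ // cat_rcons mulrA; congr (_ * _).
    by case: (s); case: (g); case: (b); case: (h); rewrite /= ?expr0 ?expr1 ?mulr1 ?mul1r ?mulrNN ?mulr1.
  rewrite sum_sum4_cop.
  under eq_bigr do rewrite term. under [X in _ + (X + _)]eq_bigr do rewrite term.
  under [X in _ + (_ + (X + _))]eq_bigr do rewrite term.
  under [X in _ + (_ + (_ + X))]eq_bigr do rewrite term.
  case: (c =P c') => [<-|nc]; last first.
    by case: (c) (c') nc => -[] //= _; rewrite !big1_eq !addr0.
  have main k : \sum_(e <- E) ((-1) ^+ ((g (+) h) && false) * f (pl ++ (ycoord k false y * e.1) :: e.2 :: l)) +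
      \sum_(e <- E) ((-1) ^+ ((g (+) h) && true) * f (pl ++ (ycoord k true y * e.1) :: e.2 :: l)) =
      \sum_(e <- E) f (pl ++ (yproj k (g (+) h) y * e.1) :: e.2 :: l).
    rewrite -big_split; apply: eq_bigr => e _ /=.
    by rewrite andbF andbT expr0 mul1r /yproj mulrDl -scalerAl multilinearD // multilinearZ.
  by rewrite -main; case: (c); rewrite /= !big1_eq ?addr0 ?add0r.
under eq_legwise do rewrite FE.
case: (c == c'); last by rewrite (@legwise0 C X).
rewrite -(@legwiseZ C X); apply: eq_legwise => l.
by rewrite act_odd ?sp //= mulKf.
Qed.

Lemma coloured_adj kap1 c h kap2 f l1 (y : Y) l2 : multilinear f -> size kap1 = size l1 ->
  coloured (kap1 ++ (c, h) :: kap2) f (l1 ++ hadamard_adj H y :: l2) =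
  r ^+ 2 * coloured (kap1 ++ (~~ c, h) :: kap2)
    (if ends false kap1 == h then act Cap (size kap1).*2 (act Cup (size kap1).*2 f)
     else act (Cross c) (size kap1).*2 f) (l1 ++ y :: l2).
Proof.
move=> mf s1; rewrite /coloured !(@legwise_cat C X) //; set g := ends _ _.
have sp := size_projs (V := X) false s1.
rewrite -(@legwiseZ C X) /=; apply: eq_legwise => l.
rewrite yproj_adj; case: eqP => [->|gh].
  rewrite addbb /= multilinearZ // act_even ?sp //= act_even ?sp //=.
  by rewrite expr2 -mulrA mulVKf // mulrCA mulVKf.
have -> : g (+) h = true by case: (g) gh; case: (h).
by rewrite act_even ?sp //= mulVKf // expf_neq0.
Qed.

End Moves.

(** * Closed diagrams of spaces and of graphs *)

Section Generators.
Variables (R : realType) (Z Z' : fqspace R).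
Local Notation C := R[i].

Inductive space_pair : forall k l, 'Hom(tpow Z k, tpow Z l) -> 'Hom(tpow Z' k, tpow Z' l) -> Prop :=
| space_pair_mul : space_pair (fmul Z) (fmul Z')
| space_pair_counit : space_pair (dagger (funit Z)) (dagger (funit Z')).

Inductive graph_pair (A : 'End(Z)) (A' : 'End(Z')) :
    forall k l, 'Hom(tpow Z k, tpow Z l) -> 'Hom(tpow Z' k, tpow Z' l) -> Prop :=
| graph_pair_space k l f f' of @space_pair k l f f' : graph_pair A A' f f'
| graph_pair_adj : graph_pair A A' (tendo A) (tendo A').

Variable B : (seq Z -> C) -> (seq Z' -> C) -> Prop.

Lemma span2Z a phi phi' : span2 B phi phi' ->
  span2 B (fun s => a * phi s) (fun s => a * phi' s).
Proof.
move=> sp; have := span2_lin a 0 sp sp.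
rewrite (_ : (fun s => a * phi s + 0 * phi s) = (fun s => a * phi s)); last first.
  by apply/funext => s; rewrite mul0r addr0.
rewrite (_ : (fun s => a * phi' s + 0 * phi' s) = (fun s => a * phi' s)) //.
by apply/funext => s; rewrite mul0r addr0.
Qed.

Lemma span2_0 phi phi' : span2 B phi phi' -> span2 B (fun _ => 0) (fun _ => 0).
Proof.
move=> sp; have := span2Z 0 sp.
rewrite (_ : (fun s => 0 * phi s) = (fun _ => 0)); last first.
  by apply/funext => s; rewrite mul0r.
rewrite (_ : (fun s => 0 * phi' s) = (fun _ => 0)) //.
by apply/funext => s; rewrite mul0r.
Qed.

End Generators.

Section Comparison.
Variables (R : realType) (X X' : fqspace R) (H : 'End(X)) (H' : 'End(X')).
Local Notation C := R[i].
Hypotheses (hH : quantum_hadamard H) (hH' : quantum_hadamard H').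
Variables (r : C) (E : seq (X * X)) (E' : seq (X' * X')).
Hypotheses (r0 : r != 0) (r4 : fpsi X 1 = r ^+ 4) (r4' : fpsi X' 1 = r ^+ 4).
Hypotheses (cE : copairing E) (cE' : copairing E').
Let S := hadamard_system hH r4 cE.
Let S' := hadamard_system hH' r4' cE'.

(** Diagrams of the space itself have no crossings, so all regions have the same
    bit. *)
Definition plain_pair (phi : seq X -> C) (phi' : seq X' -> C) :=
  exists u : state r, [/\ planar u, reg u = (fun _ => false), phi = fn u S & phi' = fn u S'].

Lemma reg_ins_plain i : reg_ins i false (fun _ => false) = (fun _ => false).
Proof. by apply/funext => k; reg_tac. Qed.

Lemma reg_del_plain i : reg_del i (fun _ => false) = (fun _ => false).
Proof. by apply/funext => k; reg_tac. Qed.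

Lemma plain_cap i (u : state r) : planar u -> reg u = (fun _ => false) ->
  plain_pair (act Cap i (fn u S)) (act Cap i (fn u S')).
Proof.
move=> pu ru; exists (cap i false u); split=> //; first exact: planar_capT.
by rewrite /= ru reg_ins_plain.
Qed.

Lemma plain_cup i (u : state r) : planar u -> reg u = (fun _ => false) ->
  plain_pair (act Cup i (fn u S)) (act Cup i (fn u S')).
Proof.
move=> pu ru; exists (cup i u); split=> //; first by apply: planar_cupT; rewrite ?ru.
by rewrite /= ru reg_del_plain.
Qed.

Lemma plain_multilinear phi phi' : plain_pair phi phi' -> multilinear phi /\ multilinear phi'.
Proof.
move=> [u [pu _ -> ->]]; have gu := planar_good pu.
by split; [case: (gu S) | case: (gu S')].
Qed.

Lemma plain_stable k l (f : 'Hom(tpow X k, tpow X l)) f' : space_pair f f' ->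
  stable (span2 plain_pair) f f' /\ stable (span2 plain_pair) (dagger f) (dagger f').
Proof.
case=> {k l f f'}; split; apply: span2_stable => p phi phi' [u [pu ru -> ->]];
  have [/= m _] := planar_good pu S; have [/= m' _] := planar_good pu S'.
- exists (fun s => r^-1 * act Cap p.*2.+1 (fn u S) s), (fun s => r^-1 * act Cap p.*2.+1 (fn u S') s).
  split; first by apply: span2Z; apply: span2_base; apply: plain_cap.
    by apply: pulls_mul => // l1 x y l2 s1; rewrite act_odd //= mulKf.
  by apply: pulls_mul => // l1 x y l2 s1; rewrite act_odd //= mulKf.
- exists (fun s => r^-1 * act Cup p.*2.+1 (fn u S) s), (fun s => r^-1 * act Cup p.*2.+1 (fn u S') s).
  split; first by apply: span2Z; apply: span2_base; apply: plain_cup.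
    by apply: (pulls_comul m cE) => l1 x l2 s1; rewrite act_odd //= mulKf.
  by apply: (pulls_comul m' cE') => l1 x l2 s1; rewrite act_odd //= mulKf.
- exists (fun s => r * act Cap p.*2 (fn u S) s), (fun s => r * act Cap p.*2 (fn u S') s).
  split; first by apply: span2Z; apply: span2_base; apply: plain_cap.
    by apply: pulls_counit => // l1 x l2 s1; rewrite act_even //= mulVKf.
  by apply: pulls_counit => // l1 x l2 s1; rewrite act_even //= mulVKf.
exists (fun s => r * act Cup p.*2 (fn u S) s), (fun s => r * act Cup p.*2 (fn u S') s).
split; first by apply: span2Z; apply: span2_base; apply: plain_cup.
  by rewrite daggerK; apply: pulls_unit => // l1 l2 s1; rewrite act_even //= mulVKf.
by rewrite daggerK; apply: pulls_unit => // l1 l2 s1; rewrite act_even //= mulVKf.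
Qed.

Lemma space_isomorphic : quantum_isomorphic X X'.
Proof.
have ml phi phi' := @span2_multilinear _ _ _ _ phi phi' plain_multilinear.
have li a b phi phi' chi chi' := @span2_lin _ _ _ plain_pair a b phi phi' chi chi'.
have ni : span2 plain_pair (@nil_form _ X) (@nil_form _ X').
  apply: span2_base; exists (State 0 (fun _ => false) (fun S => @nil_form C S)).
  by split=> //; apply: planar_nil.
have sc phi phi' : span2 plain_pair phi phi' -> phi [::] = phi' [::].
  apply: span2_scalar => p p' [u [pu _ -> ->]].
  by have [c uc] := planar_scalar pu; rewrite !uc.
have st k l f f' := @plain_stable k l f f'.
exists (@twin_map R X X' (@space_pair R X X')); split.
- apply: (twin_iso ml li ni sc st (space_pair_mul X X') (space_pair_counit X X')).
  + by move=> k l f f' []; split; constructor.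
  + by move=> k l f []; [exists (fmul X') | exists (dagger (funit X'))]; constructor.
  by move=> k l f []; [exists (fmul X) | exists (dagger (funit X))]; constructor.
- apply: (twin_mapE ml li ni sc st (space_pair_mul X X') (space_pair_counit X X')).
  by apply: twin_base; constructor.
apply: (twin_mapE ml li ni sc st (space_pair_mul X X') (space_pair_counit X X')).
by apply: twin_base; constructor.
Qed.

Local Notation Y := (fq_sum4 X).
Local Notation Y' := (fq_sum4 X').

Definition coloured_pair (phi : seq Y -> C) (phi' : seq Y' -> C) :=
  exists kap (u : state r), [/\ planar u, reg u = regs false kap,
    phi = coloured kap (fn u S) & phi' = coloured kap (fn u S')].

Lemma coloured_multilinear phi phi' : coloured_pair phi phi' -> multilinear phi /\ multilinear phi'.
Proof.
move=> [kap [u [pu _ -> ->]]]; have gu := planar_good pu.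
by split; apply: multilinear_coloured; [case: (gu S) | case: (gu S')].
Qed.

Lemma coloured_base kap (u : state r) : planar u -> reg u = regs false kap ->
  span2 coloured_pair (coloured kap (fn u S)) (coloured kap (fn u S')).
Proof. by move=> pu ru; apply: span2_base; exists kap, u. Qed.

(** On rows with too few legs for [T] there is nothing to compute, since
    coloured functionals vanish on longer lists. *)
Lemma pulls_short (X0 : fqspace R) (H0 : 'End(X0)) (h0 : quantum_hadamard H0) E0
    (p0 : fpsi X0 1 = r ^+ 4) (c0 : copairing E0) kap (f : seq (hadamard_system h0 p0 c0) -> C) k l
    (T : 'Hom(tpow (fq_sum4 X0) k, tpow (fq_sum4 X0) l)) p :
  (size kap < p + l)%N -> pulls T p (coloured kap f) (fun _ => 0).
Proof.
move=> sk l1 w l2 s1 _; rewrite /ev big1 // => i _.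
rewrite /coloured legwise_short ?mulr0 //.
by rewrite s1 size_cat size_tlist addnA (leq_trans sk) // leq_addr.
Qed.

Lemma coloured_stable k l (f : 'Hom(tpow Y k, tpow Y l)) f' :
  (forall p kap1 kap2 (u : state r), size kap1 = p -> (l <= size kap2)%N ->
    planar u -> reg u = regs false (kap1 ++ kap2) ->
    exists chi chi', [/\ span2 coloured_pair chi chi',
      pulls f p (coloured (kap1 ++ kap2) (fn u S)) chi &
      pulls f' p (coloured (kap1 ++ kap2) (fn u S')) chi']) ->
  stable (span2 coloured_pair) f f'.
Proof.
move=> h; apply: span2_stable => p phi phi' [kap [u [pu ru -> ->]]].
have [sk|ks] := ltnP (size kap) (p + l).
  exists (fun _ => 0), (fun _ => 0); split; try exact: pulls_short.
  exact: span2_0 (coloured_base pu ru).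
have pk : (p <= size kap)%N by apply: leq_trans ks; rewrite leq_addr.
have := h p (take p kap) (drop p kap) u; rewrite cat_take_drop; apply=> //.
  by rewrite size_takel.
by rewrite size_drop leq_subRL.
Qed.

Lemma coloured_stable_mul : stable (span2 coloured_pair) (fmul Y) (fmul Y').
Proof.
apply: coloured_stable => p kap1 [//|[c h] kap2] u s1 _ pu ru.
have [/= m _] := planar_good pu S; have [/= m' _] := planar_good pu S'.
have pb b : span2 coloured_pair
    (coloured (kap1 ++ (c, b) :: (c, h) :: kap2) (act Cap p.*2.+1 (fn u S)))
    (coloured (kap1 ++ (c, b) :: (c, h) :: kap2) (act Cap p.*2.+1 (fn u S'))).
  apply: (@coloured_base _ (cap p.*2.+1 b u)); first exact: planar_capT.
  by rewrite /= ru -s1 regs_split.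
eexists; eexists; split; first exact: (span2_lin (2%:R * r)^-1 (2%:R * r)^-1 (pb false) (pb true)).
  apply: pulls_mul; first exact: multilinear_coloured.
  by move=> l1 x y l2 sl; rewrite (coloured_mul r0) // ?s1 ?sl.
apply: pulls_mul; first exact: multilinear_coloured.
by move=> l1 x y l2 sl; rewrite (coloured_mul r0) // ?s1 ?sl.
Qed.

Lemma coloured_stable_counit :
  stable (span2 coloured_pair) (dagger (funit Y)) (dagger (funit Y')).
Proof.
apply: coloured_stable => p kap1 kap2 u s1 _ pu ru.
have [/= m _] := planar_good pu S; have [/= m' _] := planar_good pu S'.
have pc c : span2 coloured_pair
    (coloured (kap1 ++ (c, ends false kap1) :: kap2) (act Cap p.*2 (fn u S)))
    (coloured (kap1 ++ (c, ends false kap1) :: kap2) (act Cap p.*2 (fn u S'))).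
  apply: (@coloured_base _ (cap p.*2 c u)); first exact: planar_capT.
  by rewrite /= ru -s1 regs_insert.
eexists; eexists; split; first exact: (span2_lin r r (pc false) (pc true)).
  apply: pulls_counit; first exact: multilinear_coloured.
  by move=> l1 x l2 sl; rewrite (coloured_counit r0) // ?s1 ?sl.
apply: pulls_counit; first exact: multilinear_coloured.
by move=> l1 x l2 sl; rewrite (coloured_counit r0) // ?s1 ?sl.
Qed.

Lemma coloured_stable_unit : stable (span2 coloured_pair) (funit Y) (funit Y').
Proof.
apply: coloured_stable => p kap1 [//|[c h] kap2] u s1 _ pu ru.
have [/= m _] := planar_good pu S; have [/= m' _] := planar_good pu S'.
have [gh|gh] := eqVneq (ends false kap1) h.
  have pc : span2 coloured_pair
      (coloured (kap1 ++ kap2) (act Cup p.*2 (fn u S)))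
      (coloured (kap1 ++ kap2) (act Cup p.*2 (fn u S'))).
    apply: (@coloured_base _ (cup p.*2 u)); last by rewrite /= ru -s1 -regs_delete.
    apply: planar_cupT => //; rewrite ru -s1.
    by have [-> _ ->] := regs_at kap1 c h kap2 false.
  eexists; eexists; split; first exact: (span2Z (2%:R * r) pc).
    apply: pulls_unit; first exact: multilinear_coloured.
    by move=> l1 l2 sl; rewrite (coloured_unit r0) // ?s1 ?sl // gh eqxx.
  apply: pulls_unit; first exact: multilinear_coloured.
  by move=> l1 l2 sl; rewrite (coloured_unit r0) // ?s1 ?sl // gh eqxx.
exists (fun _ => 0), (fun _ => 0); split; first exact: span2_0 (coloured_base pu ru).
  apply: pulls_unit; first exact: multilinear_coloured.
  by move=> l1 l2 sl; rewrite (coloured_unit r0) // ?s1 ?sl // (negPf gh).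
apply: pulls_unit; first exact: multilinear_coloured.
by move=> l1 l2 sl; rewrite (coloured_unit r0) // ?s1 ?sl // (negPf gh).
Qed.

Lemma coloured_stable_comul :
  stable (span2 coloured_pair) (dagger (fmul Y)) (dagger (fmul Y')).
Proof.
have cY := sum4_copairing cE; have cY' := sum4_copairing cE'.
apply: coloured_stable => p kap1 [|[c b] [|[c' h] kap2]] // u s1 _ pu ru.
have [/= m _] := planar_good pu S; have [/= m' _] := planar_good pu S'.
have [cc|cc] := eqVneq c c'.
  have pc : span2 coloured_pair
      (coloured (kap1 ++ (c, h) :: kap2) (act Cup p.*2.+1 (fn u S)))
      (coloured (kap1 ++ (c, h) :: kap2) (act Cup p.*2.+1 (fn u S'))).
    apply: (@coloured_base _ (cup p.*2.+1 u)); last by rewrite /= ru -s1 -regs_merge.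
    apply: planar_cupT => //; rewrite ru -s1.
    by have [-> ->] := regs_at2 kap1 c b c' h kap2 false.
  eexists; eexists; split; first exact: (span2Z r^-1 pc).
    apply: (pulls_comul _ cY); first exact: multilinear_coloured.
    by move=> l1 x l2 sl; rewrite (coloured_comul r0) // ?s1 ?sl // cc eqxx.
  apply: (pulls_comul _ cY'); first exact: multilinear_coloured.
  by move=> l1 x l2 sl; rewrite (coloured_comul r0) // ?s1 ?sl // cc eqxx.
exists (fun _ => 0), (fun _ => 0); split; first exact: span2_0 (coloured_base pu ru).
  apply: (pulls_comul _ cY); first exact: multilinear_coloured.
  by move=> l1 x l2 sl; rewrite (coloured_comul r0) // ?s1 ?sl // (negPf cc).
apply: (pulls_comul _ cY'); first exact: multilinear_coloured.
by move=> l1 x l2 sl; rewrite (coloured_comul r0) // ?s1 ?sl // (negPf cc).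
Qed.

Lemma coloured_stable_adj :
  stable (span2 coloured_pair) (tendo (hadamard_adj H)) (tendo (hadamard_adj H')).
Proof.
apply: coloured_stable => p kap1 [//|[c h] kap2] u s1 _ pu ru.
have [/= m _] := planar_good pu S; have [/= m' _] := planar_good pu S'.
pose F (S0 : biunitary r) := if ends false kap1 == h
  then act Cap p.*2 (act Cup p.*2 (fn u S0)) else act (Cross c) p.*2 (fn u S0).
have pc : span2 coloured_pair (coloured (kap1 ++ (~~ c, h) :: kap2) (F S))
    (coloured (kap1 ++ (~~ c, h) :: kap2) (F S')).
  have [e1 e2 e3] := regs_at kap1 c h kap2 false; rewrite /F.
  case: eqP => gh.
    apply: (@coloured_base _ (cap p.*2 (~~ c) (cup p.*2 u))).
      by apply: planar_capT; apply: planar_cupT => //; rewrite ru -s1 e1 e3.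
    by rewrite /= ru -s1 -regs_delete -regs_insert gh.
  have := @coloured_base (kap1 ++ (~~ c, h) :: kap2) (cross p.*2 u).
  rewrite /= (_ : orient (reg u) p.*2 = c); last by rewrite /orient odd_double ru -s1 e2.
  apply; last by rewrite ru -s1 regs_recolour.
  by apply: planar_crossT => //; rewrite ru -s1 e1 e3; apply/eqP.
eexists; eexists; split; first exact: (span2Z (r ^+ 2) pc).
  apply: pulls_endo; first exact: multilinear_coloured.
  by move=> l1 x l2 sl; rewrite (coloured_adj r0) // ?s1 ?sl.
apply: pulls_endo; first exact: multilinear_coloured.
by move=> l1 x l2 sl; rewrite (coloured_adj r0) // ?s1 ?sl.
Qed.

End Comparison.

Section SelfAdjoint.
Variables (R : realType) (X : fqspace R) (H : 'End(X)).
Local Notation Y := (fq_sum4 X).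

(** A self-adjoint generator need not be treated again for its adjoint. *)
Lemma edagger_hadamard_adj : edagger (hadamard_adj H) = hadamard_adj H.
Proof.
apply: (@edaggerE R Y) => x y; rewrite !hadamard_adjE.
have fP := edaggerP (fq_axiom X) (had_plus H); have fM := edaggerP (fq_axiom X) (had_minus H).
rewrite /had_adj_fun; move: (edagger (had_plus H)) (edagger (had_minus H)) fP fM => P' M'.
move: (had_plus H) (had_minus H) => P M fP fM.
case: x y => [[[a b] c] d] [[[a' b'] c'] d'].
have fD (u v w : X) : finner (u + v) w = finner u w + finner v w.
  by have := finner_conj (fq_star X) 1 u v w; rewrite scale1r rmorph1 mul1r.
have fDr (u v w : X) : finner u (v + w) = finner u v + finner u w.
  by have := finner_lin 1 u v w; rewrite scale1r mul1r.
have fP' u v : finner (P u) v = finner u (P' v) by rewrite -finner_herm -fP finner_herm.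
have fM' u v : finner (M u) v = finner u (M' v) by rewrite -finner_herm -fM finner_herm.
have fY (p q : Y) : finner p q = finner p.1.1.1 q.1.1.1 + finner p.1.1.2 q.1.1.2 +
   finner p.1.2 q.1.2 + finner p.2 q.2.
  case: p => [[[p1 p2] p3] p4]; case: q => [[[q1 q2] q3] q4].
  by rewrite /finner /= /sum_psi /= /sum_psi /= /sum_psi /=.
rewrite !fY /= !fD !fDr fP' !fM' fP fM fP' fP fM.
set t1 := finner c' _; set t2 := finner d' _; set t3 := finner c' _; set t4 := finner d' _.
set t5 := finner a' _; set t6 := finner b' _; set t7 := finner a' _; set t8 := finner b' _.
move: t1 t2 t3 t4 t5 t6 t7 t8 => t1 t2 t3 t4 t5 t6 t7 t8.
by ring.
Qed.

End SelfAdjoint.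

Section GraphIso.
Variables (R : realType) (X X' : fqspace R) (H : 'End(X)) (H' : 'End(X')).
Local Notation C := R[i].
Hypotheses (hH : quantum_hadamard H) (hH' : quantum_hadamard H').
Variables (r : C) (E : seq (X * X)) (E' : seq (X' * X')).
Hypotheses (r0 : r != 0) (r4 : fpsi X 1 = r ^+ 4) (r4' : fpsi X' 1 = r ^+ 4).
Hypotheses (cE : copairing E) (cE' : copairing E').
Local Notation Y := (fq_sum4 X).
Local Notation Y' := (fq_sum4 X').

Lemma graph_isomorphic :
  quantum_graph_isomorphic (hadamard_graph H) (hadamard_graph H').
Proof.
pose B := coloured_pair hH hH' r4 r4' cE cE'.
pose A := hadamard_adj H; pose A' := hadamard_adj H'.
have ml phi phi' := @span2_multilinear R Y Y' B phi phi' (@coloured_multilinear _ _ _ _ _ hH hH' _ _ _ r4 r4' cE cE').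
have li a b phi phi' chi chi' := @span2_lin R Y Y' B a b phi phi' chi chi'.
have ni : span2 B (@nil_form _ Y) (@nil_form _ Y').
  apply: span2_base; exists [::], (State 0 (fun _ => false) (fun S => @nil_form C S)).
  split; first exact: planar_nil.
  - by apply/funext => -[|[]].
  - by apply/funext => -[].
  by apply/funext => -[].
have sc phi phi' : span2 B phi phi' -> phi [::] = phi' [::].
  apply: span2_scalar => p p' [kap [u [pu _ -> ->]]].
  have [c uc] := planar_scalar pu.
  by case: kap => [|[k h] kap] //=; rewrite /coloured /= !uc.
have st k l f f' : graph_pair A A' f f' ->
    stable (span2 B) f f' /\ stable (span2 B) (@dagger _ Y k l f) (@dagger _ Y' k l f').
  case=> {k l f f'} [k l f f' []|].
  - by split; [exact: coloured_stable_mul | exact: coloured_stable_comul].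
  - by rewrite !daggerK; split; [exact: coloured_stable_counit | exact: coloured_stable_unit].
  rewrite !tendo_dag !edagger_hadamard_adj.
  by split; apply: coloured_stable_adj.
have gm := graph_pair_space A A' (space_pair_mul Y Y').
have gc := graph_pair_space A A' (space_pair_counit Y Y').
exists (@twin_map R Y Y' (graph_pair A A')); split.
- apply: (twin_iso ml li ni sc st gm gc).
  + move=> k l f f' [{}k {}l {}f {}f' []|]; split;
    do ?[exact: graph_gen_adj | apply: graph_gen_space; constructor].
  + move=> k l f [{}k {}l {}f []|].
    * by exists (fmul Y').
    * by exists (dagger (funit Y')).
    by exists (tendo A'); constructor.
  move=> k l f [{}k {}l {}f []|].
  * by exists (fmul Y).
  * by exists (dagger (funit Y)).
  by exists (tendo A); constructor.
- by apply: (twin_mapE ml li ni sc st gm gc); apply: twin_base.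
- by apply: (twin_mapE ml li ni sc st gm gc); apply: twin_base.
by apply: (twin_mapE ml li ni sc st gm gc); apply: twin_base; apply: graph_pair_adj.
Qed.

End GraphIso.

(** * The invariant and the classification *)

Section Converse.
Variables (R : realType) (Z Z' : fqspace R).

(** [eta^dagger eta] is [psi 1] times the identity of scalars, which any
    monoidal dagger-isomorphism fixes. *)
Lemma iso_psi1 (G : hom_family Z) (G' : hom_family Z') (F : hom_map Z Z') :
  monoidal_dagger_iso (generated G) (generated G') F ->
  generated G (dagger (funit Z)) -> F 1 0 (dagger (funit Z)) = dagger (funit Z') ->
  fpsi Z 1 = fpsi Z' 1.
Proof.
move=> [_ Fid Fcomp _ Flin Fdag] gu Fu.
have gu' : generated G (funit Z) by rewrite -[funit Z]daggerK; apply: gen_dagger.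
have Fu' : F 0 1 (funit Z) = funit Z'.
  by rewrite -{1}[funit Z]daggerK Fdag // Fu daggerK.
have circle (W : fqspace R) : (dagger (funit W) \o funit W)%VF =
    fpsi W 1 *: \1%VF + 0 *: \1%VF :> 'End(tpow W 0).
  apply: eq_tpow => v; have [w _ ->] := ptensor_surj v.
  rewrite comp_lfunE funit_ptensor funit_dag scale0r addr0 scale_lfunE id_lfunE.
  by rewrite (ptensor0 w [::]).
have e := Fcomp _ _ _ _ _ gu' gu; rewrite Fu Fu' (circle Z) (circle Z') in e.
have g1 := gen_id G 0.
rewrite (Flin _ _ _ _ _ _ g1 g1) Fid !scale0r !addr0 in e.
have := congr1 (fun f : 'End(tpow Z' 0) => f (ptensor 0 [::]) idx0) e.
by rewrite /= !scale_lfunE !id_lfunE !ffunE !big_ord0 /GRing.scale /= !mulr1.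
Qed.

End Converse.

Theorem theorem6p12 (R : realType) (X X' : fqspace R)
    (H : 'End(X)) (H' : 'End(X'))
    (hH : quantum_hadamard H) (hH' : quantum_hadamard H') :
  (quantum_graph_isomorphic (hadamard_graph H) (hadamard_graph H')
     <-> quantum_isomorphic X X')
  /\ (quantum_isomorphic X X' <-> delta X = delta X').
Proof.
have [E cE] := copairing_exists X; have [E' cE'] := copairing_exists X'.
(* The fourth root [r] of [psi 1] is the square root of [delta]. *)
have sq (W : fqspace R) : fpsi W 1 = sqrtC (delta W) ^+ 4.
  by rewrite (exprM _ 2 2) sqrtCK delta_sq.
have r0 : sqrtC (delta X) != 0.
  by rewrite sqrtC_eq0 -sqrf_eq0 delta_sq psi1_neq0.
have iso_delta : quantum_isomorphic X X' -> delta X = delta X'.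
  move=> [F [iso _ Fu]]; rewrite !deltaE; congr sqrtC.
  by apply: (iso_psi1 iso _ Fu); apply: gen_base; constructor.
have delta_iso : delta X = delta X' -> quantum_isomorphic X X'.
  move=> dd; apply: (space_isomorphic hH hH' r0 (sq X) _ cE cE').
  by rewrite dd sq.
have delta_graph : delta X = delta X' ->
    quantum_graph_isomorphic (hadamard_graph H) (hadamard_graph H').
  move=> dd; apply: (graph_isomorphic hH hH' r0 (sq X) _ cE cE').
  by rewrite dd sq.
have graph_delta : quantum_graph_isomorphic (hadamard_graph H) (hadamard_graph H') ->
    delta X = delta X'.
  move=> [F [iso _ Fu _]]; rewrite !deltaE; congr sqrtC.
  have e4 (W : fqspace R) : fpsi (fq_sum4 W) 1 = fpsi W 1 *+ 4.
    by rewrite !mulrS mulr0n addr0 !addrA.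
  have e : fpsi (fq_sum4 X) 1 = fpsi (fq_sum4 X') 1.
    exact: iso_psi1 iso (gen_base (graph_gen_space (space_gen_counit _))) Fu.
  rewrite (e4 X) (e4 X') in e; apply: (@mulIf _ (4%:R : R[i])); first by rewrite pnatr_eq0.
  by rewrite [LHS]mulr_natr [RHS]mulr_natr.
split; last by split.
by split=> [/graph_delta/delta_iso|/iso_delta/delta_graph].
Qed.
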